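(* Let $\mathcal{A}=\mathcal{A}_\mu(R,\sigma,t)$ be any TGW algebra with index set denoted $V$, such that $R$ is a polynomial algebra $R=R_E=\Bbbk[u_e\mid e\in E]$ (for some index set $E$) and $\mu$ is symmetric. Assume that $\varphi:\mathcal{A}\to A_E(\Bbbk)$ is a map of $R_E$-rings with involution, where $A_E(\Bbbk)$ is the Weyl algebra over $\Bbbk$ with index set $E$. Then $\mathcal{A}$ is consistent (the canonical map $R_E\to\mathcal{A}$ is injective), and there exist a multiquiver $\Gamma=(V,E,s,t)$ with vertex set $V$ and edge set $E$ and a map $\xi:\mathcal{A}\to\mathcal{A}(\Gamma)$ of $\mathbb{Z}V$-graded $R_E$-rings with involution such that $\varphi=\varphi_\Gamma\circ\xi$, where $\varphi_\Gamma:\mathcal{A}(\Gamma)\to A_E(\Bbbk)$ is the canonical representation. Moreover, if $\varphi(X_i)\neq 0$ for each $i\in V$, then $\Gamma$ is uniquely determined and $\mu_{ij}=1$ for all $i,j\in V$ with $i\neq j$.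
   Context: $\Bbbk$ is a field of characteristic zero; rings are associative and unital; $\mathbb{Z}X$ denotes the free abelian group on a set $X$. TGW algebras. A TGW datum $(R,\sigma,t)$ with index set $I$: a $\Bbbk$-algebra $R$, commuting $\Bbbk$-algebra automorphisms $\sigma=(\sigma_i)_{i\in I}$ of $R$, nonzero central elements $t=(t_i)_{i\in I}$ of $R$. Given $\mu=(\mu_{ij})_{i\ne j}$ with $\mu_{ij}\in\Bbbk\setminus\{0\}$, $\mathcal{C}_\mu(R,\sigma,t)$ is the free $R$-ring on symbols $X_i,Y_i$ ($i\in I$) modulo the relations $X_ir=\sigma_i(r)X_i$, $Y_ir=\sigma_i^{-1}(r)Y_i$, $Y_iX_i=t_i$, $X_iY_i=\sigma_i(t_i)$ ($r\in R$, $i\in I$), $X_iY_j=\mu_{ij}Y_jX_i$ ($i\neq j$). It is $\mathbb{Z}I$-graded by $\deg X_i=i$, $\deg Y_i=-i$, $\deg r=0$. The TGW algebra $\mathcal{A}_\mu(R,\sigma,t)$ is the quotient of $\mathcal{C}_\mu(R,\sigma,t)$ by the sum of all graded ideals having zero intersection with the degree-zero component; it is $\mathbb{Z}I$-graded and an $R$-ring via the canonical map $R\to\mathcal{A}_\mu(R,\sigma,t)$. Rings with involution. An involution on a ring $A$ is a $\mathbb{Z}$-linear map $a\mapsto a^*$ with $(ab)^*=b^*a^*$, $(a^* )^*=a$. For a ring $R$, an $R$-ring with involution is a ring $A$ with a ring homomorphism $\rho_A:R\to A$ and an involution such that $\rho_A(r)^*=\rho_A(r)$ for all $r\in R$. A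 map of $R$-rings with involution $k:A\to B$ is a ring homomorphism with $k\circ\rho_A=\rho_B$ and $k(a^* )=k(a)^*$. If $R$ is commutative and $\mu$ is symmetric ($\mu_{ij}=\mu_{ji}$), $\mathcal{A}_\mu(R,\sigma,t)$ is an $R$-ring with involution via $X_i^*=Y_i$, $Y_i^*=X_i$, $r^*=r$. $A_E(\Bbbk)$ is the Weyl algebra: generators $x_e,y_e$ ($e\in E$), relations $[x_e,x_{e'}]=[y_e,y_{e'}]=0$, $[y_e,x_{e'}]=\delta_{ee'}$. It is an $R_E$-ring with involution via $u_e\mapsto y_ex_e$, $x_e^*=y_e$, $y_e^*=x_e$. Multiquivers. A multiquiver $\Gamma=(V,E,s,t)$ consists of sets $V$ (vertices), $E$ (edges) and functions $s,t:E\to (V\times\mathbb{Z}_{>0})\cup\{\emptyset\}$ such that (no loops) if $s(e)=(u,m)$ and $t(e)=(v,n)$ then $u\ne v$; and (local finiteness) for each $v\in V$ only finitely many $e$ have $s(e)\in\{v\}\times\mathbb{Z}_{>0}$ or $t(e)\in\{v\}\times\mathbb{Z}_{>0}$. The incidence matrix is $\gamma:\mathbb{Z}V\to\mathbb{Z}E$, $\gamma(v)=\sum_{e\in E}\gamma_{ev}e$, where $\gamma_{ev}=n$ if $t(e)=(v,n)$, $\gamma_{ev}=-n$ if $s(e)=(v,n)$, and $\gamma_{ev}=0$ otherwise. $\mathcal{A}(\Gamma)$ is the TGW algebra $\mathcal{A}_\mu(R_E,\sigma^\Gamma,t^\Gamma)$ with index set $V$, where all $\mu_{ij}=1$, $R_E=\Bbbk[u_e\mid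 e\in E]$, $\sigma_v(u_e)=u_e-\gamma_{ev}$, $t_v=\prod_{e\in E}u_{ev}$ with $u_{ev}=u_e(u_e+1)\cdots(u_e+\gamma_{ev}-1)$ if $\gamma_{ev}>0$, $u_{ev}=1$ if $\gamma_{ev}=0$, $u_{ev}=(u_e-1)(u_e-2)\cdots(u_e-|\gamma_{ev}|)$ if $\gamma_{ev}<0$. For $k=\sum k_ee\in\mathbb{Z}E$ put $z^k=\prod_e z_e^{(k_e)}\in A_E(\Bbbk)$ with $z_e^{(p)}=x_e^p$ if $p\ge0$ and $z_e^{(p)}=y_e^{-p}$ if $p<0$. The canonical representation $\varphi_\Gamma:\mathcal{A}(\Gamma)\to A_E(\Bbbk)$ is the map of $R_E$-rings with involution with $\varphi_\Gamma(X_v)=z^{\gamma(v)}$, $\varphi_\Gamma(Y_v)=z^{-\gamma(v)}$, $\varphi_\Gamma(u_e)=y_ex_e$. *)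

(* Defs.v *)
From HB Require Import structures.
From mathcomp Require Import all_boot all_order all_algebra finmap.
From mathcomp Require Import boolp classical_sets cardinality fsbigop.
From mathcomp.multinomials Require Import monalg.

Set Implicit Arguments.
Unset Strict Implicit.
Unset Printing Implicit Defensive.

Import GRing.Theory.
Local Open Scope classical_set_scope.
Local Open Scope quotient_scope.
Local Open Scope ring_scope.

(* The free R-ring on the symbols X: ring expressions with constants in R,    *)
(* modulo the congruence generated by the ring axioms and the requirement     *)
(* that constants form a homomorphic image of R.                              *)
Section FreeRing.
Variables (R : pzRingType) (X : Type).

Inductive rterm : Type :=
| Cst of R
| Gen of X
| Add of rterm & rterm
| Opp of rterm
| Mul of rterm & rterm.

HB.instance Definition _ := gen_eqMixin rterm.
HB.instance Definition _ := gen_choiceMixin rterm.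

Inductive req : rterm -> rterm -> Prop :=
| req_refl a : req a a
| req_sym a b : req a b -> req b a
| req_trans b a c : req a b -> req b c -> req a c
| req_add a a' b b' : req a a' -> req b b' -> req (Add a b) (Add a' b')
| req_opp a a' : req a a' -> req (Opp a) (Opp a')
| req_mul a a' b b' : req a a' -> req b b' -> req (Mul a b) (Mul a' b')
| req_addA a b c : req (Add a (Add b c)) (Add (Add a b) c)
| req_addC a b : req (Add a b) (Add b a)
| req_add0 a : req (Add (Cst 0) a) a
| req_addN a : req (Add (Opp a) a) (Cst 0)
| req_mulA a b c : req (Mul a (Mul b c)) (Mul (Mul a b) c)
| req_mul1 a : req (Mul (Cst 1) a) a
| req_mul1r a : req (Mul a (Cst 1)) a
| req_mulDl a b c : req (Mul (Add a b) c) (Add (Mul a c) (Mul b c))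
| req_mulDr a b c : req (Mul a (Add b c)) (Add (Mul a b) (Mul a c))
| req_cstD r s : req (Cst (r + s)) (Add (Cst r) (Cst s))
| req_cstM r s : req (Cst (r * s)) (Mul (Cst r) (Cst s)).

Definition reqb (a b : rterm) : bool := `[< req a b >].

Lemma reqb_equiv : equiv_class_of reqb.
Proof.
split=> [a|a b|b a c].
- by apply/asboolP; exact: req_refl.
- by apply/asboolP/asboolP; exact: req_sym.
- by move=> /asboolP ab /asboolP bc; apply/asboolP; exact: req_trans ab bc.
Qed.

Canonical reqb_equiv_rel := EquivRelPack reqb_equiv.

Definition free_ring := {eq_quot reqb}.
HB.instance Definition _ := Choice.on free_ring.
HB.instance Definition _ := EqQuotient.on free_ring.

Definition fr_pi (a : rterm) : free_ring := \pi_free_ring a.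

Lemma fr_piP a b : fr_pi a = fr_pi b <-> req a b.
Proof. by split=> [/eqmodP/asboolP|h]; last by apply/eqmodP/asboolP. Qed.

Lemma fr_reprK (x : free_ring) : fr_pi (repr x) = x.
Proof. exact: reprK. Qed.

Lemma fr_repr a : req (repr (fr_pi a)) a.
Proof. by apply/fr_piP; rewrite fr_reprK. Qed.

Lemma fr_ind (P : free_ring -> Prop) : (forall a, P (fr_pi a)) -> forall x, P x.
Proof. by move=> h x; rewrite -(fr_reprK x); exact: h. Qed.

Definition fr_cst (r : R) : free_ring := fr_pi (Cst r).
Definition fr_gen (x : X) : free_ring := fr_pi (Gen x).
Definition fr_add (x y : free_ring) := fr_pi (Add (repr x) (repr y)).
Definition fr_opp (x : free_ring) := fr_pi (Opp (repr x)).
Definition fr_mul (x y : free_ring) := fr_pi (Mul (repr x) (repr y)).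

Lemma fr_addE a b : fr_add (fr_pi a) (fr_pi b) = fr_pi (Add a b).
Proof. by apply/fr_piP; apply: req_add; exact: fr_repr. Qed.
Lemma fr_oppE a : fr_opp (fr_pi a) = fr_pi (Opp a).
Proof. by apply/fr_piP; apply: req_opp; exact: fr_repr. Qed.
Lemma fr_mulE a b : fr_mul (fr_pi a) (fr_pi b) = fr_pi (Mul a b).
Proof. by apply/fr_piP; apply: req_mul; exact: fr_repr. Qed.

Lemma fr_addA : associative fr_add.
Proof.
by elim/fr_ind=> a; elim/fr_ind=> b; elim/fr_ind=> c; rewrite !fr_addE;
  apply/fr_piP; exact: req_addA.
Qed.
Lemma fr_addC : commutative fr_add.
Proof.
by elim/fr_ind=> a; elim/fr_ind=> b; rewrite !fr_addE; apply/fr_piP;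
  exact: req_addC.
Qed.
Lemma fr_add0 : left_id (fr_cst 0) fr_add.
Proof. by elim/fr_ind=> a; rewrite fr_addE; apply/fr_piP; exact: req_add0. Qed.
Lemma fr_addN : left_inverse (fr_cst 0) fr_opp fr_add.
Proof.
by elim/fr_ind=> a; rewrite fr_oppE fr_addE; apply/fr_piP; exact: req_addN.
Qed.
HB.instance Definition _ :=
  GRing.isZmodule.Build free_ring fr_addA fr_addC fr_add0 fr_addN.

Lemma fr_mulA : associative fr_mul.
Proof.
by elim/fr_ind=> a; elim/fr_ind=> b; elim/fr_ind=> c; rewrite !fr_mulE;
  apply/fr_piP; exact: req_mulA.
Qed.
Lemma fr_mul1 : left_id (fr_cst 1) fr_mul.
Proof. by elim/fr_ind=> a; rewrite fr_mulE; apply/fr_piP; exact: req_mul1. Qed.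
Lemma fr_mul1r : right_id (fr_cst 1) fr_mul.
Proof. by elim/fr_ind=> a; rewrite fr_mulE; apply/fr_piP; exact: req_mul1r. Qed.
Lemma fr_addrE (x y : free_ring) : x + y = fr_add x y. Proof. by []. Qed.
Lemma fr_mulDl : left_distributive fr_mul +%R.
Proof.
elim/fr_ind=> a; elim/fr_ind=> b; elim/fr_ind=> c.
by rewrite !fr_addrE fr_addE !fr_mulE fr_addE; apply/fr_piP; exact: req_mulDl.
Qed.
Lemma fr_mulDr : right_distributive fr_mul +%R.
Proof.
elim/fr_ind=> a; elim/fr_ind=> b; elim/fr_ind=> c.
by rewrite !fr_addrE fr_addE !fr_mulE fr_addE; apply/fr_piP; exact: req_mulDr.
Qed.
HB.instance Definition _ := GRing.Zmodule_isPzRing.Build free_ring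
  fr_mulA fr_mul1 fr_mul1r fr_mulDl fr_mulDr.

Lemma fr_piD a b : fr_pi (Add a b) = fr_pi a + fr_pi b.
Proof. by rewrite -fr_addE. Qed.
Lemma fr_piN a : fr_pi (Opp a) = - fr_pi a.
Proof. by rewrite -fr_oppE. Qed.
Lemma fr_piM a b : fr_pi (Mul a b) = fr_pi a * fr_pi b.
Proof. by rewrite -fr_mulE. Qed.

Lemma fr_cst_is_zmod_morphism : zmod_morphism fr_cst.
Proof.
have fD r s : fr_cst (r + s) = fr_cst r + fr_cst s.
  by rewrite -fr_piD; apply/fr_piP; exact: req_cstD.
by move=> r s; apply/eqP; rewrite eq_sym subr_eq -fD subrK.
Qed.
HB.instance Definition _ :=
  GRing.isZmodMorphism.Build R free_ring fr_cst fr_cst_is_zmod_morphism.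
Lemma fr_cst_is_monoid_morphism : monoid_morphism fr_cst.
Proof.
by split=> // r s; rewrite -fr_piM; apply/fr_piP; exact: req_cstM.
Qed.
HB.instance Definition _ :=
  GRing.isMonoidMorphism.Build R free_ring fr_cst fr_cst_is_monoid_morphism.
End FreeRing.

Section QuotientRing.
Variable A : pzRingType.
Implicit Types (I S : set A).

Definition two_sided_ideal I : Prop :=
  [/\ I 0, (forall a b, I a -> I b -> I (a - b)) &
      (forall a b, I b -> I (a * b) /\ I (b * a))].

Definition ideal_gen S : set A := smallest two_sided_ideal S.

Lemma ideal_genP S : two_sided_ideal (ideal_gen S).
Proof.
split=> [I [[]]|a b ha hb|a b hb] //.
  move=> I /[dup] hI [[_ hB _] _]; apply: hB; [exact: ha hI | exact: hb hI].
by split=> I /[dup] hI [[_ _ hM] _]; case: (hM a b (hb I hI)).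
Qed.

Lemma sub_ideal_gen S : S `<=` ideal_gen S.
Proof. exact: sub_smallest. Qed.

Lemma ideal_gen_sub S I : two_sided_ideal I -> S `<=` I -> ideal_gen S `<=` I.
Proof. by move=> hI hS a; apply. Qed.

Variable S : set A.

Lemma ideal_gen0 : ideal_gen S 0. Proof. by case: (ideal_genP S). Qed.
Lemma ideal_genB a b : ideal_gen S a -> ideal_gen S b -> ideal_gen S (a - b).
Proof. by case: (ideal_genP S) => _ + _; apply. Qed.
Lemma ideal_genN a : ideal_gen S a -> ideal_gen S (- a).
Proof. by rewrite -sub0r; apply: ideal_genB; exact: ideal_gen0. Qed.
Lemma ideal_genD a b : ideal_gen S a -> ideal_gen S b -> ideal_gen S (a + b).
Proof. by move=> ha hb; rewrite -[b]opprK; apply: ideal_genB; last exact: ideal_genN. Qed.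
Lemma ideal_genMl a b : ideal_gen S b -> ideal_gen S (a * b).
Proof. by case: (ideal_genP S) => _ _ h /(h a)[]. Qed.
Lemma ideal_genMr a b : ideal_gen S b -> ideal_gen S (b * a).
Proof. by case: (ideal_genP S) => _ _ h /(h a)[]. Qed.

Definition qrel (a b : A) : bool := `[< ideal_gen S (a - b) >].

Lemma qrel_equiv : equiv_class_of qrel.
Proof.
split=> [a|a b|b a c].
- by apply/asboolP; rewrite subrr; exact: ideal_gen0.
- by apply/asboolP/asboolP => /ideal_genN; rewrite opprB.
- move=> /asboolP ab /asboolP bc; apply/asboolP.
  by rewrite -(subrK b a) -addrA; exact: ideal_genD.
Qed.

Canonical qrel_equiv_rel := EquivRelPack qrel_equiv.

(* The quotient of A by the two-sided ideal generated by S.                   *)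
Definition quot_ring := {eq_quot qrel}.
HB.instance Definition _ := Choice.on quot_ring.
HB.instance Definition _ := EqQuotient.on quot_ring.

Definition qpi (a : A) : quot_ring := \pi_quot_ring a.

Lemma qpiP a b : qpi a = qpi b <-> ideal_gen S (a - b).
Proof. by split=> [/eqmodP/asboolP|h]; last by apply/eqmodP/asboolP. Qed.

Lemma qreprK (x : quot_ring) : qpi (repr x) = x.
Proof. exact: reprK. Qed.

Lemma qrepr a : ideal_gen S (repr (qpi a) - a).
Proof. by apply/qpiP; rewrite qreprK. Qed.

Lemma q_ind (P : quot_ring -> Prop) : (forall a, P (qpi a)) -> forall x, P x.
Proof. by move=> h x; rewrite -(qreprK x); exact: h. Qed.

Definition q_add (x y : quot_ring) := qpi (repr x + repr y).
Definition q_opp (x : quot_ring) := qpi (- repr x).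
Definition q_mul (x y : quot_ring) := qpi (repr x * repr y).

Lemma q_addE a b : q_add (qpi a) (qpi b) = qpi (a + b).
Proof. by apply/qpiP; rewrite opprD addrACA; apply: ideal_genD; exact: qrepr. Qed.
Lemma q_oppE a : q_opp (qpi a) = qpi (- a).
Proof. by apply/qpiP; rewrite -opprD; apply: ideal_genN; exact: qrepr. Qed.
Lemma q_mulE a b : q_mul (qpi a) (qpi b) = qpi (a * b).
Proof.
apply/qpiP; set a' := repr _; set b' := repr _.
have -> : a' * b' - a * b = a' * (b' - b) + (a' - a) * b.
  by rewrite mulrBr mulrBl addrA subrK.
by apply: ideal_genD; [apply: ideal_genMl|apply: ideal_genMr]; exact: qrepr.
Qed.

Lemma q_addA : associative q_add.
Proof.
by elim/q_ind=> a; elim/q_ind=> b; elim/q_ind=> c; rewrite !q_addE addrA.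
Qed.
Lemma q_addC : commutative q_add.
Proof. by elim/q_ind=> a; elim/q_ind=> b; rewrite !q_addE addrC. Qed.
Lemma q_add0 : left_id (qpi 0) q_add.
Proof. by elim/q_ind=> a; rewrite q_addE add0r. Qed.
Lemma q_addN : left_inverse (qpi 0) q_opp q_add.
Proof. by elim/q_ind=> a; rewrite q_oppE q_addE addNr. Qed.
HB.instance Definition _ :=
  GRing.isZmodule.Build quot_ring q_addA q_addC q_add0 q_addN.

Lemma q_mulA : associative q_mul.
Proof.
by elim/q_ind=> a; elim/q_ind=> b; elim/q_ind=> c; rewrite !q_mulE mulrA.
Qed.
Lemma q_mul1 : left_id (qpi 1) q_mul.
Proof. by elim/q_ind=> a; rewrite q_mulE mul1r. Qed.
Lemma q_mul1r : right_id (qpi 1) q_mul.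
Proof. by elim/q_ind=> a; rewrite q_mulE mulr1. Qed.
Lemma q_addrE (x y : quot_ring) : x + y = q_add x y. Proof. by []. Qed.
Lemma q_mulDl : left_distributive q_mul +%R.
Proof.
elim/q_ind=> a; elim/q_ind=> b; elim/q_ind=> c.
by rewrite !q_addrE q_addE !q_mulE q_addE mulrDl.
Qed.
Lemma q_mulDr : right_distributive q_mul +%R.
Proof.
elim/q_ind=> a; elim/q_ind=> b; elim/q_ind=> c.
by rewrite !q_addrE q_addE !q_mulE q_addE mulrDr.
Qed.
HB.instance Definition _ := GRing.Zmodule_isPzRing.Build quot_ring
  q_mulA q_mul1 q_mul1r q_mulDl q_mulDr.

Lemma qpi_is_zmod_morphism : zmod_morphism qpi.
Proof. by move=> a b; rewrite -q_addE -q_oppE. Qed.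
HB.instance Definition _ :=
  GRing.isZmodMorphism.Build A quot_ring qpi qpi_is_zmod_morphism.
Lemma qpi_is_monoid_morphism : monoid_morphism qpi.
Proof. by split=> // a b; rewrite -q_mulE. Qed.
HB.instance Definition _ :=
  GRing.isMonoidMorphism.Build A quot_ring qpi qpi_is_monoid_morphism.

Lemma qpi_eq0 a : qpi a = 0 <-> ideal_gen S a.
Proof. by rewrite -[0]/(qpi 0) qpiP subr0. Qed.

End QuotientRing.

Definition is_antihom (A B : pzRingType) (f : A -> B) : Prop :=
  [/\ {morph f : a b / a + b}, f 1 = 1 & forall a b, f (a * b) = f b * f a].

Definition is_involution (A : pzRingType) (st : A -> A) : Prop :=
  [/\ {morph st : a b / a + b}, (forall a b, st (a * b) = st b * st a)
    & involutive st].

Section AntiHom.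
Variables (A B : pzRingType) (f : A -> B) (hf : is_antihom f).
Lemma antihomD a b : f (a + b) = f a + f b. Proof. by case: hf. Qed.
Lemma antihomM a b : f (a * b) = f b * f a. Proof. by case: hf. Qed.
Lemma antihom0 : f 0 = 0.
Proof. by apply: (addrI (f 0)); rewrite -antihomD !addr0. Qed.
Lemma antihomN a : f (- a) = - f a.
Proof. by apply: (addrI (f a)); rewrite -antihomD !subrr antihom0. Qed.
Lemma antihomB a b : f (a - b) = f a - f b.
Proof. by rewrite antihomD antihomN. Qed.
Lemma antihom_sum (s : seq A) : f (\sum_(a <- s) a) = \sum_(a <- s) f a.
Proof.
by elim: s => [|a s IHs]; rewrite ?(big_nil, big_cons) ?antihom0 ?antihomD ?IHs.
Qed.
End AntiHom.

Lemma involution_antihom (A : pzRingType) (st : A -> A) :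
  is_involution st -> is_antihom st.
Proof.
move=> [hD hM hK]; split=> //.
by have := hM (st 1) 1; rewrite mulr1 hK mulr1 => <-.
Qed.

(* The map induced on the quotient; meaningful when st preserves the ideal.   *)
Section QuotientStar.
Variables (A : pzRingType) (S : set A) (st : A -> A).

Definition qstar (x : quot_ring S) : quot_ring S := qpi S (st (repr x)).

Hypotheses (st_inv : is_involution st).
Hypothesis (st_S : forall a, S a -> ideal_gen S (st a)).

Let st_anti := involution_antihom st_inv.

Lemma st_ideal_gen a : ideal_gen S a -> ideal_gen S (st a).
Proof.
move: a; apply: (@ideal_gen_sub _ S (fun a => ideal_gen S (st a))) => //.
split=> [|a b ha hb|a b hb].
- by rewrite (antihom0 st_anti); exact: ideal_gen0.
- by rewrite (antihomB st_anti); exact: ideal_genB.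
- rewrite !(antihomM st_anti); split; [exact: ideal_genMr|exact: ideal_genMl].
Qed.

Lemma qstarE a : qstar (qpi S a) = qpi S (st a).
Proof.
by apply/qpiP; rewrite -(antihomB st_anti); apply: st_ideal_gen; exact: qrepr.
Qed.

Lemma qstar_inv : is_involution qstar.
Proof.
case: st_inv => hD hM hK; split.
- elim/q_ind=> a; elim/q_ind=> b.
  by rewrite -rmorphD !qstarE hD rmorphD.
- elim/q_ind=> a; elim/q_ind=> b.
  by rewrite -rmorphM !qstarE hM rmorphM.
- by elim/q_ind=> a; rewrite !qstarE hK.
Qed.
End QuotientStar.

Inductive xy_gen (I : Type) : Type := GX of I | GY of I.
Arguments GX {I} i.
Arguments GY {I} i.

Section FreeStar.
Variables (R : comPzRingType) (I : Type).

Fixpoint term_star (a : rterm R (xy_gen I)) : rterm R (xy_gen I) :=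
  match a with
  | Cst r => Cst _ r
  | Gen (GX i) => Gen _ (GY i)
  | Gen (GY i) => Gen _ (GX i)
  | Add a b => Add (term_star a) (term_star b)
  | Opp a => Opp (term_star a)
  | Mul a b => Mul (term_star b) (term_star a)
  end.

Lemma term_star_req a b : req a b -> req (term_star a) (term_star b).
Proof.
elim=> {a b} //=; try by constructor.
- by move=> b a c _ + _; exact: req_trans.
- by move=> a b c; apply: req_sym; constructor.
- by move=> r s; rewrite mulrC; constructor.
Qed.

Lemma term_starK : involutive term_star.
Proof.
by elim=> //= [[]//|a -> b ->|a ->|a -> b ->].
Qed.

Definition free_star (x : free_ring R (xy_gen I)) : free_ring R (xy_gen I) :=
  fr_pi (term_star (repr x)).

Lemma free_starE a : free_star (fr_pi a) = fr_pi (term_star a).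
Proof. by apply/fr_piP/term_star_req/fr_repr. Qed.

Lemma free_star_inv : is_involution free_star.
Proof.
split.
- elim/fr_ind=> a; elim/fr_ind=> b.
  by rewrite -fr_piD !free_starE /= fr_piD.
- elim/fr_ind=> a; elim/fr_ind=> b.
  by rewrite -fr_piM !free_starE /= fr_piM.
- by elim/fr_ind=> a; rewrite !free_starE term_starK.
Qed.

Lemma free_star_cst r : free_star (fr_cst _ r) = fr_cst _ r.
Proof. exact: free_starE. Qed.
Lemma free_star_X i : free_star (fr_gen R (GX i)) = fr_gen R (GY i).
Proof. exact: free_starE. Qed.
Lemma free_star_Y i : free_star (fr_gen R (GY i)) = fr_gen R (GX i).
Proof. exact: free_starE. Qed.
End FreeStar.

Record inv_ring (R : pzRingType) := InvRing {
  inv_sort :> pzRingType;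
  inv_rho : {rmorphism R -> inv_sort};
  inv_star : inv_sort -> inv_sort;
  inv_starP : is_involution inv_star;
  inv_star_rho : forall r, inv_star (inv_rho r) = inv_rho r }.

Record inv_map (R : pzRingType) (A B : inv_ring R) := InvMap {
  inv_fun :> {rmorphism A -> B};
  inv_map_rho : forall r, inv_fun (inv_rho A r) = inv_rho B r;
  inv_map_star : forall a, inv_fun (inv_star a) = inv_star (inv_fun a) }.

Record tgw_datum (k : fieldType) (R : algType k) (V : choiceType) := TgwDatum {
  tgw_sigma : V -> {lrmorphism R -> R};
  tgw_sigmaV : V -> R -> R;
  tgw_sigmaK : forall i, cancel (tgw_sigma i) (tgw_sigmaV i);
  tgw_sigmaVK : forall i, cancel (tgw_sigmaV i) (tgw_sigma i);
  tgw_sigmaC : forall i j r,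
    tgw_sigma i (tgw_sigma j r) = tgw_sigma j (tgw_sigma i r);
  tgw_t : V -> R;
  tgw_t_neq0 : forall i, tgw_t i != 0;
  tgw_t_central : forall i r, tgw_t i * r = r * tgw_t i }.

Section TGW.
Variables (k : fieldType) (R : algType k) (V : choiceType).
Variables (D : tgw_datum R V) (mu : V -> V -> k).

Local Notation F := (free_ring R (xy_gen V)).
Local Notation cst := (@fr_cst R (xy_gen V)).
Local Notation X i := (fr_gen R (GX i)).
Local Notation Y i := (fr_gen R (GY i)).

Inductive tgw_rel : set F :=
| TgwXr i r : tgw_rel (X i * cst r - cst (tgw_sigma D i r) * X i)
| TgwYr i r : tgw_rel (Y i * cst r - cst (tgw_sigmaV D i r) * Y i)
| TgwYX i : tgw_rel (Y i * X i - cst (tgw_t D i))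
| TgwXY i : tgw_rel (X i * Y i - cst (tgw_sigma D i (tgw_t D i)))
| TgwXYmu i j : i != j -> tgw_rel (X i * Y j - cst (mu i j)%:A * (Y j * X i)).

Definition tgwc := quot_ring tgw_rel.
HB.instance Definition _ := GRing.PzRing.on tgwc.

Definition tgwc_pi (a : F) : tgwc := qpi tgw_rel a.
HB.instance Definition _ := GRing.RMorphism.copy tgwc_pi (qpi tgw_rel).

Definition tgwc_rho (r : R) : tgwc := tgwc_pi (cst r).
Definition tgwc_X (i : V) : tgwc := tgwc_pi (X i).
Definition tgwc_Y (i : V) : tgwc := tgwc_pi (Y i).

Inductive tgwc_homog : {malg int[V]} -> tgwc -> Prop :=
| homog_rho r : tgwc_homog 0 (tgwc_rho r)
| homog_X i : tgwc_homog << i >> (tgwc_X i)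
| homog_Y i : tgwc_homog (- << i >>) (tgwc_Y i)
| homog_0 g : tgwc_homog g 0
| homog_B g a b : tgwc_homog g a -> tgwc_homog g b -> tgwc_homog g (a - b)
| homog_M g h a b :
    tgwc_homog g a -> tgwc_homog h b -> tgwc_homog (g + h) (a * b).

Definition graded_ideal (I : set tgwc) : Prop :=
  two_sided_ideal I /\
  forall a, I a -> exists2 s : seq tgwc,
    (forall b, b \in s -> I b /\ exists g, tgwc_homog g b)
    & a = \sum_(b <- s) b.

Definition tgwc_null_ideal (I : set tgwc) : Prop :=
  graded_ideal I /\ forall a, I a -> tgwc_homog 0 a -> a = 0.

(* The sum of all graded ideals meeting the degree-zero component trivially.  *)
Definition tgwc_rad : set tgwc := [set a | exists2 s : seq tgwc,
  (forall b, b \in s -> exists2 I, tgwc_null_ideal I & I b)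
  & a = \sum_(b <- s) b].

Lemma tgwc_rad_ideal : two_sided_ideal tgwc_rad.
Proof.
have radM a b : tgwc_rad b -> tgwc_rad (a * b) /\ tgwc_rad (b * a).
  move=> [s hs ->]; split.
    exists [seq a * c | c <- s]; last by rewrite big_map mulr_sumr.
    move=> _ /mapP[c /hs[I hI Ic] ->]; exists I => //.
    by case: hI => -[[_ _ h] _] _; case: (h a c Ic).
  exists [seq c * a | c <- s]; last by rewrite big_map mulr_suml.
  move=> _ /mapP[c /hs[I hI Ic] ->]; exists I => //.
  by case: hI => -[[_ _ h] _] _; case: (h a c Ic).
split=> //; first by exists [::]; rewrite ?big_nil.
move=> a b [s hs ->] /(radM (-1))[]; rewrite mulN1r => -[s' hs' ->] _.
exists (s ++ s'); last by rewrite big_cat.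
by move=> c; rewrite mem_cat => /orP[/hs|/hs'].
Qed.

Lemma tgwc_rad_gen : ideal_gen tgwc_rad = tgwc_rad.
Proof.
apply/seteqP; split; last exact: sub_ideal_gen.
by apply: ideal_gen_sub => //; exact: tgwc_rad_ideal.
Qed.

Definition tgw := quot_ring tgwc_rad.
HB.instance Definition _ := GRing.PzRing.on tgw.

Definition tgw_pi (a : tgwc) : tgw := qpi tgwc_rad a.
HB.instance Definition _ := GRing.RMorphism.copy tgw_pi (qpi tgwc_rad).

Definition tgw_X (i : V) : tgw := tgw_pi (tgwc_X i).
Definition tgw_Y (i : V) : tgw := tgw_pi (tgwc_Y i).
Definition tgw_rho : R -> tgw := tgw_pi \o tgwc_pi \o @fr_cst R (xy_gen V).
HB.instance Definition _ :=
  GRing.RMorphism.copy tgw_rho (tgw_pi \o tgwc_pi \o @fr_cst R (xy_gen V)).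

Definition tgw_homog (g : {malg int[V]}) : set tgw := tgw_pi @` tgwc_homog g.

End TGW.

Section TGWStar.
Variables (k : fieldType) (R : comAlgType k) (V : choiceType).
Variables (D : tgw_datum R V) (mu : V -> V -> k).

Definition tgwc_star (a : tgwc D mu) : tgwc D mu := qstar (@free_star R V) a.
Definition tgw_star (a : tgw D mu) : tgw D mu := qstar tgwc_star a.

Hypothesis mu_sym : forall i j, i != j -> mu i j = mu j i.

Lemma tgw_rel_star a : tgw_rel D mu a -> ideal_gen (tgw_rel D mu) (free_star a).
Proof.
have hs := involution_antihom (@free_star_inv R V).
have rel b : tgw_rel D mu b -> qpi (tgw_rel D mu) b = 0.
  by move=> hb; apply/qpi_eq0; exact: sub_ideal_gen.
have relB b c : tgw_rel D mu (b - c) ->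
    qpi (tgw_rel D mu) b = qpi (tgw_rel D mu) c.
  by move=> /rel; rewrite rmorphB /= => /eqP; rewrite subr_eq0 => /eqP.
case=> [i r|i r|i|i|i j ij]; apply/qpi_eq0;
  rewrite (antihomB hs) rmorphB /= !(antihomM hs)
    ?free_star_cst ?free_star_X ?free_star_Y; apply/eqP; rewrite subr_eq0;
  apply/eqP.
- by rewrite (relB _ _ (TgwYr D mu i (tgw_sigma D i r))) tgw_sigmaK.
- by rewrite (relB _ _ (TgwXr D mu i (tgw_sigmaV D i r))) tgw_sigmaVK.
- exact: (relB _ _ (TgwYX D mu i)).
- exact: (relB _ _ (TgwXY D mu i)).
- have ji : j != i by rewrite eq_sym.
  rewrite (relB _ _ (TgwXYmu D mu ji)) -mu_sym //; set c := (mu i j)%:A.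
  have sc i' : tgw_sigma D i' c = c by rewrite linearZ /= rmorph1.
  have sVc i' : tgw_sigmaV D i' c = c.
    by rewrite -{1}(sc i') tgw_sigmaK.
  rewrite -[in RHS]mulrA [RHS]rmorphM /= (relB _ _ (TgwXr D mu j c)) sc.
  rewrite -[RHS]rmorphM /= [in RHS]mulrA [RHS]rmorphM /= (relB _ _ (TgwYr D mu i c)) sVc.
  by rewrite -rmorphM /= mulrA.
Qed.

Lemma tgwc_star_inv : is_involution tgwc_star.
Proof. apply: qstar_inv; [exact: free_star_inv | exact: tgw_rel_star]. Qed.

Lemma tgwc_starE a : tgwc_star (tgwc_pi D mu a) = tgwc_pi D mu (free_star a).
Proof. apply: qstarE; [exact: free_star_inv | exact: tgw_rel_star]. Qed.

Lemma tgwc_star_homog g a : tgwc_homog g a -> tgwc_homog (- g) (tgwc_star a).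
Proof.
have hs := involution_antihom tgwc_star_inv.
elim=> {g a} [r|i|i|g|g a b _ IHa _ IHb|g h a b _ IHa _ IHb].
- by rewrite oppr0 tgwc_starE free_star_cst; exact: homog_rho.
- by rewrite tgwc_starE free_star_X; exact: homog_Y.
- by rewrite opprK tgwc_starE free_star_Y; exact: homog_X.
- by rewrite (antihom0 hs); exact: homog_0.
- by rewrite (antihomB hs); exact: homog_B.
- by rewrite (antihomM hs) opprD addrC; exact: homog_M.
Qed.

Lemma tgwc_null_ideal_star I :
  tgwc_null_ideal I -> tgwc_null_ideal (tgwc_star @^-1` I).
Proof.
have hs := involution_antihom tgwc_star_inv.
have [_ _ sK] := tgwc_star_inv.
move=> [[[I0 IB IM] Igr] Iz]; split; [split|].
- split=> [|a b|a b]; rewrite /preimage /= ?(antihom0 hs) //.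
    by rewrite (antihomB hs); exact: IB.
  by move=> /(IM (tgwc_star a))[]; rewrite !(antihomM hs).
- move=> a /Igr[s hs' ha]; exists (map tgwc_star s).
    move=> _ /mapP[b /hs'[Ib [g hg]] ->]; split; first by rewrite /preimage /= sK.
    by exists (- g); exact: tgwc_star_homog.
  by rewrite big_map -(antihom_sum hs) -ha sK.
- move=> a Ia ha; rewrite -[a]sK (Iz (tgwc_star a)) ?(antihom0 hs) //.
  by rewrite -oppr0; exact: tgwc_star_homog.
Qed.

Lemma tgwc_rad_star a :
  tgwc_rad a -> ideal_gen (@tgwc_rad _ _ _ D mu) (tgwc_star a).
Proof.
have hs := involution_antihom tgwc_star_inv.
have [_ _ sK] := tgwc_star_inv.
move=> [s hs' ->]; apply: sub_ideal_gen; exists (map tgwc_star s); last first.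
  by rewrite big_map (antihom_sum hs).
move=> _ /mapP[b /hs'[I hI Ib] ->]; exists (tgwc_star @^-1` I).
  exact: tgwc_null_ideal_star.
by rewrite /preimage /= sK.
Qed.

Lemma tgw_star_inv : is_involution tgw_star.
Proof. apply: qstar_inv; [exact: tgwc_star_inv | exact: tgwc_rad_star]. Qed.

Lemma tgw_starE a :
  tgw_star (tgw_pi (tgwc_pi D mu a)) = tgw_pi (tgwc_pi D mu (free_star a)).
Proof.
rewrite -tgwc_starE; apply: qstarE; [exact: tgwc_star_inv|exact: tgwc_rad_star].
Qed.

Lemma tgw_star_X i : tgw_star (tgw_X D mu i) = tgw_Y D mu i.
Proof. by rewrite tgw_starE free_star_X. Qed.
Lemma tgw_star_Y i : tgw_star (tgw_Y D mu i) = tgw_X D mu i.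
Proof. by rewrite tgw_starE free_star_Y. Qed.
Lemma tgw_star_rho r : tgw_star (tgw_rho D mu r) = tgw_rho D mu r.
Proof. by rewrite tgw_starE free_star_cst. Qed.

Definition tgw_inv : inv_ring R :=
  @InvRing R (tgw D mu) (tgw_rho D mu) tgw_star tgw_star_inv tgw_star_rho.
End TGWStar.

Notation polyring k E := {malg k[{cmonom E}]}.

Section PolyEval.
Variables (k : fieldType) (E : choiceType).

Definition pvar (e : E) : polyring k E := << ucm e >>.

Section Eval.
Variables (S : pzRingType) (f : k -> S) (h : E -> S).

Definition mon_eval (m : {cmonom E}) : S := \prod_(e <- finsupp m) h e ^+ m e.

(* When S is not commutative this is only used with central f c and pairwise  *)
(* commuting h e, so that the order of the factors is irrelevant.             *)
Definition peval (p : polyring k E) : S :=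
  \sum_(m <- msupp p) f p@_m * mon_eval m.
End Eval.

Section EvalTheory.
Variables (S : pzRingType) (f : {rmorphism k -> S}) (h : E -> S).
Hypothesis fC : forall c e, GRing.comm (f c) (h e).
Hypothesis hC : forall e e', GRing.comm (h e) (h e').

Lemma prod_comm_perm (F : E -> S) (s t : seq E) :
  (forall e e', GRing.comm (F e) (F e')) -> perm_eq s t ->
  \prod_(e <- s) F e = \prod_(e <- t) F e.
Proof.
move=> FC; elim: s t => [|e s IHs] t st.
  by move: st; rewrite perm_sym => /perm_nilP ->; rewrite !big_nil.
have : e \in t by rewrite -(perm_mem st) mem_head.
move=> et; move: st; case/splitPr: et => t1 t2.
rewrite perm_sym -[e :: t2]cat1s perm_catCA /= perm_sym perm_cons => /IHs {}IHs.
rewrite big_cons IHs !big_cat /= big_cons !mulrA; congr (_ * _).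
by apply: commr_prod => i _; exact: FC.
Qed.

Lemma prod_commM (F G : E -> S) (s : seq E) :
  (forall e e', GRing.comm (F e) (G e')) ->
  \prod_(e <- s) (F e * G e) = \prod_(e <- s) F e * \prod_(e <- s) G e.
Proof.
move=> FG; elim: s => [|e s IHs]; rewrite ?(big_nil, big_cons) ?mulr1 //.
rewrite IHs !mulrA; congr (_ * _); rewrite -!mulrA; congr (_ * _).
by apply: commr_prod => i _; apply: commr_sym; exact: FG.
Qed.

Lemma mon_evalEw (d : {fset E}) (m : {cmonom E}) : (finsupp m `<=` d)%fset ->
  mon_eval h m = \prod_(e <- d) h e ^+ m e.
Proof.
move=> /fsubsetP md.
transitivity (\prod_(e <- d | e \in finsupp m) h e ^+ m e); last first.
  rewrite big_mkcond /=; apply: eq_bigr => e _.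
  by case: finsuppP.
rewrite -big_filter; apply: prod_comm_perm.
  by move=> e e'; apply/commrX/commr_sym/commrX.
apply: uniq_perm; rewrite ?filter_uniq ?fset_uniq // => e.
by rewrite mem_filter; case: (boolP (e \in finsupp m)) => // /md ->.
Qed.

Lemma mon_eval1 : mon_eval h mone = 1.
Proof. by rewrite /mon_eval mdom1 big_seq_fset0. Qed.

Lemma mon_evalM m n : mon_eval h (mmul m n) = mon_eval h m * mon_eval h n.
Proof.
rewrite (@mon_evalEw (finsupp m `|` finsupp n)%fset) ?mdomD //.
rewrite (@mon_evalEw (finsupp m `|` finsupp n)%fset m) ?fsubsetUl //.
rewrite (@mon_evalEw (finsupp m `|` finsupp n)%fset n) ?fsubsetUr //.
rewrite -prod_commM; last by move=> e e'; apply/commrX/commr_sym/commrX.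
by apply: eq_bigr => e _; rewrite cmM exprD.
Qed.

Lemma mon_evalU e : mon_eval h (ucm e) = h e.
Proof. by rewrite /mon_eval mdomU big_seq_fset1 cmUU expr1. Qed.

Lemma pevalEw (d : {fset {cmonom E}}) p : (msupp p `<=` d)%fset ->
  peval f h p = \sum_(m <- d) f p@_m * mon_eval h m.
Proof.
move=> le; rewrite [LHS](big_fset_incl _ le) => //= x xd /mcoeff_outdom ->.
by rewrite rmorph0 mul0r.
Qed.

Lemma peval_monom c m : peval f h << c *g m >> = f c * mon_eval h m.
Proof. by rewrite (pevalEw (msuppU_le)) big_seq_fset1 mcoeffUU. Qed.

Lemma peval_zmod : zmod_morphism (peval f h).
Proof.
move=> p q; pose d := (msupp p `|` msupp q)%fset.
rewrite (@pevalEw d) ?msuppB_le // (@pevalEw d p) ?fsubsetUl //.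
rewrite (@pevalEw d q) ?fsubsetUr // -sumrB; apply: eq_bigr => m _.
by rewrite mcoeffB rmorphB mulrBl.
Qed.

Lemma peval_sum (I : Type) (s : seq I) (F : I -> polyring k E) :
  peval f h (\sum_(i <- s) F i) = \sum_(i <- s) peval f h (F i).
Proof.
have p0 : peval f h 0 = 0 by rewrite -(subr0 0) peval_zmod subrr.
have pN q : peval f h (- q) = - peval f h q.
  by rewrite -sub0r peval_zmod p0 sub0r.
have pD p q : peval f h (p + q) = peval f h p + peval f h q.
  by rewrite -{1}[q]opprK peval_zmod pN opprK.
by elim: s => [|i s IHs]; rewrite ?(big_nil, big_cons) // pD IHs.
Qed.

Lemma peval_monoid : monoid_morphism (peval f h).
Proof.
split; first by rewrite -[1]/(<< mone >>) peval_monom rmorph1 mul1r mon_eval1.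
move=> p q; rewrite malgME peval_sum mulr_suml; apply: eq_bigr => m _.
rewrite peval_sum mulr_sumr; apply: eq_bigr => n _.
rewrite peval_monom rmorphM mon_evalM !mulrA; congr (_ * _).
rewrite -!mulrA; congr (_ * _).
apply: commr_prod => e _; exact/commrX.
Qed.

Lemma pevalU e : peval f h (pvar e) = h e.
Proof. by rewrite peval_monom rmorph1 mul1r mon_evalU. Qed.

Lemma pevalC c : peval f h c%:MP = f c.
Proof. by rewrite peval_monom mon_eval1 mulr1. Qed.
End EvalTheory.

Lemma mon_eval_pvar (m : {cmonom E}) : mon_eval pvar m = << m >>.
Proof.
have UM (a b : {cmonom E}) : (<< mmul a b >> : polyring k E) = << a >> * << b >>.
  by rewrite malgM_def fgmulUU mulr1.
have UX (a : {cmonom E}) n :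
    (<< a >> : polyring k E) ^+ n = << iter n (mmul a) mone >>.
  by elim: n => [//|n IHn]; rewrite exprS IHn /= UM.
have UP (F : E -> {cmonom E}) s : \prod_(e <- s) (<< F e >> : polyring k E) =
    << \big[mmul/mone]_(e <- s) F e >>.
  elim: s => [|e s IHs]; first by rewrite !big_nil.
  by rewrite !big_cons IHs UM.
rewrite /mon_eval; under eq_bigr do rewrite UX; rewrite UP.
congr << _ >>; apply/eqP/cmP => i.
have big_at s (F : E -> {cmonom E}) :
    (\big[mmul/mone]_(e <- s) F e) i = (\sum_(e <- s) F e i)%N.
  by elim: s => [|e s IHs]; rewrite ?(big_nil, big_cons) ?cm1 ?cmM ?IHs.
have iter_at n (a : {cmonom E}) : (iter n (mmul a) mone) i = (n * a i)%N.
  by elim: n => [|n IHn]; rewrite /= ?cm1 // cmM IHn mulSn.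
rewrite big_at; under eq_bigr do rewrite iter_at cmU.
case: (boolP (i \in finsupp m)) => im; last first.
  rewrite big1_seq; first by move: im; rewrite -cmE_eq0 => /eqP.
  move=> e /andP[_ em]; case: eqP => [ei|_]; last by rewrite muln0.
  by move: im; rewrite -ei em.
rewrite (bigD1_seq i) //= eqxx muln1 big1 ?addn0 // => e ei.
by rewrite (negPf ei) muln0.
Qed.

Lemma polyring_ext (S : pzRingType) (f g : {rmorphism polyring k E -> S}) :
  (forall c, f c%:MP = g c%:MP) -> (forall e, f (pvar e) = g (pvar e)) ->
  f =1 g.
Proof.
move=> fgC fgU p; rewrite [p]monalgE !rmorph_sum; apply: eq_bigr => m _.
have -> : << p@_m *g m >> = (p@_m)%:MP * << m >> :> polyring k E.
  by rewrite malgM_def fgmulUU mulr1 mul1m.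
rewrite [LHS]rmorphM [RHS]rmorphM; congr (_ * _).
  exact: fgC.
rewrite -mon_eval_pvar [LHS]rmorph_prod [RHS]rmorph_prod.
by apply: eq_bigr => e _; rewrite [LHS]rmorphXn [RHS]rmorphXn fgU.
Qed.

(* Translation u_e |-> u_e + c_e of the polynomial ring.                      *)
Definition pshift (c : E -> int) : polyring k E -> polyring k E :=
  peval (@malgC {cmonom E} k) (fun e => pvar e + (c e)%:~R).

Lemma pshift_zmod c : zmod_morphism (pshift c).
Proof. exact: peval_zmod. Qed.
HB.instance Definition _ c := GRing.isZmodMorphism.Build
  (polyring k E) (polyring k E) (pshift c) (pshift_zmod c).
Lemma pshift_monoid c : monoid_morphism (pshift c).
Proof. by apply: peval_monoid => *; exact: mulrC. Qed.
HB.instance Definition _ c := GRing.isMonoidMorphism.Build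
  (polyring k E) (polyring k E) (pshift c) (pshift_monoid c).
Lemma pshiftC c a : pshift c a%:MP = a%:MP.
Proof. exact: pevalC. Qed.
Lemma pshiftU c e : pshift c (pvar e) = pvar e + (c e)%:~R.
Proof. exact: pevalU. Qed.
Lemma pshift_scalable c : scalable (pshift c).
Proof. by move=> a p; rewrite -!mul_malgC rmorphM /= pshiftC. Qed.
HB.instance Definition _ c := GRing.isScalable.Build
  k (polyring k E) (polyring k E) *:%R (pshift c) (pshift_scalable c).

Lemma pshift_comp c d p : pshift c (pshift d p) = pshift (fun e => c e + d e) p.
Proof.
apply: (@polyring_ext _ (pshift c \o pshift d)) => [a|e] /=.
  by rewrite !pshiftC.
by rewrite !pshiftU rmorphD rmorph_int /= pshiftU rmorphD addrA.
Qed.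

Lemma pshift0 c p : (forall e, c e = 0) -> pshift c p = p.
Proof.
move=> c0; apply: (@polyring_ext _ (pshift c) idfun) => [a|e] /=.
  exact: pshiftC.
by rewrite pshiftU c0 addr0.
Qed.
End PolyEval.
Arguments pvar {k E} e.

Section Weyl.
Variables (k : fieldType) (E : choiceType).

Local Notation F := (free_ring k (xy_gen E)).
Local Notation cst := (@fr_cst k (xy_gen E)).
Local Notation x e := (fr_gen k (GX e)).
Local Notation y e := (fr_gen k (GY e)).

(* The relations WeylCx, WeylCy turn the free k-ring into a k-algebra.        *)
Inductive weyl_rel : set F :=
| WeylCx c e : weyl_rel (cst c * x e - x e * cst c)
| WeylCy c e : weyl_rel (cst c * y e - y e * cst c)
| Weylxx e e' : weyl_rel (x e * x e' - x e' * x e)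
| Weylyy e e' : weyl_rel (y e * y e' - y e' * y e)
| Weylyx e e' : weyl_rel (y e * x e' - x e' * y e - (e == e')%:R).

Definition weyl := quot_ring weyl_rel.
HB.instance Definition _ := GRing.PzRing.on weyl.

Definition weyl_pi (a : F) : weyl := qpi weyl_rel a.
HB.instance Definition _ := GRing.RMorphism.copy weyl_pi (qpi weyl_rel).

Definition weyl_cst : k -> weyl := weyl_pi \o cst.
HB.instance Definition _ := GRing.RMorphism.copy weyl_cst (weyl_pi \o cst).
Definition weyl_x (e : E) : weyl := weyl_pi (x e).
Definition weyl_y (e : E) : weyl := weyl_pi (y e).

Lemma weyl_relE a b : weyl_rel (a - b) -> weyl_pi a = weyl_pi b.
Proof. by move=> h; apply/qpiP; exact: sub_ideal_gen. Qed.

Lemma weyl_cstx c e : GRing.comm (weyl_cst c) (weyl_x e).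
Proof. by have := weyl_relE (WeylCx c e); rewrite !rmorphM. Qed.
Lemma weyl_csty c e : GRing.comm (weyl_cst c) (weyl_y e).
Proof. by have := weyl_relE (WeylCy c e); rewrite !rmorphM. Qed.
Lemma weyl_xx e e' : GRing.comm (weyl_x e) (weyl_x e').
Proof. by have := weyl_relE (Weylxx e e'); rewrite !rmorphM. Qed.
Lemma weyl_yy e e' : GRing.comm (weyl_y e) (weyl_y e').
Proof. by have := weyl_relE (Weylyy e e'); rewrite !rmorphM. Qed.
Lemma weyl_yx e e' :
  weyl_y e * weyl_x e' - weyl_x e' * weyl_y e = (e == e')%:R.
Proof.
by have := weyl_relE (Weylyx e e'); rewrite rmorphB !rmorphM rmorph_nat.
Qed.
Lemma weyl_yx_comm e e' : e != e' -> GRing.comm (weyl_y e) (weyl_x e').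
Proof.
move=> ee'; apply/eqP; rewrite -subr_eq0 weyl_yx (negPf ee'); exact: eqxx.
Qed.

Definition weyl_u (e : E) : weyl := weyl_y e * weyl_x e.

Lemma weyl_uu e e' : GRing.comm (weyl_u e) (weyl_u e').
Proof.
have [->|ee'] := eqVneq e e'; first exact: commr_refl.
have e'e : e' != e by rewrite eq_sym.
apply: commrM; apply: commr_sym; apply: commrM.
- exact: weyl_yy.
- exact: weyl_yx_comm.
- exact/commr_sym/weyl_yx_comm.
- exact: weyl_xx.
Qed.

Lemma weyl_cstu c e : GRing.comm (weyl_cst c) (weyl_u e).
Proof. by apply: commrM; [exact: weyl_csty | exact: weyl_cstx]. Qed.

Definition weyl_rho : polyring k E -> weyl := peval weyl_cst weyl_u.
Lemma weyl_rho_zmod : zmod_morphism weyl_rho.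
Proof. exact: peval_zmod. Qed.
HB.instance Definition _ :=
  GRing.isZmodMorphism.Build (polyring k E) weyl weyl_rho weyl_rho_zmod.
Lemma weyl_rho_monoid : monoid_morphism weyl_rho.
Proof. by apply: peval_monoid; [exact: weyl_cstu | exact: weyl_uu]. Qed.
HB.instance Definition _ :=
  GRing.isMonoidMorphism.Build (polyring k E) weyl weyl_rho weyl_rho_monoid.

Lemma weyl_rhoU e : weyl_rho (pvar e) = weyl_y e * weyl_x e.
Proof. exact: pevalU. Qed.
Lemma weyl_rhoC c : weyl_rho c%:MP = weyl_cst c.
Proof. exact: pevalC. Qed.

Definition weyl_star (a : weyl) : weyl := qstar (@free_star k E) a.

Lemma weyl_rel_star a : weyl_rel a -> ideal_gen weyl_rel (free_star a).
Proof.
have hs := involution_antihom (@free_star_inv k E).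
case=> [c e|c e|e e'|e e'|e e'];
  rewrite ?(antihomB hs) !(antihomM hs)
    ?free_star_cst ?free_star_X ?free_star_Y.
- by rewrite -opprB; apply: ideal_genN; apply: sub_ideal_gen; exact: WeylCy.
- by rewrite -opprB; apply: ideal_genN; apply: sub_ideal_gen; exact: WeylCx.
- by apply: sub_ideal_gen; exact: Weylyy.
- by apply: sub_ideal_gen; exact: Weylxx.
- apply: sub_ideal_gen; rewrite -(rmorph_nat cst) free_star_cst rmorph_nat.
  by rewrite eq_sym; exact: Weylyx.
Qed.

Lemma weyl_star_inv : is_involution weyl_star.
Proof. apply: qstar_inv; [exact: free_star_inv | exact: weyl_rel_star]. Qed.

Lemma weyl_starE a : weyl_star (weyl_pi a) = weyl_pi (free_star a).
Proof. apply: qstarE; [exact: free_star_inv | exact: weyl_rel_star]. Qed.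
Lemma weyl_star_x e : weyl_star (weyl_x e) = weyl_y e.
Proof. by rewrite weyl_starE free_star_X. Qed.
Lemma weyl_star_y e : weyl_star (weyl_y e) = weyl_x e.
Proof. by rewrite weyl_starE free_star_Y. Qed.

Lemma weyl_star_rho p : weyl_star (weyl_rho p) = weyl_rho p.
Proof.
have hs := involution_antihom weyl_star_inv.
have [_ s1 _] := hs.
have mon_star (m : {cmonom E}) :
    weyl_star (mon_eval weyl_u m) = mon_eval weyl_u m.
  rewrite /mon_eval; elim: (finsupp m : seq E) => [|e s IHs].
    by rewrite big_nil s1.
  rewrite big_cons (antihomM hs) IHs.
  have uX n : weyl_star (weyl_u e ^+ n) = weyl_u e ^+ n.
    elim: n => [|n IHn]; first exact: s1.
    by rewrite exprS (antihomM hs) IHn (antihomM hs) weyl_star_x weyl_star_y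
      -exprSr exprS.
  rewrite uX; apply: commr_sym; apply: commr_prod => e' _.
  by apply/commrX/commr_sym/commrX; exact: weyl_uu.
rewrite /weyl_rho /peval; elim: (msupp p : seq _) => [|m s IHs].
  by rewrite big_nil (antihom0 hs).
rewrite big_cons (antihomD hs) IHs (antihomM hs) mon_star; congr (_ + _).
have -> : weyl_star (weyl_cst p@_m) = weyl_cst p@_m.
  by rewrite weyl_starE free_star_cst.
apply: commr_sym; apply: commr_prod => e _; apply: commrX; exact: weyl_cstu.
Qed.

Definition weyl_inv : inv_ring (polyring k E) :=
  @InvRing (polyring k E) weyl weyl_rho weyl_star weyl_star_inv weyl_star_rho.

Definition weyl_zpow1 (e : E) (p : int) : weyl :=
  match p with
  | Posz n => weyl_x e ^+ n
  | Negz n => weyl_y e ^+ n.+1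
  end.

(* Factors with distinct e commute, so the order of the product is immaterial.*)
Definition weyl_zpow (d : {malg int[E]}) : weyl :=
  \prod_(e <- msupp d) weyl_zpow1 e d@_e.
End Weyl.
Arguments weyl_x {k E} e.
Arguments weyl_y {k E} e.
Arguments weyl_zpow {k E} d.

(* None stands for the empty end; the positive integers are the n with 0 < n. *)
Record multiquiver (V E : choiceType) := Multiquiver {
  mq_s : E -> option (V * nat);
  mq_t : E -> option (V * nat);
  mq_s_gt0 : forall e v n, mq_s e = Some (v, n) -> (0 < n)%N;
  mq_t_gt0 : forall e v n, mq_t e = Some (v, n) -> (0 < n)%N;
  mq_loopless : forall e u m v n,
    mq_s e = Some (u, m) -> mq_t e = Some (v, n) -> u <> v;
  mq_locfin : forall v, finite_set
    [set e | (exists n, mq_s e = Some (v, n)) \/ exists n, mq_t e = Some (v, n)]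
}.

Section Quiver.
Variables (k : fieldType) (V E : choiceType) (G : multiquiver V E).

Definition mq_gamma (e : E) (v : V) : int :=
  let outgoing : int :=
    if mq_s G e is Some (w, n) then (if w == v then - n%:Z else 0) else 0 in
  if mq_t G e is Some (w, n) then (if w == v then n%:Z else outgoing)
  else outgoing.

Lemma mq_gamma_finite v : finite_set [set e | mq_gamma e v != 0].
Proof.
apply: sub_finite_set (mq_locfin G v) => e /=; rewrite /mq_gamma.
have out : (if mq_s G e is Some (w, n) then
    (if w == v then - n%:Z else 0) else 0) != 0 :> int ->
    exists n, mq_s G e = Some (v, n).
  by case: mq_s => [[w n]|//]; have [->|//] := eqVneq w v; exists n.
case: mq_t => [[w n]|]; last by move=> /out; left.
by have [->|_] := eqVneq w v; [right; exists n | move=> /out; left].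
Qed.

Definition mq_incidence (v : V) : {malg int[E]} :=
  \sum_(e \in [set: E]) << mq_gamma e v *g e >>.

Lemma mq_incidenceE v e : (mq_incidence v)@_e = mq_gamma e v.
Proof.
have fin : finite_set
    ([set: E] `&` (fun e => << mq_gamma e v *g e >>) @^-1` [set~ 0]).
  apply: sub_finite_set (mq_gamma_finite v) => e' /= [_] /eqP.
  by rewrite monalgU_eq0.
rewrite /mq_incidence raddf_sum /=.
under eq_bigr do rewrite mcoeffU.
have [es|es] := boolP (e \in finite_support 0 [set: E]
    (fun e => << mq_gamma e v *g e >>)).
  rewrite (bigD1_seq e) //= eqxx big1 ?addr0 // => e' /negPf ->.
  by rewrite mulr0n.
rewrite big1_seq => [|e' /andP[_ e's]].
  apply/esym/eqP; apply: contraNT es => g0; rewrite in_finite_support // inE.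
  by split=> //=; apply/eqP; rewrite monalgU_eq0.
by have [ee|//] := eqVneq e' e; move: es; rewrite -ee e's.
Qed.

Definition mq_u (e : E) (v : V) : polyring k E :=
  match mq_gamma e v with
  | Posz n => \prod_(i < n) (pvar e + i%:R)
  | Negz n => \prod_(i < n.+1) (pvar e - i.+1%:R)
  end.

Definition mq_tt (v : V) : polyring k E :=
  \big[*%R/1]_(e \in [set: E]) mq_u e v.

Definition mq_sigma (v : V) : {lrmorphism polyring k E -> polyring k E} :=
  pshift (fun e => - mq_gamma e v).
Definition mq_sigmaV (v : V) : polyring k E -> polyring k E :=
  pshift (fun e => mq_gamma e v).

Lemma mq_sigmaU v e : mq_sigma v (pvar e) = pvar e - (mq_gamma e v)%:~R.
Proof. by rewrite [LHS]pshiftU rmorphN. Qed.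

Lemma mq_sigmaK v : cancel (mq_sigma v) (mq_sigmaV v).
Proof.
by move=> p; rewrite [LHS]pshift_comp pshift0 // => e; rewrite subrr.
Qed.
Lemma mq_sigmaVK v : cancel (mq_sigmaV v) (mq_sigma v).
Proof.
by move=> p; rewrite [LHS]pshift_comp pshift0 // => e; rewrite addNr.
Qed.
Lemma mq_sigmaC v w p : mq_sigma v (mq_sigma w p) = mq_sigma w (mq_sigma v p).
Proof.
rewrite [LHS]pshift_comp [RHS]pshift_comp; congr (pshift _ p).
by apply/funext => e; rewrite addrC.
Qed.

Definition mq_mu (_ _ : V) : k := 1.

Hypothesis k_pchar0 : [pchar k] =i pred0.

Lemma mq_tt_neq0 v : mq_tt v != 0.
Proof.
pose ev : polyring k E -> k := peval (@idfun k) (fun=> 2^-1).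
have evM : monoid_morphism ev by apply: peval_monoid => *; exact: mulrC.
have evA : zmod_morphism ev by exact: peval_zmod.
pose evz := GRing.isZmodMorphism.Build _ _ ev evA.
pose evm := GRing.isMonoidMorphism.Build _ _ ev evM.
have [evh evU] : exists f : {rmorphism polyring k E -> k},
    forall e, f (pvar e) = 2^-1.
  by exists (HB.pack ev evz evm : {rmorphism polyring k E -> k}); exact: pevalU.
have natr0 n : (n.+1%:R : k) != 0 by rewrite ((pcharf0P k).1 k_pchar0).
suff : evh (mq_tt v) != 0 by apply: contraNneq => ->; rewrite rmorph0.
rewrite rmorph_prod prodf_seq_neq0; apply/allP => e _ /=.
have two : (2 : k) != 0 := natr0 1%N.
have halfD n : (2^-1 + n%:R : k) = (n * 2)%N.+1%:R / 2.
  by apply: (mulIf two); rewrite mulrDl mulVf // divfK // -(natr1 (n * 2)%N) natrM addrC.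
have halfB n : (2^-1 - n.+1%:R : k) = - ((n * 2)%N.+1%:R / 2).
  apply: (mulIf two); rewrite mulrBl mulVf // mulNr divfK // -natrM mulSn.
  by rewrite !addSn add0n -(natr1 (n * 2).+1) opprD addrCA subrr addr0.
rewrite /mq_u; case: (mq_gamma e v) => n; rewrite rmorph_prod;
  apply/prodf_neq0 => i _.
  by rewrite rmorphD evU rmorph_nat halfD mulf_neq0 ?invr_eq0.
by rewrite rmorphB evU rmorph_nat halfB oppr_eq0 mulf_neq0 ?invr_eq0.
Qed.

Definition mq_datum : tgw_datum (polyring k E) V :=
  @TgwDatum k (polyring k E) V mq_sigma mq_sigmaV mq_sigmaK mq_sigmaVK mq_sigmaC
    mq_tt mq_tt_neq0 (fun v r => mulrC (mq_tt v) r).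

Definition mq_algebra : inv_ring (polyring k E) :=
  @tgw_inv k (polyring k E) V mq_datum mq_mu (fun _ _ _ => erefl).

Definition is_canonical_rep (f : inv_map mq_algebra (weyl_inv k E)) : Prop :=
  [/\ forall v, f (tgw_X mq_datum mq_mu v) = weyl_zpow (mq_incidence v),
      forall v, f (tgw_Y mq_datum mq_mu v) = weyl_zpow (- mq_incidence v)
    & forall e, f (inv_rho mq_algebra (pvar e)) = weyl_y e * weyl_x e].
End Quiver.

Definition tgw_graded (k : fieldType) (R : algType k) (V : choiceType)
    (D D' : tgw_datum R V) (mu mu' : V -> V -> k)
    (f : tgw D mu -> tgw D' mu') : Prop :=
  forall g a, tgw_homog g a -> tgw_homog g (f a).

Definition factors_through (k : fieldType) (k0 : [pchar k] =i pred0)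
    (V E : choiceType) (D : tgw_datum (polyring k E) V) (mu : V -> V -> k)
    (mu_sym : forall i j, i != j -> mu i j = mu j i)
    (phi : inv_map (tgw_inv D mu_sym) (weyl_inv k E))
    (G : multiquiver V E) : Prop :=
  exists (xi : inv_map (tgw_inv D mu_sym) (mq_algebra G k0))
         (phiG : inv_map (mq_algebra G k0) (weyl_inv k E)),
    [/\ @tgw_graded k (polyring k E) V D (mq_datum G k0) mu (@mq_mu k V) xi,
        is_canonical_rep phiG
      & forall a, phi a = phiG (xi a)].

(* Main.v *)
Require Import Defs.
From HB Require Import structures.
From mathcomp Require Import all_boot all_order all_algebra finmap.
From mathcomp Require Import boolp classical_sets functions cardinality fsbigop.
From mathcomp.multinomials Require Import monalg.

(** Let [tau g] be the automorphism [u_e |-> u_e - g_e] of the polynomial ring R.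
The Weyl algebra W is free as a left R-module on the monomials [z^g], with
[z^g r = tau g r z^g]; independence is seen in the representation of W on
R-valued functions on Z^E in which [z^g] acts as [C_g * tau g] followed by the
translation by g.  Since [phi X_i] intertwines r and [sigma_i r] and is nonzero
([phi(X_i)^* phi(X_i) = t_i]), it has the form [r_i z^(g_i)] with
[sigma_i = tau g_i].  With [A = r_i C_(g_i)] and [B = C_(-g_j) tau (-g_j) r_j],
the relation between [X_i] and [Y_j] becomes
[A * tau g_i B = mu_ij * (B * tau (-g_j) A)].  Passing to leading terms after a
Kronecker substitution that keeps one variable gives [mu_ij = 1], and shows that
if [(g_i)_e] and [(g_j)_e] had the same sign then A and B would have degree 0 in
u_e, although u_e divides one of them.  So the [g_i] are the columns of the
incidence matrix of a multiquiver.

The canonical representation kills the null ideals because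
[f(b)^* f(b) = f(b^* b) = 0] for b homogeneous in a null ideal.  It is injective
on homogeneous elements because the degree-zero component of a TGW construction
is the image of R; hence every relation needed to define
[xi X_i = r_i X_i, xi Y_i = Y_i r_i] holds since its image in W does. *)

Set Implicit Arguments.
Unset Strict Implicit.
Unset Printing Implicit Defensive.

Import Order.TTheory GRing.Theory Num.Theory.
Local Open Scope ring_scope.

(** * Universal properties *)

Lemma rmorph_pack (A B : pzRingType) (f : A -> B) :
  {morph f : a b / a + b} -> {morph f : a b / a * b} -> f 1 = 1 ->
  exists F : {rmorphism A -> B}, F =1 f.
Proof.
move=> fD fM f1.
have f0 : f 0 = 0 by apply: (addrI (f 0)); rewrite -fD !addr0.
have fB : zmod_morphism f.
  move=> a b; apply: (addIr (f b)); rewrite -fD !subrK //.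
pose fz := GRing.isZmodMorphism.Build A B f fB.
pose fm := GRing.isMonoidMorphism.Build A B f (conj f1 fM).
by exists (HB.pack f fz fm : {rmorphism A -> B}).
Qed.

Section FreeRingLift.
Variables (R : pzRingType) (X : Type) (B : pzRingType).
Variables (f : {rmorphism R -> B}) (g : X -> B).

Fixpoint term_eval (a : rterm R X) : B :=
  match a with
  | Cst r => f r
  | Gen x => g x
  | Add a b => term_eval a + term_eval b
  | Opp a => - term_eval a
  | Mul a b => term_eval a * term_eval b
  end.

Lemma term_eval_req a b : req a b -> term_eval a = term_eval b.
Proof.
elim=> {a b} //=; do ?by move=> *; rewrite ?addrA ?mulrA ?mulrDl ?mulrDr ?rmorphD ?rmorphM.
- by move=> a b c _ -> _ ->.
- by move=> a a' b b' _ -> _ ->.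
- by move=> a a' _ ->.
- by move=> a a' b b' _ -> _ ->.
- by move=> a b; rewrite addrC.
- by move=> a; rewrite rmorph0 add0r.
- by move=> a; rewrite rmorph0 addNr.
- by move=> a; rewrite rmorph1 mul1r.
- by move=> a; rewrite rmorph1 mulr1.
Qed.

(** Evaluation of terms respects the congruence [req], so evaluating a representative gives a
    well-defined map. *)
Lemma free_ring_lift : exists F : {rmorphism free_ring R X -> B},
  (forall r, F (fr_cst X r) = f r) /\ (forall x, F (fr_gen R x) = g x).
Proof.
pose F0 (x : free_ring R X) := term_eval (repr x).
have F0E a : F0 (fr_pi a) = term_eval a by apply: term_eval_req; exact: fr_repr.
have F0D : {morph F0 : a b / a + b}.
  by elim/fr_ind=> a; elim/fr_ind=> b; rewrite -fr_piD !F0E.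
have F0M : {morph F0 : a b / a * b}.
  by elim/fr_ind=> a; elim/fr_ind=> b; rewrite -fr_piM !F0E.
have F01 : F0 1 = 1 by rewrite -[1]/(fr_pi (Cst _ 1)) F0E /= rmorph1.
have [F FE] := rmorph_pack F0D F0M F01.
by exists F; split=> [r|x]; rewrite FE F0E.
Qed.
End FreeRingLift.

(** The zeros of [h] form a two-sided ideal; containing [S], it contains the ideal generated by
    [S]. *)
Lemma quot_ring_lift (A B : pzRingType) (S : set A) (h : {rmorphism A -> B}) :
  (forall a, S a -> h a = 0) ->
  exists F : {rmorphism quot_ring S -> B}, forall a, F (qpi S a) = h a.
Proof.
move=> hS.
have hI a : ideal_gen S a -> h a = 0.
  move: a; apply: (@ideal_gen_sub _ S (fun a => h a = 0)) => //.
  split=> [|a b ha hb|a b hb]; first by rewrite rmorph0.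
    by rewrite rmorphB ha hb subr0.
  by rewrite !rmorphM hb mulr0 mul0r.
pose F0 (x : quot_ring S) := h (repr x).
have F0E a : F0 (qpi S a) = h a.
  by apply/eqP; rewrite -subr_eq0 -rmorphB; apply/eqP; apply: hI; exact: qrepr.
have F0D : {morph F0 : a b / a + b}.
  by elim/q_ind=> a; elim/q_ind=> b; rewrite -rmorphD !F0E rmorphD.
have F0M : {morph F0 : a b / a * b}.
  by elim/q_ind=> a; elim/q_ind=> b; rewrite -rmorphM !F0E rmorphM.
have F01 : F0 1 = 1 by rewrite -[1]/(qpi S 1) F0E rmorph1.
have [F FE] := rmorph_pack F0D F0M F01.
by exists F => a; rewrite FE F0E.
Qed.

Lemma free_ring_ind (R : pzRingType) (X : Type) (P : free_ring R X -> Prop) :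
  (forall r, P (fr_cst X r)) -> (forall x, P (fr_gen R x)) ->
  (forall a b, P a -> P b -> P (a + b)) -> (forall a, P a -> P (- a)) ->
  (forall a b, P a -> P b -> P (a * b)) -> forall a, P a.
Proof.
move=> Pc Pg PD PN PM; elim/fr_ind; elim=> [r|x|a Pa b Pb|a Pa|a Pa b Pb].
- exact: Pc.
- exact: Pg.
- by rewrite fr_piD; exact: PD.
- by rewrite fr_piN; exact: PN.
- by rewrite fr_piM; exact: PM.
Qed.

(** * The degree-zero component of a TGW construction *)

Section TgwTheory.
Variables (k : fieldType) (R : algType k) (V : choiceType).
Variables (D : tgw_datum R V) (mu : V -> V -> k).

Local Notation C := (tgwc D mu).
Local Notation rho := (tgwc_rho D mu).
Local Notation X := (tgwc_X D mu).
Local Notation Y := (tgwc_Y D mu).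

Lemma tgwc_ind (P : C -> Prop) :
  (forall r, P (rho r)) -> (forall i, P (X i)) -> (forall i, P (Y i)) ->
  (forall a b, P a -> P b -> P (a + b)) -> (forall a, P a -> P (- a)) ->
  (forall a b, P a -> P b -> P (a * b)) -> forall a, P a.
Proof.
move=> Pc PX PY PD PN PM; elim/q_ind; elim/free_ring_ind => [r|[i|i]|a b Pa Pb|a Pa|a b Pa Pb].
- exact: Pc.
- exact: PX.
- exact: PY.
- by rewrite rmorphD; exact: PD.
- by rewrite rmorphN; exact: PN.
- by rewrite rmorphM; exact: PM.
Qed.

Lemma tgwc_homogN g (a : C) : tgwc_homog g a -> tgwc_homog g (- a).
Proof. by move=> ha; rewrite -sub0r; apply: homog_B => //; exact: homog_0. Qed.

Lemma tgwc_rel_eq a b : tgw_rel D mu (a - b) -> tgwc_pi D mu a = tgwc_pi D mu b.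
Proof. by move=> h; apply/qpiP; exact: sub_ideal_gen. Qed.

Lemma tgwc_rhoM r s : rho (r * s) = rho r * rho s.
Proof. by rewrite /tgwc_rho !rmorphM. Qed.
Lemma tgwc_XR i r : X i * rho r = rho (tgw_sigma D i r) * X i.
Proof. by have := tgwc_rel_eq (TgwXr D mu i r); rewrite !rmorphM. Qed.
Lemma tgwc_YR i r : Y i * rho r = rho (tgw_sigmaV D i r) * Y i.
Proof. by have := tgwc_rel_eq (TgwYr D mu i r); rewrite !rmorphM. Qed.
Lemma tgwc_YX i : Y i * X i = rho (tgw_t D i).
Proof. by have := tgwc_rel_eq (TgwYX D mu i); rewrite !rmorphM. Qed.
Lemma tgwc_XY i : X i * Y i = rho (tgw_sigma D i (tgw_t D i)).
Proof. by have := tgwc_rel_eq (TgwXY D mu i); rewrite !rmorphM. Qed.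
Lemma tgwc_XYmu i j : i != j -> X i * Y j = rho (mu i j)%:A * (Y j * X i).
Proof. by move=> ij; have := tgwc_rel_eq (TgwXYmu D mu ij); rewrite !rmorphM. Qed.

(** Reduces multiplication by arbitrary elements to multiplication by homogeneous ones when sets of
    sums of homogeneous elements are shown to be ideals. *)
Lemma tgwc_homog_sum (a : C) : exists2 s : seq C,
  (forall b, b \in s -> exists g, tgwc_homog g b) & a = \sum_(b <- s) b.
Proof.
elim/tgwc_ind: a => [r|i|i|a b [s hs ->] [t ht ->]|a [s hs ->]|a b [s hs ->] [t ht ->]].
- exists [:: rho r]; rewrite ?big_seq1 // => b; rewrite inE => /eqP ->.
  by exists 0; exact: homog_rho.
- exists [:: X i]; rewrite ?big_seq1 // => b; rewrite inE => /eqP ->.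
  by eexists; exact: homog_X.
- exists [:: Y i]; rewrite ?big_seq1 // => b; rewrite inE => /eqP ->.
  by eexists; exact: homog_Y.
- exists (s ++ t); last by rewrite big_cat.
  by move=> c; rewrite mem_cat => /orP[/hs|/ht].
- exists (map -%R s); last by rewrite big_map sumrN.
  by move=> _ /mapP[b /hs[g hb] ->]; exists g; exact: tgwc_homogN.
- exists [seq x * y | x <- s, y <- t]; last first.
    by rewrite big_allpairs_dep mulr_suml; apply: eq_bigr => x _; rewrite mulr_sumr.
  move=> _ /allpairsP[[x y] /= [/hs[g hx] /ht[h hy] ->]].
  by exists (g + h); exact: homog_M.
Qed.

(* Products Y_J X_I span the algebra as a left R-module. *)
Definition xy_word (J I : seq V) : C := (\prod_(j <- J) Y j) * \prod_(i <- I) X i.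

Definition xy_deg (J I : seq V) : {malg int[V]} :=
  \sum_(i <- I) << i >> - \sum_(j <- J) << j >>.

Inductive xy_span (g : {malg int[V]}) : C -> Prop :=
| xy_span0 : xy_span g 0
| xy_spanD r J I a : xy_deg J I = g -> xy_span g a ->
    xy_span g (rho r * xy_word J I + a).

Lemma xy_span_add g a b : xy_span g a -> xy_span g b -> xy_span g (a + b).
Proof.
move=> ha hb; elim: ha => [|r J I c dg _ IH]; first by rewrite add0r.
by rewrite -addrA; exact: xy_spanD.
Qed.

Lemma xy_span_rho g r a : xy_span g a -> xy_span g (rho r * a).
Proof.
elim=> [|s J I c dg _ IH]; first by rewrite mulr0; exact: xy_span0.
by rewrite mulrDr mulrA -tgwc_rhoM; exact: xy_spanD.
Qed.

Lemma xy_span_word g r J I : xy_deg J I = g -> xy_span g (rho r * xy_word J I).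
Proof. by move=> dg; rewrite -[_ * _]addr0; apply: xy_spanD => //; exact: xy_span0. Qed.

Lemma xy_span_opp g a : xy_span g a -> xy_span g (- a).
Proof.
suff -> : - a = rho (-1) * a by exact: xy_span_rho.
by rewrite /tgwc_rho !rmorphN !rmorph1 mulN1r.
Qed.

Lemma tgwc_rho1 : rho 1 = 1. Proof. by rewrite /tgwc_rho !rmorph1. Qed.

Lemma prod_Y_rho J r : exists s, (\prod_(j <- J) Y j) * rho r = rho s * \prod_(j <- J) Y j.
Proof.
elim: J => [|j J [s IH]]; first by exists r; rewrite big_nil mul1r mulr1.
by exists (tgw_sigmaV D j s); rewrite big_cons -mulrA IH !mulrA tgwc_YR.
Qed.

(** Only the relations for distinct indices occur; their scalars, moved left through the letters
    [Y j], accumulate in [s]. *)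
Lemma X_prod_Y i J : i \notin J -> exists s,
  X i * \prod_(j <- J) Y j = rho s * ((\prod_(j <- J) Y j) * X i).
Proof.
elim: J => [|j J IH]; first by exists 1; rewrite big_nil mulr1 tgwc_rho1 !mul1r.
rewrite inE negb_or => /andP[ij /IH[s Es]].
rewrite big_cons mulrA tgwc_XYmu // -!mulrA Es.
exists ((mu i j)%:A * tgw_sigmaV D j s); rewrite tgwc_rhoM -!mulrA; congr (_ * _).
by rewrite !mulrA tgwc_YR.
Qed.

Lemma xy_deg_consX i J I : xy_deg J (i :: I) = << i >> + xy_deg J I.
Proof. by rewrite /xy_deg big_cons addrA. Qed.
Lemma xy_deg_consY j J I : xy_deg (j :: J) I = - << j >> + xy_deg J I.
Proof. by rewrite /xy_deg big_cons opprD addrCA. Qed.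
Lemma xy_deg_rem j J1 J2 I : xy_deg (J1 ++ j :: J2) I = - << j >> + xy_deg (J1 ++ J2) I.
Proof. by rewrite -xy_deg_consY /xy_deg !(big_cat, big_cons) /= addrCA. Qed.

Lemma xy_span_Y g j a : xy_span g a -> xy_span (- << j >> + g) (Y j * a).
Proof.
elim=> [|r J I b dg _ IH]; first by rewrite mulr0; exact: xy_span0.
rewrite mulrDr; apply: xy_span_add => //; rewrite mulrA tgwc_YR -mulrA.
have -> : Y j * xy_word J I = xy_word (j :: J) I by rewrite /xy_word big_cons mulrA.
by apply: xy_span_word; rewrite xy_deg_consY dg.
Qed.

(** If [i] is not in [J], the new letter travels to the right of all Y's and lengthens the word.
    Otherwise it meets the first [Y i], and the product [X i * Y i] collapses into R, which raises
    the degree by [i] through the loss of that [Y i]. *)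
Lemma xy_span_X g i a : xy_span g a -> xy_span (<< i >> + g) (X i * a).
Proof.
elim=> [|r J I b dg _ IH]; first by rewrite mulr0; exact: xy_span0.
rewrite mulrDr; apply: xy_span_add => //; rewrite mulrA tgwc_XR -mulrA.
apply: xy_span_rho; rewrite /xy_word mulrA.
have [iJ|iJ] := boolP (i \in J); last first.
  have [s ->] := X_prod_Y iJ; rewrite -!mulrA.
  have -> : (\prod_(j <- J) Y j) * (X i * \prod_(i0 <- I) X i0) = xy_word J (i :: I).
    by rewrite /xy_word big_cons.
  by apply: xy_span_word; rewrite xy_deg_consX dg.
(* The split is at the first occurrence of [i], so that [X i] can pass [J1]. *)
have [J1 [J2 [EJ iJ1]]] : exists J1 J2, J = J1 ++ i :: J2 /\ i \notin J1.
  exists (take (index i J) J), (drop (index i J).+1 J); split.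
    by rewrite -{1}(cat_take_drop (index i J) J) (drop_nth i) ?index_mem // nth_index.
  elim: (J) => //= x s IHs; case: eqP => [->//|xi].
  by rewrite inE negb_or IHs andbT; apply/eqP => ix; apply: xi.
have [s Es] := X_prod_Y iJ1.
have [s' Es'] := prod_Y_rho J1 (tgw_sigma D i (tgw_t D i)).
rewrite EJ big_cat big_cons /= mulrA Es -!mulrA mulrA.
have -> : rho s * (\prod_(j <- J1) Y j) *
      (X i * (Y i * (\prod_(j <- J2) Y j * \prod_(i0 <- I) X i0))) =
    rho (s * s') * xy_word (J1 ++ J2) I.
  rewrite tgwc_rhoM /xy_word big_cat /= -!mulrA; congr (_ * _).
  by rewrite [X i * _]mulrA tgwc_XY mulrA Es' !mulrA.
apply: xy_span_word.
by rewrite -dg EJ xy_deg_rem addrA subrr add0r.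
Qed.

(** The induction proves that left multiplication by [a] sends the span in degree d to the span in
    degree g + d; this is then applied to 1. *)
Lemma tgwc_homog_span g a : tgwc_homog g a -> xy_span g a.
Proof.
move=> ha; rewrite -[a]mulr1 -[g]addr0.
have : xy_span 0 1.
  have -> : (1 : C) = rho 1 * xy_word [::] [::].
    by rewrite /xy_word !big_nil tgwc_rho1 !mulr1.
  by apply: xy_span_word; rewrite /xy_deg !big_nil subr0.
move: (0 : {malg int[V]}) (1 : C).
elim: ha => {g a} [r|i|i|g|g a b _ IHa _ IHb|g h a b _ IHa _ IHb] d c hc.
- by rewrite add0r; exact: xy_span_rho.
- exact: xy_span_X.
- exact: xy_span_Y.
- by rewrite mul0r; exact: xy_span0.
- rewrite mulrBl; apply: xy_span_add; [exact: IHa|apply: xy_span_opp; exact: IHb].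
- by rewrite -addrA -mulrA; apply: IHa; exact: IHb.
Qed.

Hypothesis mu_neq0 : forall i j, i != j -> mu i j != 0.

(** Converse exchange to [X_prod_Y]; here the scalars [mu i j] have to be inverted. *)
Lemma prod_Y_X i J : i \notin J -> exists s,
  (\prod_(j <- J) Y j) * X i = rho s * (X i * \prod_(j <- J) Y j).
Proof.
elim: J => [|j J IH]; first by exists 1; rewrite big_nil mulr1 tgwc_rho1 !mul1r.
rewrite inE negb_or => /andP[ij /IH[s Es]].
rewrite big_cons -mulrA Es mulrA tgwc_YR -mulrA.
have -> : Y j * (X i * \prod_(j0 <- J) Y j0) =
    rho (mu i j)^-1%:A * (X i * (Y j * \prod_(j0 <- J) Y j0)).
  rewrite [X i * (Y j * _)]mulrA tgwc_XYmu // !mulrA -tgwc_rhoM.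
  by rewrite mulr_algl scalerA mulVf ?mu_neq0 // scale1r tgwc_rho1 mul1r.
by eexists; rewrite mulrA -tgwc_rhoM.
Qed.

(** In degree 0 every letter of [I] has a partner in [J]. The head of [I] is cancelled against its
    last partner by [Y i * X i = t_i], and the induction is on the length of [I]. *)
Lemma xy_word_deg0 J I : xy_deg J I = 0 -> exists r, xy_word J I = rho r.
Proof.
have [n nI] := ubnP (size I); elim: n I J nI => // n IHn [|i I] J nI.
  move=> dg; suff -> : J = [::].
    by exists 1; rewrite /xy_word !big_nil mulr1 tgwc_rho1.
  (* A letter [j] left in [J] would make the coefficient of [j] in the degree at most -1. *)
  case: J dg => // j J /(congr1 (mcoeff j)); rewrite /xy_deg big_nil sub0r.
  rewrite big_cons mcoeffN mcoeffD mcoeff0 mcoeffUU raddf_sum /= => /eqP.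
  rewrite oppr_eq0 => /eqP E.
  have : 0 < 1 + \sum_(i <- J) (<< i >> : {malg int[V]})@_j.
    apply: ltr_pwDl => //; apply: sumr_ge0 => i _; rewrite mcoeffU.
    by case: eqP.
  by rewrite E ltxx.
move=> dg.
have iJ : i \in J.
  (* Without a [Y i], the coefficient of [i] in the degree would be at least 1. *)
  apply/negPn/negP => iJ; move: dg => /(congr1 (mcoeff i)).
  rewrite xy_deg_consX /xy_deg mcoeffD mcoeffB mcoeff0 mcoeffUU !raddf_sum /=.
  rewrite [\sum_(i0 <- J) _]big1_seq ?addr0 => [E|j /= jJ]; last first.
    by rewrite mcoeffU; case: eqP => [ji|]; rewrite ?oppr0 //; move: iJ; rewrite -ji jJ.
  have : 0 < 1 + \sum_(j <- I) (<< j >> : {malg int[V]})@_i.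
    apply: ltr_pwDl => //; apply: sumr_ge0 => j _; rewrite mcoeffU.
    by case: eqP.
  by rewrite E ltxx.
(* This time the last occurrence is taken: [X i] moves left past [J2] to meet [Y i]. *)
have [J1 [J2 [EJ iJ2]]] : exists J1 J2, J = J1 ++ i :: J2 /\ i \notin J2.
  elim: J iJ {dg} => // j J IH; have [iJ _|iJ] := boolP (i \in J).
    by have [J1 [J2 [-> h]]] := IH iJ; exists (j :: J1), J2.
  by rewrite inE (negPf iJ) orbF => /eqP <-; exists [::], J.
have [s Es] := prod_Y_X iJ2.
have [s' Es'] := prod_Y_rho J1 (tgw_sigmaV D i s * tgw_t D i).
have -> : xy_word J (i :: I) = rho s' * xy_word (J1 ++ J2) I.
  rewrite /xy_word EJ !(big_cat, big_cons) /= -!mulrA.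
  rewrite [(\prod_(j <- J2) _) * _]mulrA Es -!mulrA.
  rewrite [Y i * _]mulrA tgwc_YR -[_ * Y i * _]mulrA [Y i * _]mulrA tgwc_YX.
  by rewrite [rho (tgw_sigmaV _ _ _) * _]mulrA -tgwc_rhoM [LHS]mulrA Es' -!mulrA.
have [|r ->] := IHn I (J1 ++ J2) nI; last by exists (s' * r); rewrite tgwc_rhoM.
by move: dg; rewrite EJ xy_deg_rem xy_deg_consX addrCA addrA addrC subrr addr0.
Qed.

Lemma tgwc_homog0 a : tgwc_homog 0 a -> exists r, a = rho r.
Proof.
move=> /tgwc_homog_span; elim=> [|r J I b dg _ [s ->]].
  by exists 0; rewrite /tgwc_rho !rmorph0.
have [t ->] := xy_word_deg0 dg; exists (r * t + s).
by rewrite /tgwc_rho !rmorphD !rmorphM.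
Qed.

(** The homogeneous elements killed by [psi] span a graded ideal. Its degree-zero elements come from
    R by [tgwc_homog0], hence vanish by injectivity on R, so this ideal is among those factored out
    in the TGW algebra. *)
Lemma tgw_homog_inj (B : pzRingType) (psi : {rmorphism tgw D mu -> B}) :
  injective (psi \o tgw_rho D mu) ->
  forall g a, tgw_homog g a -> psi a = 0 -> a = 0.
Proof.
move=> psi_inj g _ [c hc <-] pc0.
(* Taking sums of homogeneous elements of the kernel, and not the whole kernel, makes [J] graded by
   construction. *)
pose J : set C := fun a => exists2 s : seq C,
  (forall b, b \in s -> psi (tgw_pi b) = 0 /\ exists g, tgwc_homog g b)
  & a = \sum_(b <- s) b.
have Jhom b h : tgwc_homog h b -> psi (tgw_pi b) = 0 -> J b.
  move=> hb b0; exists [:: b]; last by rewrite big_seq1.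
  by move=> b'; rewrite inE => /eqP ->; split=> //; exists h.
have JD a b : J a -> J b -> J (a + b).
  move=> [s hs ->] [t ht ->]; exists (s ++ t); last by rewrite big_cat.
  by move=> d; rewrite mem_cat => /orP[/hs|/ht].
have JMl a b : J b -> J (a * b).
  move=> [s hs ->]; have [t ht ->] := tgwc_homog_sum a.
  exists [seq x * y | x <- t, y <- s]; last first.
    by rewrite big_allpairs_dep mulr_suml; apply: eq_bigr => x _; rewrite mulr_sumr.
  move=> _ /allpairsP[[x y] /= [/ht[h hx] /hs[y0 [l hy]] ->]].
  by split; [rewrite !rmorphM y0 mulr0 | exists (h + l); exact: homog_M].
have JMr a b : J b -> J (b * a).
  move=> [s hs ->]; have [t ht ->] := tgwc_homog_sum a.
  exists [seq x * y | x <- s, y <- t]; last first.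
    by rewrite big_allpairs_dep mulr_suml; apply: eq_bigr => x _; rewrite mulr_sumr.
  move=> _ /allpairsP[[x y] /= [/hs[x0 [h hx]] /ht[l hy] ->]].
  by split; [rewrite !rmorphM x0 mul0r | exists (h + l); exact: homog_M].
have J0 : J 0 by exists [::]; rewrite ?big_nil.
apply/qpi_eq0; rewrite tgwc_rad_gen; exists [:: c]; last by rewrite big_seq1.
move=> b; rewrite inE => /eqP ->; exists J; last exact: Jhom hc pc0.
split; first split.
- split=> // [a d Ja Jd|a d Jd]; last by split; [exact: JMl|exact: JMr].
  by apply: JD => //; rewrite -mulN1r; exact: JMl.
- move=> a [s hs ->]; exists s => // d /hs[d0 [h hd]].
  by split; [exact: Jhom hd d0 | exists h].
- move=> a [s hs Ea] /tgwc_homog0[r Er].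
  have : psi (tgw_pi a) = 0.
    by rewrite Ea !rmorph_sum big1_seq // => d /hs[].
  by rewrite Er => r0; rewrite (psi_inj r 0) /tgwc_rho ?rmorph0 //=.
Qed.

End TgwTheory.

(** * Shift equations for polynomials *)

Section ShiftPeriodic.
Variable k : fieldType.
Hypothesis k_pchar0 : [pchar k] =i pred0.

Lemma natr_inj_pchar0 : injective (fun n : nat => n%:R : k).
Proof.
move=> m n /eqP; wlog mn : m n / (m <= n)%N.
  move=> H; case: (leqP m n) => [mn|/ltnW nm] E; first exact: (H m n mn E).
  by apply/esym; apply: H => //; rewrite eq_sym.
rewrite eq_sym -subr_eq0 -natrB // ((pcharf0P k).1 k_pchar0) subn_eq0 => nm.
by apply/eqP; rewrite eqn_leq mn.
Qed.

(** [G - G(0)] vanishes at every natural number, and these are infinitely many distinct scalars in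
    characteristic zero. *)
Lemma size_periodic_poly (G : {poly k}) : G \Po ('X + 1) = G -> (size G <= 1)%N.
Proof.
move=> G1.
have Gn n : G.[n%:R] = G.[0].
  elim: n => // n IH; rewrite -IH -{2}G1 horner_comp !hornerE.
  by rewrite natr1.
suff -> : G = (G.[0])%:P by exact: size_polyC_leq1.
apply/eqP; rewrite -subr_eq0; apply/negPn/negP => nz.
have := max_poly_roots nz _ _ (rs := [seq n%:R | n <- iota 0 (size (G - (G.[0])%:P))]).
rewrite size_map size_iota ltnn => H; suff : false by [].
apply: H; last by rewrite map_inj_uniq ?iota_uniq //; exact: natr_inj_pchar0.
by apply/allP => _ /mapP[n _ ->]; rewrite /root !hornerE Gn subrr.
Qed.

Local Notation sh c := ('X + c%:R%:P).

Lemma comp_poly_natshift (p : {poly k}) m n : (p \Po sh m) \Po sh n = p \Po sh (m + n)%N.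
Proof.
by rewrite -comp_polyA comp_polyD comp_polyX comp_polyC -addrA -polyCD natrD [n%:R + _]addrC.
Qed.

(* The product G of A(u+m), ..., A(u+m+n-1) and B(u), ..., B(u+m-1) satisfies  *)
(* G(u+1) = G(u), hence is constant in characteristic zero.                    *)
Lemma shift_exchange_constant (A B : {poly k}) (m n : nat) :
  A != 0 -> B != 0 -> (0 < m)%N -> (0 < n)%N ->
  (A \Po sh m) * B = (B \Po sh m) * (A \Po sh (m + n)%N) ->
  (size A <= 1)%N /\ (size B <= 1)%N.
Proof.
move=> A0 B0 m0 n0 AB.
have sh0 (p : {poly k}) c : p != 0 -> p \Po sh c != 0.
  by move=> p0; rewrite -size_poly_eq0 size_comp_poly2 ?size_XaddC // size_poly_eq0.
pose PA := \prod_(i < n) (A \Po sh (m + i)%N).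
pose PB := \prod_(j < m) (B \Po sh j).
have PA0 : PA != 0 by apply/prodf_neq0 => i _; exact: sh0.
have PB0 : PB != 0 by apply/prodf_neq0 => i _; exact: sh0.
have PA1 : (PA \Po sh 1) * (A \Po sh m) = PA * (A \Po sh (m + n)%N).
  rewrite /PA rmorph_prod /=.
  under eq_bigr do rewrite comp_poly_natshift addn1 -addnS.
  have := @big_ord_recl _ 1 *%R n (fun i : 'I_n.+1 => A \Po sh (m + i)%N).
  rewrite big_ord_recr /= addn0 => ->; rewrite mulrC; congr (_ * _).
have PB1 : (PB \Po sh 1) * B = PB * (B \Po sh m).
  rewrite /PB rmorph_prod /=.
  under eq_bigr do rewrite comp_poly_natshift addn1.
  have := @big_ord_recl _ 1 *%R m (fun i : 'I_m.+1 => B \Po sh i).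
  by rewrite big_ord_recr /= addr0 comp_polyXr => ->; rewrite mulrC.
have G1 : (PA * PB) \Po ('X + 1) = PA * PB.
  have nz : (A \Po sh m) * B != 0 by rewrite mulf_neq0 ?sh0.
  apply: (mulIf nz); rewrite {2}AB -[1]/(1%:R%:P) comp_polyM.
  by rewrite mulrACA PA1 PB1 mulrACA [_ * (B \Po _)]mulrC.
have G0 : PA * PB != 0 by rewrite mulf_neq0.
have sG := size_periodic_poly G1.
(* These are the factors of index 0 of [PA] and [PB]; they exist because [n] and [m] are
   positive. *)
have [An Bn] : (A \Po sh m %| PA * PB)%R /\ (B %| PA * PB)%R.
  split; [apply: dvdp_mulr|apply: dvdp_mull].
    case: n n0 @PA {PA0 PA1 G1 G0 sG AB} => // n _ PA; rewrite /PA.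
    by rewrite big_ord_recl addn0 dvdp_mulIl.
  case: m m0 @PB {PB0 PB1 G1 G0 sG AB} @PA {PA0 PA1} => // m _ PB PA; rewrite /PB.
  by rewrite big_ord_recl addr0 comp_polyXr dvdp_mulIl.
split; last exact: leq_trans (dvdp_leq G0 Bn) sG.
have := leq_trans (dvdp_leq G0 An) sG.
by rewrite size_comp_poly2 ?size_XaddC.
Qed.
End ShiftPeriodic.

(** * Leading terms of polynomials over a domain *)

Section TopTerm.
Variable A : idomainType.
Implicit Types (P Q : {poly A}) (q : A) (N : nat).

(** [P] has degree at most [N] with coefficient [q] in degree [N]. Allowing [q = 0] makes the
    predicate stable under sums; for nonzero [q] it fixes the degree and the leading coefficient. *)
Definition top_term N q P := (size (P - q *: 'X^N)%R <= N)%N.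

Lemma top_term_size N q P : top_term N q P -> (size P <= N.+1)%N.
Proof.
move=> h; rewrite -[P](subrK (q *: 'X^N)); apply: leq_trans (size_polyD _ _) _.
rewrite geq_max (leq_trans h) //=.
by apply: leq_trans (size_scale_leq _ _) _; rewrite size_polyXn.
Qed.

Lemma top_term_coef N q P : top_term N q P -> P`_N = q.
Proof.
move=> /leq_sizeP/(_ N (leqnn N)); rewrite coefB coefZ coefXn eqxx mulr1.
by move/eqP; rewrite subr_eq0 => /eqP.
Qed.

Lemma top_term_lead N q P : q != 0 -> top_term N q P -> lead_coef P = q /\ (size P).-1 = N.
Proof.
move=> q0 h; suff s : size P = N.+1 by rewrite lead_coefE s /= (top_term_coef h).
apply/eqP; rewrite eqn_leq (top_term_size h) /=; apply: contraR q0.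
by rewrite -leqNgt => /leq_sizeP/(_ N (leqnn _)); rewrite (top_term_coef h) => ->.
Qed.

Lemma top_termM N q P N' q' P' : top_term N q P -> top_term N' q' P' ->
  top_term (N + N') (q * q') (P * P').
Proof.
move=> h h'; have s' := top_term_size h'; rewrite /top_term.
have -> : P * P' - (q * q') *: 'X^(N + N') =
    (P - q *: 'X^N) * P' + q *: 'X^N * (P' - q' *: 'X^N').
  rewrite mulrBl mulrBr addrA subrK -scalerAl -scalerAr -exprD scalerA //.
apply: leq_trans (size_polyD _ _) _; rewrite geq_max; apply/andP; split.
  apply: leq_trans (size_polyMleq _ _) _.
  by rewrite -subn1 leq_subLR add1n -addnS leq_add.
rewrite -scalerAl; apply: leq_trans (size_scale_leq _ _) _.
by apply: leq_trans (size_polyMleq _ _) _; rewrite size_polyXn addSn /= leq_add2l.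
Qed.

Lemma top_termD N q P q' P' : top_term N q P -> top_term N q' P' ->
  top_term N (q + q') (P + P').
Proof.
rewrite /top_term => h h'; rewrite scalerDl opprD addrACA.
by apply: leq_trans (size_polyD _ _) _; rewrite geq_max h.
Qed.

Lemma top_term0 N : top_term N 0 0.
Proof. by rewrite /top_term scale0r subr0 size_poly0. Qed.

Lemma top_term_lt N q P N' : top_term N q P -> (N < N')%N -> top_term N' 0 P.
Proof.
by move=> /top_term_size s lt; rewrite /top_term scale0r subr0; exact: leq_trans s lt.
Qed.

Lemma top_termC q : top_term 0 q q%:P.
Proof. by rewrite /top_term expr0 alg_polyC subrr size_poly0. Qed.

Lemma top_termX N c : (0 < N)%N -> top_term N 1 ('X^N + c%:P).
Proof.
move=> N0; rewrite /top_term scale1r addrC addKr; apply: leq_trans (size_polyC_leq1 _) N0.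
Qed.

Lemma top_term_exp N q P n : top_term N q P -> top_term (n * N) (q ^+ n) (P ^+ n).
Proof.
move=> h; elim: n => [|n IH]; first by rewrite mul0n !expr0 -polyC1; exact: top_termC.
by rewrite !exprS mulSn; exact: top_termM.
Qed.

Lemma top_term_prod (I : Type) (r : seq I) (F : I -> nat) (G : I -> A) (H : I -> {poly A}) :
  (forall i, top_term (F i) (G i) (H i)) ->
  top_term (\sum_(i <- r) F i) (\prod_(i <- r) G i) (\prod_(i <- r) H i).
Proof.
move=> h; elim: r => [|i r IH]; first by rewrite !big_nil -polyC1; exact: top_termC.
by rewrite !big_cons; exact: top_termM.
Qed.

Lemma top_term_sum (I : eqType) (r : seq I) N (G : I -> A) (H : I -> {poly A}) :
  (forall i, i \in r -> top_term N (G i) (H i)) ->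
  top_term N (\sum_(i <- r) G i) (\sum_(i <- r) H i).
Proof.
elim: r => [|i r IH] h; first by rewrite !big_nil; exact: top_term0.
rewrite !big_cons; apply: top_termD; first by apply: h; rewrite mem_head.
by apply: IH => j jr; apply: h; rewrite inE jr orbT.
Qed.
End TopTerm.

(** Uniqueness of base-[B] expansions: reduction modulo [B] isolates the lowest digit. It makes
    monomials recoverable from their Kronecker weight. *)
Lemma digits_inj (B n : nat) (a b : nat -> nat) :
  (forall j, a j < B)%N -> (forall j, b j < B)%N ->
  (\sum_(j < n) B ^ j * a j = \sum_(j < n) B ^ j * b j)%N ->
  forall j, (j < n)%N -> a j = b j.
Proof.
elim: n a b => // n IH a b aB bB.
have split_ (c : nat -> nat) :
    (\sum_(j < n.+1) B ^ j * c j = c 0 + B * \sum_(j < n) B ^ j * c j.+1)%N.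
  rewrite big_ord_recl expn0 mul1n big_distrr /=; congr addn.
  by apply: eq_bigr => j _; rewrite expnS mulnA.
rewrite !split_ => E.
have B0 : (0 < B)%N by apply: leq_ltn_trans (aB 0%N).
have E0 : a 0%N = b 0%N.
  move: E => /(congr1 (modn^~ B)); rewrite ![(_ + B * _)%N]addnC ![(B * _)%N]mulnC.
  by rewrite !modnMDl !modn_small.
case=> [//|j]; rewrite ltnS; apply: (IH (a \o S) (b \o S)) => // [i|i|]; rewrite ?aB ?bB //.
by move: E; rewrite E0 => /eqP; rewrite eqn_add2l eqn_pmul2l // => /eqP.
Qed.

Lemma seq_argmax (T : eqType) (s : seq T) (f : T -> nat) : s != [::] ->
  exists2 m, m \in s & forall n, n \in s -> (f n <= f m)%N.
Proof.
elim: s => // x [|y s] IH _.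
  by exists x; rewrite ?mem_head // => n; rewrite inE => /eqP ->.
have [//|m ms mmax] := IH; have [le|/ltnW le] := leqP (f x) (f m).
  exists m; first by rewrite inE ms orbT.
  by move=> n; rewrite inE => /orP[/eqP ->|/mmax].
exists x; first exact: mem_head.
by move=> n; rewrite inE => /orP[/eqP ->|/mmax h] //; exact: leq_trans h le.
Qed.

(** * Kronecker substitution with at most one variable kept *)

Section Kronecker.
Variables (k : fieldType) (E : choiceType) (o : option E) (w : E -> nat).

Local Notation KP := {poly {poly k}}.

Definition kcst : {rmorphism k -> KP} := (polyC : {rmorphism {poly k} -> KP}) \o polyC.
(* Kronecker substitution: the variable selected by o is kept, every other u_f *)
(* becomes the power T^(w f) of an outer indeterminate T.                      *)
Definition kvar (f : E) : KP := if o == Some f then 'X%:P else 'X^(w f).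
Definition kron : polyring k E -> KP := peval kcst kvar.

Lemma kron_zmod : zmod_morphism kron.
Proof. exact: peval_zmod. Qed.
HB.instance Definition _ := GRing.isZmodMorphism.Build _ _ kron kron_zmod.
Lemma kron_monoid : monoid_morphism kron.
Proof. by apply: peval_monoid => *; exact: mulrC. Qed.
HB.instance Definition _ := GRing.isMonoidMorphism.Build _ _ kron kron_monoid.

Lemma kronC c : kron c%:MP = c%:P%:P. Proof. exact: pevalC. Qed.
Lemma kronU f : kron (pvar f) = kvar f. Proof. exact: pevalU. Qed.

(** The substitution sends the monomial [m] to [T^(mwt m)] times the kept variable to the power
    [mexp m]. *)
Definition mwt (m : {cmonom E}) : nat :=
  \sum_(f <- finsupp m) m f * (if o == Some f then 0 else w f).
Definition mexp (m : {cmonom E}) : nat := if o is Some e then m e else 0%N.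

Hypothesis w_gt0 : forall f, (0 < w f)%N.

Definition oshift (c : E -> int) : k := if o is Some e then (c e)%:~R else 0.

(** A substituted variable contributes [T^(w f) + c f], whose top term does not see the shift since
    [w f] is positive. Only the kept variable remembers its translation. *)
Lemma mon_top (c : E -> int) (m : {cmonom E}) :
  top_term (mwt m) (('X + (oshift c)%:P) ^+ mexp m)
    (\prod_(f <- finsupp m) (kvar f + (c f)%:~R) ^+ m f).
Proof.
have -> : ('X + (oshift c)%:P) ^+ mexp m =
    \prod_(f <- finsupp m) (if o == Some f then 'X + (c f)%:~R else 1) ^+ m f :> {poly k}.
  rewrite /mexp /oshift; case: o => [e|]; last first.
    by rewrite expr0 big1 // => f _; rewrite expr1n.
  have [em|em] := boolP (e \in finsupp m).
    rewrite (bigD1_seq e) //= eqxx big1 ?mulr1 ?rmorph_int // => f fe.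
    by case: eqP => [[ef]|_]; rewrite ?expr1n //; rewrite ef eqxx in fe.
  rewrite big1_seq; first by move: em; rewrite -cmE_eq0 => /eqP ->; rewrite expr0.
  move=> f /= fm; case: eqP => [[ef]|_]; rewrite ?expr1n //.
  by rewrite ef fm in em.
apply: top_term_prod => f; apply: top_term_exp; rewrite /kvar.
case: eqP => _; last by rewrite -[(c f)%:~R](rmorph_int polyC); exact: top_termX.
have -> : 'X%:P + (c f)%:~R = ('X + (c f)%:~R)%:P :> KP by rewrite polyCD rmorph_int.
exact: top_termC.
Qed.

(** The coefficient of [T^N] in the image of [p], a polynomial in the kept variable. *)
Definition ktop N (p : polyring k E) : {poly k} :=
  \sum_(m <- msupp p) (if mwt m == N then p@_m *: 'X^(mexp m) else 0).

Lemma kron_shift_top N c p : (forall m, m \in msupp p -> mwt m <= N)%N ->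
  top_term N (ktop N p \Po ('X + (oshift c)%:P)) (kron (pshift c p)).
Proof.
move=> le.
have -> : kron (pshift c p) =
   \sum_(m <- msupp p) kcst p@_m * \prod_(f <- finsupp m) (kvar f + (c f)%:~R) ^+ m f.
  rewrite /pshift /peval raddf_sum; apply: eq_bigr => m _ /=.
  rewrite rmorphM [in LHS]rmorph_prod /= kronC; congr (_ * _).
  by apply: eq_bigr => f _; rewrite rmorphXn rmorphD rmorph_int /= kronU.
rewrite /ktop rmorph_sum /=; apply: top_term_sum => m mp.
have h : top_term (mwt m) (p@_m *: ('X + (oshift c)%:P) ^+ mexp m)
    (kcst p@_m * \prod_(f <- finsupp m) (kvar f + (c f)%:~R) ^+ m f).
  by rewrite -mul_polyC -[mwt m]add0n; apply: top_termM; [exact: top_termC | exact: mon_top].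
case: eqP => [<-|/eqP ne]; first by rewrite comp_polyZ comp_Xn_poly.
by rewrite comp_poly0; apply: top_term_lt h _; rewrite ltn_neqAle ne le.
Qed.

Hypothesis (p : polyring k E) (p0 : p != 0).
Hypothesis sep : forall m n, m \in msupp p -> n \in msupp p ->
  mwt m = mwt n -> mexp m = mexp n -> m = n.

(** [N] is the largest weight in the support. Within that weight the monomials have distinct kept
    exponents by [sep], so nothing cancels and [q] is nonzero. The same [q] serves all shifts
    [c]. *)
Lemma kron_top : exists N q, q != 0 /\ forall c,
  top_term N (q \Po ('X + (oshift c)%:P)) (kron (pshift c p)).
Proof.
have [m mp mmax] : exists2 m, m \in msupp p & forall n, n \in msupp p -> (mwt n <= mwt m)%N.
  apply: seq_argmax; apply: contra p0 => /eqP s0; rewrite -msupp_eq0.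
  by apply/eqP/fsetP => x; rewrite -[x \in msupp p]/(x \in (msupp p : seq _)) s0.
exists (mwt m), (ktop (mwt m) p); split; last by move=> c; exact: kron_shift_top.
(* The coefficient at exponent [mexp m] is [p@_m]: [m] is the only monomial contributing to it. *)
apply/eqP => /(congr1 (fun r : {poly k} => r`_(mexp m))) /eqP.
rewrite coef0 coef_sum (bigD1_seq m) //= eqxx coefZ coefXn eqxx mulr1 big1_seq ?addr0.
  by rewrite mcoeff_eq0 mp.
move=> n /andP[nm np]; case: eqP => [nN|_]; last by rewrite coef0.
rewrite coefZ coefXn; case: eqP => [e|_]; last by rewrite mulr0.
by rewrite (sep np mp) ?eqxx ?nN // in nm.
Qed.
End Kronecker.

(** With [B] larger than all exponents in [M] and the weights distinct powers of [B] on the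
    variables that occur, a weight lists the exponents as base-[B] digits. *)
Lemma kron_weights (E : choiceType) (o : option E) (M : seq {cmonom E}) :
  exists2 w : E -> nat, (forall f, 0 < w f)%N &
  forall m n, m \in M -> n \in M -> mwt o w m = mwt o w n -> mexp o m = mexp o n -> m = n.
Proof.
pose d := undup (flatten [seq (finsupp m : seq E) | m : {cmonom E} <- M]).
have dm m : m \in M -> {subset finsupp m <= d}.
  move=> mM f fm; rewrite mem_undup; apply/flattenP.
  by exists (finsupp m : seq E) => //; exact: map_f.
pose B := (\max_(m <- M) \max_(f <- finsupp m) m f).+1.
have mB m f : m \in M -> (m f < B)%N.
  move=> mM; rewrite ltnS; have [fm|] := boolP (f \in finsupp m); last first.
    by rewrite -cmE_eq0 => /eqP ->.
  apply: (leq_trans (n := \max_(f <- finsupp m) m f)).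
    exact: (@leq_bigmax_seq _ _ xpredT (fun f => m f)).
  exact: (@leq_bigmax_seq _ M xpredT (fun m : {cmonom E} => \max_(f <- finsupp m) m f)%N).
exists (fun f => B ^ index f d)%N; first by move=> f; rewrite expn_gt0.
have : uniq d by exact: undup_uniq.
(* If no variable occurs, all monomials of [M] are trivial. Otherwise [f0] serves as the default
   value for [nth]. *)
case: d dm => [|f0 d0].
  move=> dm _ m n mM nM _ _; apply/eqP/cmP => f.
  have z l : l \in M -> l f = 0%N.
    by move=> /dm h; apply/eqP; rewrite cmE_eq0; apply/negP => /h.
  by rewrite !z.
set d := f0 :: d0 => dm d_uniq m n mM nM wE eE.
pose dig (l : {cmonom E}) j := if o == Some (nth f0 d j) then 0%N else l (nth f0 d j).
have wt l : l \in M ->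
    mwt o (fun f => B ^ index f d)%N l = (\sum_(j < size d) B ^ j * dig l j)%N.
  move=> lM; transitivity (\sum_(f <- d) l f * (if o == Some f then 0 else B ^ index f d))%N.
    rewrite /mwt; transitivity (\sum_(f <- d | f \in finsupp l)
        l f * (if o == Some f then 0 else B ^ index f d))%N; last first.
      rewrite big_mkcond; apply: eq_bigr => f _; case: ifP => // /negbT.
      by rewrite -cmE_eq0 => /eqP ->.
    rewrite -[RHS]big_filter; apply: perm_big; apply: uniq_perm; rewrite ?filter_uniq // => f.
    by rewrite mem_filter; case: (boolP (f \in finsupp l)) => // /(dm _ lM).
  rewrite (big_nth f0) big_mkord; apply: eq_bigr => j _.
  by rewrite index_uniq // /dig; case: eqP; rewrite ?muln0 // mulnC.
rewrite !wt // in wE.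
have dE := digits_inj _ _ wE.
apply/eqP/cmP => f.
have z l : l \in M -> f \notin d -> l f = 0%N.
  by move=> lM; apply: contraNeq; rewrite cmE_neq0; exact: dm.
have [fd|fd] := boolP (f \in d); last by rewrite !z.
(* The kept variable has digit 0 in the weight, so its exponent is compared through [mexp]. *)
have [oE|oN] := eqVneq o (Some f); first by move: eE; rewrite /mexp oE.
have := dE _ _ (index f d); rewrite index_mem fd /dig nth_index // (negPf oN).
by apply=> // j; case: ifP => // _; exact: mB.
Qed.

(** * The polynomial ring as a domain, and the exchange equation *)

Section PolyringDomain.
Variables (k : fieldType) (E : choiceType).
Implicit Types p q A B : polyring k E.

(** The weights are chosen for both supports at once, so that one ring morphism [kron] serves both
    and leading terms can be multiplied. *)
Lemma kron_top2 o p q : p != 0 -> q != 0 -> exists w : E -> nat,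
  (exists Np qp, qp != 0 /\ forall c,
    top_term Np (qp \Po ('X + (oshift k o c)%:P)) (kron o w (pshift c p))) /\
  (exists Nq qq, qq != 0 /\ forall c,
    top_term Nq (qq \Po ('X + (oshift k o c)%:P)) (kron o w (pshift c q))).
Proof.
move=> p0 q0.
have [w w0 sep] := @kron_weights E o ((msupp p : seq _) ++ (msupp q : seq _)).
exists w; split; apply: kron_top => // m n mp np; apply: sep; rewrite mem_cat ?mp ?np ?orbT //.
Qed.

Lemma oshift0 (o : option E) : oshift k o (fun=> 0) = 0.
Proof. by case: o. Qed.

(** Nonzero polynomials have nonzero images under a suitable Kronecker substitution, whose target is
    a domain. *)
Lemma polyring_mulf_neq0 p q : p != 0 -> q != 0 -> p * q != 0.
Proof.
move=> p0 q0.
have [w [[N [a [a0 ha]]] [N' [b [b0 hb]]]]] := kron_top2 None p0 q0.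
have nz (r : polyring k E) n (d : {poly k}) : d != 0 -> (forall c, top_term n
    (d \Po ('X + (oshift k None c)%:P)) (kron None w (pshift c r))) -> kron None w r != 0.
  move=> d0 /(_ (fun=> 0)); rewrite oshift0 addr0 comp_polyXr pshift0 // => h.
  by rewrite -lead_coef_eq0 (top_term_lead d0 h).1.
apply/eqP => pq; have := mulf_neq0 (nz _ _ _ a0 ha) (nz _ _ _ b0 hb).
by rewrite -rmorphM pq rmorph0 eqxx.
Qed.

Lemma polyring_mulIf p q r : r != 0 -> p * r = q * r -> p = q.
Proof.
move=> r0 E1; apply/eqP; rewrite -subr_eq0; apply/negPn/negP => pq.
by have := polyring_mulf_neq0 pq r0; rewrite mulrBl E1 subrr eqxx.
Qed.

Hypothesis k_pchar0 : [pchar k] =i pred0.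

Lemma comp_XaddC (p : {poly k}) (a b : k) :
  (p \Po ('X + a%:P)) \Po ('X + b%:P) = p \Po ('X + (a + b)%:P).
Proof.
by rewrite -comp_polyA comp_polyD comp_polyX comp_polyC -addrA -polyCD [b + a]addrC.
Qed.

Lemma lead_coef_XaddC (p : {poly k}) (a : k) : lead_coef (p \Po ('X + a%:P)) = lead_coef p.
Proof. by rewrite lead_coef_comp ?size_XaddC // lead_coefXaddC expr1n mulr1. Qed.

Lemma comp_XaddC_eq0 (p : {poly k}) (a : k) : (p \Po ('X + a%:P) == 0) = (p == 0).
Proof. by rewrite comp_poly2_eq0 ?size_XaddC. Qed.

Section Exchange.
Variables (A B : polyring k E) (g h : E -> int) (mu : k).
Hypotheses (A0 : A != 0) (B0 : B != 0) (mu0 : mu != 0).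
Hypothesis AB : A * pshift (fun e => - g e) B = mu%:MP * (B * pshift h A).

(** Comparing leading coefficients in the outer variable T turns the equation [AB] into the same
    equation in the kept variable alone. *)
Lemma exchange_top (o : option E) : exists (w : E -> nat) (N N' : nat) (a b : {poly k}),
  [/\ a != 0, b != 0, top_term N a (kron o w A), top_term N' b (kron o w B) &
   a * (b \Po ('X + (oshift k o (fun e => - g e))%:P)) =
   mu *: (b * (a \Po ('X + (oshift k o h)%:P)))].
Proof.
have [w [[N [a [a0 ha]]] [N' [b [b0 hb]]]]] := kron_top2 o A0 B0.
have hA : top_term N a (kron o w A).
  by have := ha (fun=> 0); rewrite oshift0 addr0 comp_polyXr pshift0.
have hB : top_term N' b (kron o w B).
  by have := hb (fun=> 0); rewrite oshift0 addr0 comp_polyXr pshift0.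
exists w, N, N', a, b; split; [exact: a0|exact: b0|exact: hA|exact: hB|].
have h1 := top_termM hA (hb (fun e => - g e)).
have h2 := top_termM (top_termC (mu%:P : {poly k})) (top_termM hB (ha h)).
have [|e1 _] := top_term_lead _ h1; first by rewrite mulf_neq0 ?comp_XaddC_eq0.
have [|e2 _] := top_term_lead _ h2; first by rewrite !mulf_neq0 ?comp_XaddC_eq0 ?polyC_eq0.
have E1 : kron o w A * kron o w (pshift (fun e => - g e) B) =
    mu%:P%:P * (kron o w B * kron o w (pshift h A)).
  have kM p q : kron o w (p * q) = kron o w p * kron o w q by exact: rmorphM.
  by rewrite -kM AB !kM kronC.
by rewrite -mul_polyC; apply: etrans (etrans (esym e1) _) e2; rewrite E1.
Qed.

(** Translations preserve leading coefficients, so both sides have the same leading coefficient up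
    to the factor [mu]. *)
Lemma exchange_scalar : mu = 1.
Proof.
have [w [N [N' [a [b [a0 b0 _ _ E1]]]]]] := exchange_top None.
move: E1 => /(congr1 lead_coef); rewrite lead_coefZ !lead_coefM !lead_coef_XaddC => E1.
have nz : lead_coef b * lead_coef a != 0 by rewrite mulf_neq0 ?lead_coef_eq0.
by apply: (mulIf nz); rewrite mul1r -E1 mulrC.
Qed.

(** A factor u_e survives as a factor of the leading term when u_e is the kept variable. *)
Lemma kron_pvar_size (C C' : polyring k E) e w N (c : {poly k}) : c != 0 ->
  top_term N c (kron (Some e) w C) -> C = pvar e * C' -> (1 < size c)%N.
Proof.
move=> c0 hc EC; have [lc _] := top_term_lead c0 hc.
move: c0; rewrite -lc EC rmorphM /= kronU /kvar eqxx lead_coefM lead_coefC.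
rewrite mulf_eq0 negb_or => /andP[X0 l0].
by rewrite (size_mul X0 l0) size_polyX addSn ltnS lt0n size_poly_eq0 l0.
Qed.

(** With u_e kept and both shifts positive, [shift_exchange_constant] makes the leading term of [B]
    constant, which a factor u_e forbids. *)
Lemma exchange_pos e B' : 0 < g e -> 0 < h e -> B <> pvar e * B'.
Proof.
move=> g0 h0 EB; have [w [N [N' [a [b [a0 b0 hA hB E1]]]]]] := exchange_top (Some e).
have sb := kron_pvar_size b0 hB EB.
move: g0 h0 E1; rewrite exchange_scalar scale1r /oshift; clear AB EB hA hB.
case: (g e) => // m; case: (h e) => // n m0 n0; rewrite rmorphN => E1.
have [] := @shift_exchange_constant _ k_pchar0 a b m n a0 b0 m0 n0; last first.
  by move=> _; rewrite leqNgt sb.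
(* Translating by [m] removes the negative shift of [b] and yields the form required by
   [shift_exchange_constant]. *)
move: E1 => /(congr1 (fun p : {poly k} => p \Po ('X + m%:R%:P))).
rewrite !comp_polyM !comp_XaddC addNr addr0 comp_polyXr => ->.
by rewrite natrD [m%:R + _]addrC.
Qed.

(** Negative shifts exchange the roles of [A] and [B] in [shift_exchange_constant]. *)
Lemma exchange_neg e A' : g e < 0 -> h e < 0 -> A <> pvar e * A'.
Proof.
move=> g0 h0 EA; have [w [N [N' [a [b [a0 b0 hA hB E1]]]]]] := exchange_top (Some e).
have sa := kron_pvar_size a0 hA EA.
move: g0 h0 E1; rewrite exchange_scalar scale1r /oshift; clear AB EA hA hB.
case: (g e) => // m; case: (h e) => // n _ _; rewrite !NegzE opprK mulrNz => E1.
have [] := @shift_exchange_constant _ k_pchar0 b a n.+1 m.+1 b0 a0 isT isT; last first.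
  by move=> _; rewrite leqNgt sa.
move: E1 => /(congr1 (fun p : {poly k} => p \Po ('X + n.+1%:R%:P))).
rewrite !comp_polyM !comp_XaddC addNr addr0 comp_polyXr => <-.
by rewrite natrD [n.+1%:R + _]addrC.
Qed.
End Exchange.
End PolyringDomain.

(** * Coefficients in the Weyl algebra *)

Section EndoRing.
Variable M : zmodType.

(** Target of the representation of the Weyl algebra; the scalars of [k] also act as additive
    maps. *)
Record endo := Endo {
  endo_fun :> M -> M;
  endo_add : {morph endo_fun : a b / a + b} }.

HB.instance Definition _ := gen_eqMixin endo.
HB.instance Definition _ := gen_choiceMixin endo.

Lemma endo_ext (f g : endo) : f =1 g -> f = g.
Proof.
case: f g => [f fD] [g gD] /= /funext fg; rewrite -fg in gD *.
by congr Endo; exact: Prop_irrelevance.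
Qed.

Lemma endo0_subproof : {morph (fun _ : M => 0 : M) : a b / a + b}.
Proof. by move=> a b; rewrite addr0. Qed.
Lemma endoD_subproof (f g : endo) : {morph (fun a => f a + g a) : a b / a + b}.
Proof. by move=> a b; rewrite !endo_add addrACA. Qed.
Lemma endoN_subproof (f : endo) : {morph (fun a => - f a) : a b / a + b}.
Proof. by move=> a b; rewrite !endo_add opprD. Qed.
Lemma endo1_subproof : {morph (id : M -> M) : a b / a + b}.
Proof. by []. Qed.
Lemma endoM_subproof (f g : endo) : {morph (fun a => f (g a)) : a b / a + b}.
Proof. by move=> a b; rewrite !endo_add. Qed.

Definition endo0 := Endo endo0_subproof.
Definition endoD f g := Endo (endoD_subproof f g).
Definition endoN f := Endo (endoN_subproof f).
Definition endo1 := Endo endo1_subproof.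
Definition endoM f g := Endo (endoM_subproof f g).

Lemma endo_addA : associative endoD.
Proof. by move=> f g h; apply: endo_ext => a /=; rewrite addrA. Qed.
Lemma endo_addC : commutative endoD.
Proof. by move=> f g; apply: endo_ext => a /=; rewrite addrC. Qed.
Lemma endo_add0 : left_id endo0 endoD.
Proof. by move=> f; apply: endo_ext => a /=; rewrite add0r. Qed.
Lemma endo_addN : left_inverse endo0 endoN endoD.
Proof. by move=> f; apply: endo_ext => a /=; rewrite addNr. Qed.
HB.instance Definition _ :=
  GRing.isZmodule.Build endo endo_addA endo_addC endo_add0 endo_addN.

Lemma endo_mulA : associative endoM.
Proof. by move=> f g h; apply: endo_ext. Qed.
Lemma endo_mul1 : left_id endo1 endoM.
Proof. by move=> f; apply: endo_ext. Qed.
Lemma endo_mul1r : right_id endo1 endoM.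
Proof. by move=> f; apply: endo_ext. Qed.
Lemma endo_mulDl : left_distributive endoM +%R.
Proof. by move=> f g h; apply: endo_ext. Qed.
Lemma endo_mulDr : right_distributive endoM +%R.
Proof. by move=> f g h; apply: endo_ext => a /=; rewrite endo_add. Qed.
HB.instance Definition _ := GRing.Zmodule_isPzRing.Build endo
  endo_mulA endo_mul1 endo_mul1r endo_mulDl endo_mulDr.
End EndoRing.

(** * Shift automorphisms indexed by degrees *)

Definition tau (k : fieldType) (E : choiceType) (g : {malg int[E]}) :
  {lrmorphism polyring k E -> polyring k E} := pshift (fun e => - g@_e).
Arguments tau {k E} g.

Section Tau.
Variables (k : fieldType) (E : choiceType).
Implicit Types (g h : {malg int[E]}) (p : polyring k E).

Lemma tauU g e : tau g (pvar e) = pvar e - (g@_e)%:~R :> polyring k E.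
Proof. by rewrite [LHS]pshiftU rmorphN. Qed.
Lemma tauC g c : tau g c%:MP = c%:MP :> polyring k E.
Proof. exact: pshiftC. Qed.
Lemma tauD g h p : tau g (tau h p) = tau (g + h) p.
Proof.
rewrite [LHS]pshift_comp; congr (pshift _ p); apply/funext => e.
by rewrite mcoeffD opprD.
Qed.
Lemma tau0 p : tau 0 p = p.
Proof. by apply: pshift0 => e; rewrite mcoeff0 oppr0. Qed.

Lemma tau_Cmul g c p : tau g (c%:MP * p) = c%:MP * tau g p.
Proof. by rewrite rmorphM /= tauC. Qed.

Lemma tau_Umul g e p :
  tau g (pvar e * p) = (pvar e - (g@_e)%:~R) * tau g p.
Proof. by rewrite rmorphM /= tauU. Qed.

Lemma tau_Umul0 g e p : g@_e = 0 -> tau g (pvar e * p) = pvar e * tau g p.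
Proof. by rewrite tau_Umul => ->; rewrite subr0. Qed.

Lemma tau_y_comm e e' p :
  pvar e * tau (- << e >>) (pvar e' * tau (- << e' >>) p) =
  pvar e' * tau (- << e' >>) (pvar e * tau (- << e >>) p).
Proof.
have [->//|ne] := eqVneq e e'; have ne' : e' != e by rewrite eq_sym.
have z (a b : E) : a != b -> (- << a >> : {malg int[E]})@_b = 0.
  by move=> ab; rewrite mcoeffN mcoeffU (negPf ab) mulr0n oppr0.
rewrite (tau_Umul0 _ (z _ _ ne)) (tau_Umul0 _ (z _ _ ne')) !tauD [- << e >> - _]addrC.
exact: mulrCA.
Qed.

(** The relation between y and x in the representation, read on values: for [e = e'] it reduces to
    u_e - (u_e - 1) = 1. *)
Lemma tau_yx_comm e e' p :
  pvar e * tau (- << e >>) (tau << e' >> p) - tau << e' >> (pvar e * tau (- << e >>) p) =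
  p *+ (e == e').
Proof.
rewrite tau_Umul !tauD mulrBl opprB addrC [- << e >> + _]addrC subrK mcoeffU eq_sym.
case: eqP => [->|_]; last by rewrite mulr0n mul0r.
by rewrite mulr1n mul1r subrr tau0.
Qed.

Lemma tau_neq0 g p : p != 0 -> tau g p != 0.
Proof.
by apply: contra => /eqP p0; rewrite -[p]tau0 -(addNr g) -tauD p0 rmorph0.
Qed.

Lemma pvar_add_neq0 e c : pvar e + c%:MP != 0 :> polyring k E.
Proof.
apply/eqP => /(congr1 (mcoeff (ucm e))) /eqP.
have h1 : (pvar e : polyring k E)@_(ucm e) = 1 by exact: mcoeffUU.
have h2 : (c%:MP : polyring k E)@_(ucm e) = 0 by rewrite mcoeffC cm1_eq1.
have h : (pvar e + c%:MP : polyring k E)@_(ucm e) = 1.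
  exact: etrans (mcoeffD _ _ _) (etrans (congr2 +%R h1 h2) (addr0 1)).
by rewrite h mcoeff0 oner_eq0.
Qed.
End Tau.

Lemma polyring_ind (k : fieldType) (E : choiceType) (P : polyring k E -> Prop) :
  (forall c, P c%:MP) -> (forall e, P (pvar e)) ->
  (forall p q, P p -> P q -> P (p + q)) -> (forall p q, P p -> P q -> P (p * q)) ->
  forall p, P p.
Proof.
move=> PC PU PD PM p; have P0 : P 0 by rewrite -malgC0E.
have P1 : P 1 by rewrite -mpolyC1E.
rewrite [p]monalgE; elim: (msupp p : seq _) => [|m s IH]; first by rewrite big_nil.
rewrite big_cons; apply: (PD); last exact: IH.
have -> : << p@_m *g m >> = (p@_m)%:MP * << m >> :> polyring k E.
  by rewrite malgM_def fgmulUU mulr1 mul1m.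
apply: (PM); [exact: PC|rewrite -mon_eval_pvar /mon_eval].
elim: (finsupp m : seq _) => [|e t IHt]; first by rewrite big_nil.
rewrite big_cons; apply: (PM); last exact: IHt.
elim: (m e) => [|n IHn]; first by rewrite expr0.
by rewrite exprS; apply: (PM); [exact: PU|exact: IHn].
Qed.

(** * A representation that separates the monomials z^g *)

Section WeylCoef.
Variables (k : fieldType) (E : choiceType).

Local Notation R := (polyring k E).
Local Notation W := (weyl k E).
Local Notation Z := {malg int[E]}.
Local Notation M := (Z -> R).

Definition act_cst (c : k) (f : M) : M := fun h => c%:MP * f h.
(** The value at [h] stands for a coefficient in degree [h]: [act_x] raises and [act_y] lowers the
    degree, both twisting by [tau]. The factor u_e in [act_y] makes [y_e x_e] act as multiplication
    by u_e. *)
Definition act_x (e : E) (f : M) : M := fun h => tau << e >> (f (h - << e >>)).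
Definition act_y (e : E) (f : M) : M :=
  fun h => pvar e * tau (- << e >>) (f (h + << e >>)).

Lemma act_cstD c : {morph act_cst c : f g / f + g}.
Proof. by move=> f g; apply/funext => h; rewrite [LHS]mulrDr. Qed.
Lemma act_xD e : {morph act_x e : f g / f + g}.
Proof. by move=> f g; apply/funext => h; rewrite [LHS]rmorphD. Qed.
Lemma act_yD e : {morph act_y e : f g / f + g}.
Proof. by move=> f g; apply/funext => h; rewrite /act_y [in LHS]rmorphD mulrDr. Qed.

Definition op_cst c : endo M := Endo (act_cstD c).
Definition op_x e : endo M := Endo (act_xD e).
Definition op_y e : endo M := Endo (act_yD e).

Lemma op_cst_rmorph : exists F : {rmorphism k -> endo M}, F =1 op_cst.
Proof.
apply: rmorph_pack => [c d|c d|]; apply: endo_ext => f; apply/funext => h /=.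
- by rewrite /act_cst raddfD [LHS]mulrDl.
- by rewrite /act_cst mpolyCM mulrA.
- by rewrite /act_cst [1%:MP]mpolyC1E mul1r.
Qed.

Lemma weyl_rep_ex : exists Th : {rmorphism W -> endo M},
  [/\ forall c, Th (weyl_cst E c) = op_cst c,
      forall e, Th (weyl_x e) = op_x e & forall e, Th (weyl_y e) = op_y e].
Proof.
have [Fc FcE] := op_cst_rmorph.
have [F [Fcst Fgen]] := free_ring_lift Fc
  (fun a => match a with GX e => op_x e | GY e => op_y e end).
have [|Th ThE] := @quot_ring_lift _ _ (@weyl_rel k E) F; last first.
  by exists Th; split=> [c|e|e]; rewrite [LHS]ThE ?Fcst ?Fgen ?FcE.
have Fnat (b : bool) : F b%:R = b%:R by rewrite rmorph_nat.
have tauCe e e' (p : R) : tau << e >> (tau << e' >> p) = tau << e' >> (tau << e >> p).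
  by rewrite !tauD addrC.
have natE (b : bool) (f : M) h : (b%:R : endo M) f h = f h *+ b by case: b.
move=> _ [c e|c e|e e'|e e'|e e']; rewrite !(rmorphB, rmorphM) /= ?Fnat ?Fcst ?Fgen ?FcE;
  apply/eqP; rewrite subr_eq0; apply/eqP; apply: endo_ext => f; apply/funext => h /=.
- by rewrite /act_x /act_cst [RHS]rmorphM /= tauC.
- by rewrite /act_y /act_cst tau_Cmul; exact: mulrCA.
- by rewrite /act_x tauCe addrAC.
- by rewrite /act_y [h + << e >> + _]addrAC; exact: tau_y_comm.
- rewrite natE; transitivity (f (h + << e >> - << e' >>) *+ (e == e')).
    have := tau_yx_comm e e' (f (h + << e >> - << e' >>)).
    by rewrite {2}[h + << e >> - _]addrAC.
  by case: eqP => [->|//]; rewrite addrK.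
Qed.

Definition weyl_rep : {rmorphism W -> endo M} := sval (cid weyl_rep_ex).

(** The image of the delta function at degree 0. For [rho p * zp g] it is concentrated in degree
    [g], with value p times a fixed nonzero factor. *)
Definition weyl_coef (a : W) : Z -> R := weyl_rep a (fun h => (h == 0)%:R).

Lemma weyl_coefB a b h : weyl_coef (a - b) h = weyl_coef a h - weyl_coef b h.
Proof. by rewrite /weyl_coef rmorphB. Qed.
Lemma weyl_coefD a b h : weyl_coef (a + b) h = weyl_coef a h + weyl_coef b h.
Proof. by rewrite /weyl_coef rmorphD. Qed.
Lemma weyl_coef_sum (I : Type) (r : seq I) (F : I -> W) h :
  weyl_coef (\sum_(i <- r) F i) h = \sum_(i <- r) weyl_coef (F i) h.
Proof.
elim: r => [|i r IH]; last by rewrite !big_cons weyl_coefD IH.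
by rewrite !big_nil /weyl_coef rmorph0.
Qed.
Lemma weyl_coef1 h : weyl_coef 1 h = (h == 0)%:R.
Proof. by rewrite /weyl_coef rmorph1. Qed.

Lemma weyl_coef_cst c a h : weyl_coef (weyl_cst E c * a) h = c%:MP * weyl_coef a h.
Proof. by rewrite /weyl_coef rmorphM /= /weyl_rep; case: cid => Th [/= -> _ _]. Qed.
Lemma weyl_coef_x e a h : weyl_coef (weyl_x e * a) h = tau << e >> (weyl_coef a (h - << e >>)).
Proof. by rewrite /weyl_coef rmorphM /= /weyl_rep; case: cid => Th [/= _ -> _]. Qed.
Lemma weyl_coef_y e a h :
  weyl_coef (weyl_y e * a) h = pvar e * tau (- << e >>) (weyl_coef a (h + << e >>)).
Proof. by rewrite /weyl_coef rmorphM /= /weyl_rep; case: cid => Th [/= _ _ ->]. Qed.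

Lemma weyl_coef_rho p a h : weyl_coef (weyl_rho p * a) h = p * weyl_coef a h.
Proof.
elim/polyring_ind: p a h => [c|e|p q IHp IHq|p q IHp IHq] a h.
- by rewrite weyl_rhoC weyl_coef_cst.
- by rewrite weyl_rhoU -mulrA weyl_coef_y weyl_coef_x tauD addNr tau0 addrK.
- by rewrite rmorphD mulrDl weyl_coefD IHp IHq -mulrDl.
- by rewrite rmorphM -mulrA IHp IHq mulrA.
Qed.

(** Powers of [act_y] produce the rising factorial u_e (u_e + 1) ..., one factor for each
    application; powers of [act_x] produce no factor. *)
Definition zpow_cf (e : E) (n : int) : R :=
  if n is Negz m then \prod_(i < m.+1) (pvar e + i%:R) else 1.

Lemma weyl_coef_zpow1 e n a h : weyl_coef (weyl_zpow1 k e n * a) h =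
  zpow_cf e n * tau << n *g e >> (weyl_coef a (h - << n *g e >>)).
Proof.
have Xn m b l : weyl_coef (weyl_x e ^+ m * b) l =
    tau << m%:Z *g e >> (weyl_coef b (l - << m%:Z *g e >>)).
  elim: m b l => [|m IH] b l; first by rewrite monalgU0 tau0 subr0 mul1r.
  rewrite exprS -mulrA weyl_coef_x IH tauD -monalgUD -addrA -opprD -monalgUD.
  by rewrite -intS.
case: n => [m|m] /=; first by rewrite mul1r Xn.
rewrite NegzE; elim: m.+1 a h => {m} [|m IH] a h.
  by rewrite oppr0 monalgU0 tau0 subr0 mul1r big_ord0 mul1r.
rewrite exprS -mulrA weyl_coef_y IH rmorphM /= tauD mulrA big_ord_recl addr0.
have E1 : tau (- << e >>) (\prod_(i < m) (pvar e + i%:R)) =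
    \prod_(i < m) (pvar e + (lift ord0 i)%:R) :> R.
  rewrite rmorph_prod; apply: eq_bigr => i _.
  rewrite rmorphD rmorph_nat /= tauU mcoeffN mcoeffUU rmorphN opprK -addrA.
  by congr (_ + _); exact: nat1r.
have E2 : - << e >> + << - m%:Z *g e >> = << - m.+1%:Z *g e >> :> Z.
  by rewrite -monalgUN -monalgUD -opprD -intS.
have E3 : h + << e >> - << - m%:Z *g e >> = h - << - m.+1%:Z *g e >>.
  by rewrite -E2 opprD opprK addrA.
by rewrite E1 E2 E3.
Qed.

(** The polynomial written C_g in the overview. *)
Definition zpow_coef (g : Z) : R := \prod_(e <- msupp g) zpow_cf e g@_e.

Lemma zpow_cf_tau e f (n m : int) : e != f -> tau << n *g e >> (zpow_cf f m) = zpow_cf f m.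
Proof.
move=> ef; case: m => m /=; rewrite ?rmorph1 // rmorph_prod; apply: eq_bigr => i _.
by rewrite rmorphD rmorph_nat /= tauU mcoeffU (negPf ef) mulr0n subr0.
Qed.

Lemma weyl_coef_zpow g a h : weyl_coef (weyl_zpow g * a) h =
  zpow_coef g * tau g (weyl_coef a (h - g)).
Proof.
rewrite {3 4}[g]monalgE /weyl_zpow /zpow_coef.
elim: (msupp g : seq E) (fset_uniq (msupp g)) a h => [|e s IH] /= us a h.
  by rewrite !big_nil !mul1r subr0 tau0.
have /andP[es us'] := us.
have E1 : tau << g@_e *g e >> (\prod_(f <- s) zpow_cf f g@_f) =
    \prod_(f <- s) zpow_cf f g@_f.
  rewrite rmorph_prod; apply: eq_big_seq => f fs; apply: zpow_cf_tau.
  by apply: contraNneq es => ->.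
rewrite 2!big_cons big_cons -mulrA weyl_coef_zpow1 (IH us').
rewrite [tau _ (_ * _)]rmorphM /= E1 tauD opprD addrA; exact: mulrA.
Qed.

Lemma zpow_coef_neq0 g : zpow_coef g != 0.
Proof.
rewrite /zpow_coef; elim: (msupp g : seq E) => [|e s IH]; first by rewrite big_nil oner_eq0.
rewrite big_cons; apply: polyring_mulf_neq0; last exact: IH.
rewrite /zpow_cf; case: (g@_e) => m; first by rewrite oner_eq0.
elim: m.+1 => {m} [|m IHm]; first by rewrite big_ord0 oner_eq0.
rewrite big_ord_recr /=; apply: polyring_mulf_neq0; first exact: IHm.
by rewrite -mpolyC_nat; exact: pvar_add_neq0.
Qed.
End WeylCoef.

(** * Normal forms in the Weyl algebra *)

Section WeylNormalForm.
Variables (k : fieldType) (E : choiceType).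

Local Notation R := (polyring k E).
Local Notation W := (weyl k E).
Local Notation Z := {malg int[E]}.
Local Notation rho := (@weyl_rho k E).
Local Notation x := (@weyl_x k E).
Local Notation y := (@weyl_y k E).
Local Notation zp1 := (@weyl_zpow1 k E).
Local Notation zp := (@weyl_zpow k E).

Lemma weyl_ind (P : W -> Prop) :
  (forall c, P (weyl_cst E c)) -> (forall e, P (x e)) -> (forall e, P (y e)) ->
  (forall a b, P a -> P b -> P (a + b)) -> (forall a, P a -> P (- a)) ->
  (forall a b, P a -> P b -> P (a * b)) -> forall a, P a.
Proof.
move=> Pc PX PY PD PN PM; elim/q_ind; elim/free_ring_ind => [r|[i|i]|a b Pa Pb|a Pa|a b Pa Pb].
- exact: Pc.
- exact: PX.
- exact: PY.
- by rewrite rmorphD; exact: PD.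
- by rewrite rmorphN; exact: PN.
- by rewrite rmorphM; exact: PM.
Qed.

Lemma weyl_rho_Usub e (c : int) : rho (pvar e - c%:~R) = y e * x e - c%:~R.
Proof.
exact: etrans (rmorphB rho _ _)
  (congr2 (fun a b => a - b) (weyl_rhoU k e) (rmorph_int rho c)).
Qed.

Lemma weyl_yxE e : y e * x e = x e * y e + 1.
Proof. by have := weyl_yx k e e; rewrite eqxx mulr1n => <-; rewrite addrC subrK. Qed.

Lemma weyl_xy e : x e * y e = rho (pvar e - 1%:~R).
Proof. by rewrite weyl_rho_Usub weyl_yxE addrK. Qed.

Lemma weyl_rho_tauM g p q : rho (tau g (p * q)) = rho (tau g p) * rho (tau g q).
Proof. exact: etrans (congr1 rho (rmorphM (tau g) p q)) (rmorphM rho _ _). Qed.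

Lemma weyl_x_rho e p : x e * rho p = rho (tau << e >> p) * x e.
Proof.
elim/polyring_ind: p => [c|f|p q IHp IHq|p q IHp IHq].
- by rewrite tauC weyl_rhoC; apply: commr_sym; exact: weyl_cstx.
- rewrite tauU weyl_rho_Usub weyl_rhoU mcoeffU.
  have [->|ef] := eqVneq e f.
    by rewrite mulr1n mulrA weyl_xy weyl_rho_Usub.
  rewrite mulr0n subr0; apply: commrM; last exact: weyl_xx.
  by apply: commr_sym; apply: weyl_yx_comm; rewrite eq_sym.
- by rewrite rmorphD mulrDr IHp IHq -mulrDl !rmorphD.
- by rewrite weyl_rho_tauM rmorphM mulrA IHp -mulrA IHq mulrA.
Qed.

Lemma weyl_y_rho e p : y e * rho p = rho (tau (- << e >>) p) * y e.
Proof.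
elim/polyring_ind: p => [c|f|p q IHp IHq|p q IHp IHq].
- by rewrite tauC weyl_rhoC; apply: commr_sym; exact: weyl_csty.
- rewrite tauU weyl_rho_Usub weyl_rhoU mcoeffN mcoeffU.
  have [->|ef] := eqVneq e f.
    by rewrite mulr1n rmorphN opprK mulrDl -mulrA weyl_yxE mulrDr mulr1 mul1r mulrA.
  rewrite mulr0n oppr0 addr0; apply: commrM; first exact: weyl_yy.
  exact: weyl_yx_comm.
- by rewrite rmorphD mulrDr IHp IHq -mulrDl !rmorphD.
- by rewrite weyl_rho_tauM rmorphM mulrA IHp -mulrA IHq mulrA.
Qed.

Lemma weyl_zpow1_rho e n p : zp1 e n * rho p = rho (tau << n *g e >> p) * zp1 e n.
Proof.
case: n => [n|n] /=.
  elim: n p => [|n IH] p; first by rewrite monalgU0 tau0 mul1r mulr1.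
  have E1 : << n%:Z *g e >> + << e >> = << n.+1%:Z *g e >> :> Z.
    by rewrite -monalgUD addrC -intS.
  by rewrite exprSr -mulrA weyl_x_rho mulrA IH tauD E1 -mulrA.
rewrite NegzE; elim: n.+1 p => {n} [|n IH] p; first by rewrite monalgU0 tau0 mul1r mulr1.
have E1 : << - n%:Z *g e >> - << e >> = << - n.+1%:Z *g e >> :> Z.
  by rewrite -monalgUN -monalgUD addrC -opprD -intS.
by rewrite exprSr -mulrA weyl_y_rho mulrA IH tauD E1 -mulrA.
Qed.

Lemma weyl_zpow_rho g p : zp g * rho p = rho (tau g p) * zp g.
Proof.
rewrite {2}[g]monalgE /weyl_zpow; elim: (msupp g : seq E) p => [|e s IH] p.
  by rewrite !big_nil tau0 mul1r mulr1.
by rewrite !big_cons -mulrA IH mulrA weyl_zpow1_rho tauD mulrA.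
Qed.

(** Different variables commute; in one variable, exponents of equal sign give powers of the same
    generator. *)
Lemma weyl_zpow1_comm e f m n : (e == f) ==> (0 <= m * n) ->
  GRing.comm (zp1 e m) (zp1 f n).
Proof.
have [<- /=|ef _] := eqVneq e f.
  by case: m n => [[|m]|m] [[|n]|n] //= _; do ?[exact: commr1|exact/commr_sym/commr1];
    apply: commrX; apply: commr_sym; apply: commrX; exact: commr_refl.
have fe : f != e by rewrite eq_sym.
case: m n => [m|m] [n|n]; apply: commrX; apply: commr_sym; apply: commrX.
- exact: weyl_xx.
- exact: weyl_yx_comm.
- exact/commr_sym/weyl_yx_comm.
- exact: weyl_yy.
Qed.

Lemma weyl_zpow_comm g h : (forall e, 0 <= g@_e * h@_e) -> GRing.comm (zp g) (zp h).
Proof.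
move=> gh; apply: commr_prod => f _; apply: commr_sym; apply: commr_prod => e _.
by apply: weyl_zpow1_comm; apply/implyP => /eqP ->; rewrite mulrC.
Qed.

Lemma weyl_zpowE (d : seq E) g : uniq d -> {subset msupp g <= d} ->
  zp g = \prod_(e <- d) zp1 e g@_e.
Proof.
move=> ud sd; rewrite /weyl_zpow.
transitivity (\prod_(e <- d | e \in msupp g) zp1 e g@_e); last first.
  rewrite big_mkcond; apply: eq_bigr => e _; case: ifP => // /negbT.
  by move=> /mcoeff_outdom ->.
rewrite -[RHS]big_filter; apply: prod_comm_perm.
  by move=> e f; apply: weyl_zpow1_comm; apply/implyP => /eqP ->; rewrite -expr2 sqr_ge0.
apply: uniq_perm; rewrite ?filter_uniq // => e.
by rewrite mem_filter; case: (boolP (e \in msupp g)) => // /sd.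
Qed.

Lemma weyl_zpow_split e g (d : seq E) : e \notin d -> uniq d -> {subset msupp g <= e :: d} ->
  zp g = zp1 e g@_e * \prod_(f <- d) zp1 f g@_f.
Proof.
move=> ed ud sd; rewrite (@weyl_zpowE (e :: d)) ?big_cons //=.
by rewrite ed.
Qed.

Lemma weyl_zpow1N e n : zp1 e (- n%:Z) = y e ^+ n.
Proof. by case: n => [|n]; rewrite -?NegzE. Qed.

Lemma weyl_x_zpow1 e n : exists c, x e * zp1 e n = rho c * zp1 e (n + 1).
Proof.
case: n => [n|n] /=.
  by exists 1; rewrite rmorph1 mul1r -exprS addn1.
exists (pvar e - 1%:~R); rewrite exprS mulrA weyl_xy; congr (_ * _).
have -> : Negz n + 1 = - n%:Z by rewrite NegzE intS opprD addrC addrA subrr add0r.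
by rewrite weyl_zpow1N.
Qed.

Lemma weyl_y_zpow1 e n : exists c, y e * zp1 e n = rho c * zp1 e (n - 1).
Proof.
case: n => [[|n]|n].
- by exists 1; rewrite rmorph1 mul1r add0r /= mulr1 expr1.
- have -> : Posz n.+1 - 1 = n by rewrite intS addrC addrA addNr add0r.
  by exists (pvar e); rewrite [zp1 _ n.+1]exprS mulrA weyl_rhoU.
- have -> : Negz n - 1 = Negz n.+1 by rewrite !NegzE -opprD addrC -intS.
  by exists 1; rewrite rmorph1 mul1r -exprS.
Qed.

(** Stated for a generic family [a] of degree [u], so that it serves x with [u = 1] and y with
    [u = -1]. The factor at [e] is brought to the front, where the one-variable rule applies. *)
Lemma weyl_xy_zpow (a : E -> W) (u : int) :
  (forall e n, exists c, a e * zp1 e n = rho c * zp1 e (n + u)) ->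
  forall e g, exists c, a e * zp g = rho c * zp (g + << u *g e >>).
Proof.
(* Adding [e] separately covers the supports of both [g] and [g + << u *g e >>], even if [e] is
   missing from either. *)
move=> au e g; pose d := rem e (undup (msupp g : seq E)).
have ud : uniq d by rewrite rem_uniq // undup_uniq.
have dE f : f \in d = (f != e) && (f \in msupp g).
  by rewrite /d mem_rem_uniq ?undup_uniq // inE mem_undup.
have ed : e \notin d by rewrite dE eqxx.
have sg : {subset msupp g <= e :: d}.
  by move=> f fg; rewrite inE dE fg andbT orbN.
have sg' : {subset msupp (g + << u *g e >>) <= e :: d}.
  move=> f; rewrite inE dE -mcoeff_neq0 mcoeffD mcoeffU.
  by have [//|fe] := eqVneq f e; rewrite mulr0n addr0 mcoeff_neq0.
have [c Ec] := au e g@_e; exists c.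
rewrite (weyl_zpow_split ed ud sg) (weyl_zpow_split ed ud sg') mulrA Ec -mulrA.
rewrite mcoeffD mcoeffUU; congr (_ * (_ * _)); apply: eq_big_seq => f fd.
rewrite mcoeffD mcoeffU; case: eqP => [ef|_]; last by rewrite mulr0n addr0.
by move: ed; rewrite ef fd.
Qed.

Inductive weyl_span : W -> Prop :=
| weyl_span0 : weyl_span 0
| weyl_spanD p h a : weyl_span a -> weyl_span (rho p * zp h + a).

Lemma weyl_span_add a b : weyl_span a -> weyl_span b -> weyl_span (a + b).
Proof.
move=> ha hb; elim: ha => [|p h c _ IH]; first by rewrite add0r.
by rewrite -addrA; exact: weyl_spanD.
Qed.

Lemma weyl_span_term p h : weyl_span (rho p * zp h).
Proof. by rewrite -[_ * _]addr0; apply: weyl_spanD; exact: weyl_span0. Qed.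

Lemma weyl_span_rho p a : weyl_span a -> weyl_span (rho p * a).
Proof.
elim=> [|q h c _ IH]; first by rewrite mulr0; exact: weyl_span0.
by rewrite mulrDr mulrA -rmorphM; exact: weyl_spanD.
Qed.

(** The span contains 1 and is stable under left multiplication by scalars and generators, since
    these pass R by [tau] and then alter one exponent. *)
Lemma weyl_spanT a : weyl_span a.
Proof.
suff H b : weyl_span b -> weyl_span (a * b).
  rewrite -[a]mulr1; apply: H.
  have -> : 1 = rho 1 * zp 0 by rewrite rmorph1 mul1r /weyl_zpow msupp0 big_nil.
  exact: weyl_span_term.
elim/weyl_ind: a b => [c|e|e|a b IHa IHb|a IHa|a b IHa IHb] d hd.
- by rewrite -weyl_rhoC; exact: weyl_span_rho.
- elim: hd => [|p h c _ IH]; first by rewrite mulr0; exact: weyl_span0.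
  rewrite mulrDr; apply: weyl_span_add; last exact: IH.
  rewrite mulrA weyl_x_rho -mulrA; apply: weyl_span_rho.
  by have [s ->] := weyl_xy_zpow weyl_x_zpow1 e h; exact: weyl_span_term.
- elim: hd => [|p h c _ IH]; first by rewrite mulr0; exact: weyl_span0.
  rewrite mulrDr; apply: weyl_span_add; last exact: IH.
  rewrite mulrA weyl_y_rho -mulrA; apply: weyl_span_rho.
  by have [s ->] := weyl_xy_zpow weyl_y_zpow1 e h; exact: weyl_span_term.
- by rewrite mulrDl; apply: weyl_span_add; [exact: IHa|exact: IHb].
- have -> : - a * d = rho (-1) * (a * d) by rewrite rmorphN rmorph1 mulN1r mulNr.
  by apply: weyl_span_rho; exact: IHa.
- by rewrite -mulrA; apply: IHa; exact: IHb.
Qed.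

Lemma weyl_normal_form a : exists (d : seq Z) (r : Z -> R),
  uniq d /\ a = \sum_(h <- d) rho (r h) * zp h.
Proof.
elim: (weyl_spanT a) => [|p h b _ [d [r [ud ->]]]].
  by exists [::], (fun=> 0); rewrite big_nil.
have [hd|hd] := boolP (h \in d).
  exists d, (fun l => if l == h then p + r h else r l); split=> //.
  rewrite (bigD1_seq h) //= [in RHS](bigD1_seq h) //= eqxx rmorphD mulrDl addrA.
  by congr (_ + _); apply: eq_bigr => l /negPf ->.
exists (h :: d), (fun l => if l == h then p else r l); split; first by rewrite /= hd.
rewrite big_cons eqxx; congr (_ + _); apply: eq_big_seq => l ld.
by case: eqP => // lh; rewrite -lh ld in hd.
Qed.

Lemma weyl_coef_term p g h : weyl_coef (rho p * zp g) h = p * zpow_coef k g *+ (h == g).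
Proof.
rewrite -[zp g]mulr1 weyl_coef_rho weyl_coef_zpow weyl_coef1 subr_eq0 rmorph_nat.
by case: eqP; rewrite ?mulr1 // !mulr0.
Qed.

Lemma weyl_coef_normal (d : seq Z) (r : Z -> R) h : uniq d ->
  weyl_coef (\sum_(g <- d) rho (r g) * zp g) h = (r h * zpow_coef k h) *+ (h \in d).
Proof.
move=> ud; rewrite weyl_coef_sum; under eq_bigr do rewrite weyl_coef_term.
have [hd|hd] := boolP (h \in d).
  rewrite (bigD1_seq h) //= eqxx big1 ?addr0 // => g /negPf gh.
  by rewrite eq_sym gh mulr0n.
rewrite big1_seq // => g /= gd; case: eqP => // hg; by rewrite hg gd in hd.
Qed.

(** In normal form the value at [h] is [r h] times the nonzero [zpow_coef k h], so R being a domain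
    forces every [r h] to vanish. *)
Lemma weyl_coef_inj (a b : W) : weyl_coef a =1 weyl_coef b -> a = b.
Proof.
move=> ab; apply/eqP; rewrite -subr_eq0; apply/eqP.
have ab0 h : weyl_coef (a - b) h = 0 by rewrite weyl_coefB ab subrr.
have [d [r [ud E1]]] := weyl_normal_form (a - b); rewrite E1 in ab0 *.
rewrite big1_seq // => h /= hd; have := ab0 h; rewrite weyl_coef_normal // hd mulr1n => r0.
suff -> : r h = 0 by rewrite rmorph0 mul0r.
apply: (polyring_mulIf (@zpow_coef_neq0 k E h)); by rewrite r0 mul0r.
Qed.

Lemma weyl_rho_inj : injective rho.
Proof.
move=> p q pq; have := weyl_coef_rho p 1 0; rewrite pq weyl_coef_rho weyl_coef1 eqxx.
by rewrite !mulr1 => ->.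
Qed.

Hypothesis k_pchar0 : [pchar k] =i pred0.

Lemma polyring_natr_eq0 (n : nat) : n%:R = 0 :> R -> n = 0%N.
Proof.
rewrite -mpolyC_nat -malgC0E => /eqP; rewrite malgC_eq ((pcharf0P k).1 k_pchar0).
by move/eqP.
Qed.

Lemma polyring_intr_inj (m n : int) : m%:~R = n%:~R :> R -> m = n.
Proof.
move=> mn; apply/eqP; rewrite -subr_eq0.
have {mn} : (m - n)%:~R = 0 :> R by rewrite mulrzBr mn subrr.
case: (m - n) => [l /polyring_natr_eq0 -> //|l].
by rewrite NegzE mulrNz => /eqP; rewrite oppr_eq0 => /eqP /polyring_natr_eq0.
Qed.

Lemma tau_inj (g h : Z) : (forall p : R, tau g p = tau h p) -> g = h.
Proof.
move=> gh; apply/malgP => e; have := gh (pvar e); rewrite !tauU => /addrI/oppr_inj.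
exact: polyring_intr_inj.
Qed.

(** Cancelling in each degree [h] where [a] has a nonzero coefficient gives [s = tau h]. Since [tau]
    determines its index in characteristic zero, only one such degree exists. *)
Lemma weyl_eigen (s : R -> R) (a : W) : a <> 0 -> (forall p, a * rho p = rho (s p) * a) ->
  exists (d : Z) (r : R), [/\ r != 0, a = rho r * zp d & forall p, s p = tau d p].
Proof.
move=> a0 as_; have [d [r [ud E1]]] := weyl_normal_form a.
have key h : h \in d -> r h != 0 -> forall p, s p = tau h p.
  move=> hd r0 p.
  have Ea : a * rho p = \sum_(g <- d) rho (r g * tau g p) * zp g.
    rewrite E1 mulr_suml; apply: eq_bigr => g _.
    by rewrite -mulrA weyl_zpow_rho mulrA -rmorphM.
  have e1 : weyl_coef (a * rho p) h = r h * tau h p * zpow_coef k h.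
    by rewrite Ea (weyl_coef_normal (fun g => r g * tau g p) h ud) hd mulr1n.
  have e2 : weyl_coef a h = r h * zpow_coef k h.
    rewrite E1 (weyl_coef_normal r h ud) hd mulr1n; reflexivity.
  have E2 : weyl_coef (a * rho p) h = s p * weyl_coef a h.
    by rewrite as_; exact: weyl_coef_rho.
  have E3 : r h * tau h p * zpow_coef k h = s p * (r h * zpow_coef k h).
    exact: etrans (esym e1) (etrans E2 (congr1 _ e2)).
  apply: (polyring_mulIf (polyring_mulf_neq0 r0 (@zpow_coef_neq0 k E h))).
  apply: etrans (esym E3) _.
  exact: etrans (congr1 (fun t => t * _) (mulrC _ _)) (esym (mulrA _ _ _)).
have [h hd rh0] : exists2 h, h \in d & r h != 0.
  apply: contrapT => none; apply: a0; rewrite E1 big1_seq // => h /= hd.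
  suff -> : r h = 0 by rewrite rmorph0 mul0r.
  by apply/eqP/negPn/negP => rh; apply: none; exists h.
exists h, (r h); split; [exact: rh0| |exact: key].
rewrite E1 (bigD1_seq h) //= big1_seq ?addr0 // => g /andP[gh gd].
suff -> : r g = 0 by rewrite rmorph0 mul0r.
apply/eqP/negPn/negP => rg; move/eqP: gh; apply; apply: tau_inj => p.
by rewrite -(key g) // (key h).
Qed.

Lemma weyl_star_zpow1 e n : weyl_star (zp1 e n) = zp1 e (- n).
Proof.
have hs := involution_antihom (@weyl_star_inv k E); have [_ s1 _] := hs.
have sX (a : W) m : weyl_star (a ^+ m) = weyl_star a ^+ m.
  elim: m => [|m IH]; first exact: s1.
  by rewrite exprS (antihomM hs) IH -exprSr.
case: n => [n|n]; first by rewrite weyl_zpow1N /= sX weyl_star_x.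
by rewrite NegzE opprK weyl_zpow1N sX weyl_star_y.
Qed.

Lemma weyl_star_zpow g : weyl_star (zp g) = zp (- g).
Proof.
have hs := involution_antihom (@weyl_star_inv k E); have [_ s1 _] := hs.
rewrite /weyl_zpow msuppN; elim: (msupp g : seq E) (fset_uniq (msupp g)) => [|e s IH] us.
  by rewrite !big_nil; exact: s1.
have /andP[es us'] := us.
rewrite !big_cons (antihomM hs) (IH us') weyl_star_zpow1 mcoeffN.
apply: commr_sym; rewrite big_seq; apply: commr_prod => f fs; apply: weyl_zpow1_comm.
by apply/implyP => /eqP ef; rewrite ef fs in es.
Qed.

Lemma weyl_coef0 h : weyl_coef (0 : W) h = 0.
Proof. by have := weyl_coefB (0 : W) 0 h; rewrite subr0 subrr. Qed.

(** The degree-zero value of the product is [C_(-g) * tau (- g) (p * p * C_g)], a product of nonzero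
    factors unless [p = 0]. *)
Lemma weyl_star_term_eq0 p g :
  weyl_star (rho p * zp g) * (rho p * zp g) = 0 -> rho p * zp g = 0.
Proof.
have hs := involution_antihom (@weyl_star_inv k E).
rewrite (antihomM hs) weyl_star_rho weyl_star_zpow => E1.
suff -> : p = 0 by rewrite rmorph0 mul0r.
apply/eqP/negPn/negP => p0.
have := congr1 (fun b : W => weyl_coef b 0) E1.
rewrite -mulrA weyl_coef_zpow sub0r opprK weyl_coef_rho weyl_coef_term eqxx mulr1n.
rewrite weyl_coef0 => /eqP; apply/negP.
apply: polyring_mulf_neq0; first exact: zpow_coef_neq0.
apply: tau_neq0; apply: polyring_mulf_neq0; first exact: p0.
apply: polyring_mulf_neq0; [exact: p0|exact: zpow_coef_neq0].
Qed.

End WeylNormalForm.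

(** * Universal properties of TGW constructions *)

Section TgwLift.
Variables (k : fieldType) (R : algType k) (V : choiceType).
Variables (D : tgw_datum R V) (mu : V -> V -> k) (B : pzRingType).

Lemma tgwc_lift (f : {rmorphism R -> B}) (x y : V -> B) :
  (forall i r, x i * f r = f (tgw_sigma D i r) * x i) ->
  (forall i r, y i * f r = f (tgw_sigmaV D i r) * y i) ->
  (forall i, y i * x i = f (tgw_t D i)) ->
  (forall i, x i * y i = f (tgw_sigma D i (tgw_t D i))) ->
  (forall i j, i != j -> x i * y j = f (mu i j)%:A * (y j * x i)) ->
  exists F : {rmorphism tgwc D mu -> B},
    [/\ forall r, F (tgwc_rho D mu r) = f r, forall i, F (tgwc_X D mu i) = x i
      & forall i, F (tgwc_Y D mu i) = y i].
Proof.
move=> xr yr yx xy xymu.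
have [F [Fc Fg]] := free_ring_lift f
  (fun a : xy_gen V => match a with GX i => x i | GY i => y i end).
have [|F' F'E] := @quot_ring_lift _ _ (tgw_rel D mu) F; last first.
  by exists F'; split=> [r|i|i]; rewrite [LHS]F'E ?Fc ?Fg.
move=> _ [i r|i r|i|i|i j ij]; rewrite rmorphB !rmorphM ?Fc ?Fg; apply/eqP;
  rewrite subr_eq0; apply/eqP.
- exact: xr.
- exact: yr.
- exact: yx.
- exact: xy.
- exact: xymu.
Qed.

Lemma null_ideal_tgw_pi I (b : tgwc D mu) : tgwc_null_ideal I -> I b -> tgw_pi b = 0.
Proof.
move=> hI Ib; apply/qpi_eq0; rewrite tgwc_rad_gen; exists [:: b]; last by rewrite big_seq1.
by move=> c; rewrite inE => /eqP ->; exists I.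
Qed.

(** Null ideals are graded, so vanishing on their homogeneous elements implies vanishing on the sum
    of all of them. *)
Lemma tgw_lift (F : {rmorphism tgwc D mu -> B}) :
  (forall I g b, tgwc_null_ideal I -> I b -> tgwc_homog g b -> F b = 0) ->
  exists F' : {rmorphism tgw D mu -> B}, forall a, F' (tgw_pi a) = F a.
Proof.
move=> FI; have [|F' F'E] := @quot_ring_lift _ _ (@tgwc_rad _ _ _ D mu) F; last by exists F'.
move=> _ [s hs ->]; rewrite rmorph_sum big1_seq // => b /hs[I hI Ib].
have [[_ /(_ b Ib)[t ht ->]] _] := hI.
by rewrite rmorph_sum big1_seq // => c /ht[Ic [g hc]]; exact: FI hI Ic hc.
Qed.

Lemma tgw_homogB g (a b : tgw D mu) : tgw_homog g a -> tgw_homog g b -> tgw_homog g (a - b).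
Proof. by move=> [c hc <-] [d hd <-]; exists (c - d); rewrite ?rmorphB //; exact: homog_B. Qed.
Lemma tgw_homogM g h (a b : tgw D mu) :
  tgw_homog g a -> tgw_homog h b -> tgw_homog (g + h) (a * b).
Proof. by move=> [c hc <-] [d hd <-]; exists (c * d); rewrite ?rmorphM //; exact: homog_M. Qed.
Lemma tgw_homog_rho r : tgw_homog 0 (tgw_rho D mu r).
Proof. by exists (tgwc_rho D mu r) => //; exact: homog_rho. Qed.
Lemma tgw_homog_X i : tgw_homog << i >> (tgw_X D mu i).
Proof. by exists (tgwc_X D mu i) => //; exact: homog_X. Qed.
Lemma tgw_homog_Y i : tgw_homog (- << i >>) (tgw_Y D mu i).
Proof. by exists (tgwc_Y D mu i) => //; exact: homog_Y. Qed.

Lemma tgw_XR i r : tgw_X D mu i * tgw_rho D mu r = tgw_rho D mu (tgw_sigma D i r) * tgw_X D mu i.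
Proof. by have := congr1 (@tgw_pi _ _ _ D mu) (tgwc_XR D mu i r); rewrite !rmorphM. Qed.
Lemma tgw_YX i : tgw_Y D mu i * tgw_X D mu i = tgw_rho D mu (tgw_t D i).
Proof. by have := congr1 (@tgw_pi _ _ _ D mu) (tgwc_YX D mu i); rewrite !rmorphM. Qed.
Lemma tgw_XY i : tgw_X D mu i * tgw_Y D mu i = tgw_rho D mu (tgw_sigma D i (tgw_t D i)).
Proof. by have := congr1 (@tgw_pi _ _ _ D mu) (tgwc_XY D mu i); rewrite !rmorphM. Qed.
Lemma tgw_YR i r : tgw_Y D mu i * tgw_rho D mu r = tgw_rho D mu (tgw_sigmaV D i r) * tgw_Y D mu i.
Proof. by have := congr1 (@tgw_pi _ _ _ D mu) (tgwc_YR D mu i r); rewrite !rmorphM. Qed.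
Lemma tgw_XYmu i j : i != j -> tgw_X D mu i * tgw_Y D mu j =
  tgw_rho D mu (mu i j)%:A * (tgw_Y D mu j * tgw_X D mu i).
Proof. by move=> ij; have := congr1 (@tgw_pi _ _ _ D mu) (tgwc_XYmu D mu ij); rewrite !rmorphM. Qed.
End TgwLift.

(** * Multiquivers and their canonical representations *)

Section QuiverCombinatorics.
Variables (V E : choiceType).

Lemma mq_gamma_t (G : multiquiver V E) e v n : mq_t G e = Some (v, n) -> mq_gamma G e v = n%:Z.
Proof. by rewrite /mq_gamma => ->; rewrite eqxx. Qed.

Lemma mq_gamma_s (G : multiquiver V E) e v n :
  mq_s G e = Some (v, n) -> mq_gamma G e v = - n%:Z.
Proof.
move=> se; rewrite /mq_gamma se eqxx; case te: (mq_t G e) => [[w m]|//].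
by case: eqP => // wv; case: (mq_loopless se te).
Qed.

Lemma mq_gamma_gt0 (G : multiquiver V E) e v :
  0 < mq_gamma G e v -> mq_t G e = Some (v, `|mq_gamma G e v|%N).
Proof.
rewrite /mq_gamma; case: mq_t => [[w m]|]; first case: eqP => [->//|_];
  by case: mq_s => [[u n]|//]; case: eqP => // _; rewrite oppr_gt0.
Qed.

Lemma mq_gamma_lt0 (G : multiquiver V E) e v :
  mq_gamma G e v < 0 -> mq_s G e = Some (v, `|mq_gamma G e v|%N).
Proof.
rewrite /mq_gamma; case: mq_t => [[w m]|]; first case: eqP => [_ //|_];
  by case: mq_s => [[u n]|//]; case: eqP => // ->; rewrite abszN.
Qed.

(** An edge has at most one source and one target, so a row of the incidence matrix has at most one
    entry of each sign. *)
Lemma mq_gamma_le0 (G : multiquiver V E) e i j :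
  i != j -> mq_gamma G e i * mq_gamma G e j <= 0.
Proof.
move=> ij; rewrite leNgt; apply/negP => gt0.
have [i0|i0|i0] := ltgtP (mq_gamma G e i) 0; last by rewrite i0 mul0r in gt0.
  have j0 : mq_gamma G e j < 0 by rewrite -(nmulr_rgt0 _ i0).
  have := mq_gamma_lt0 i0; rewrite (mq_gamma_lt0 j0) => -[ji _].
  by rewrite ji eqxx in ij.
have j0 : 0 < mq_gamma G e j by rewrite -(pmulr_rgt0 _ i0).
have := mq_gamma_gt0 i0; rewrite (mq_gamma_gt0 j0) => -[ji _].
by rewrite ji eqxx in ij.
Qed.

(** The positive entry in row [e] recovers the target with its multiplicity, and the negative entry
    the source. *)
Lemma multiquiver_eq (G G' : multiquiver V E) :
  (forall e v, mq_gamma G e v = mq_gamma G' e v) -> G = G'.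
Proof.
move=> gE.
have t_sub (H H' : multiquiver V E) e p : (forall v, mq_gamma H e v = mq_gamma H' e v) ->
    mq_t H e = Some p -> mq_t H' e = Some p.
  case: p => v n hE te; have gv := mq_gamma_t te.
  have : 0 < mq_gamma H' e v by rewrite -hE gv; exact: (mq_t_gt0 te).
  by move=> /mq_gamma_gt0; rewrite -hE gv.
have s_sub (H H' : multiquiver V E) e p : (forall v, mq_gamma H e v = mq_gamma H' e v) ->
    mq_s H e = Some p -> mq_s H' e = Some p.
  case: p => v n hE se; have gv := mq_gamma_s se.
  have : mq_gamma H' e v < 0 by rewrite -hE gv oppr_lt0; exact: (mq_s_gt0 se).
  by move=> /mq_gamma_lt0; rewrite -hE gv abszN.
have sE : mq_s G = mq_s G'.
  apply/funext => e; case s1: (mq_s G e) => [p|].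
    by rewrite (s_sub G G' e p).
  case s2: (mq_s G' e) => [p|//].
  by rewrite (s_sub G' G e p) in s1.
have tE : mq_t G = mq_t G'.
  apply/funext => e; case s1: (mq_t G e) => [p|].
    by rewrite (t_sub G G' e p).
  case s2: (mq_t G' e) => [p|//].
  by rewrite (t_sub G' G e p) in s1.
case: G G' sE tE {gE} => [s t a b c d] [s' t' a' b' c' d'] /= sE tE.
by subst s' t'; congr Multiquiver; exact: Prop_irrelevance.
Qed.

(** The sign condition leaves at most one positive and one negative entry for each edge; local
    finiteness comes from the finite support of [g v]. *)
Lemma multiquiver_exists (g : V -> {malg int[E]}) :
  (forall i j e, i != j -> (g i)@_e * (g j)@_e <= 0) ->
  exists G : multiquiver V E, forall v, mq_incidence G v = g v.
Proof.
move=> g_opp.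
(* The chosen vertex is the only one with an entry of that sign, which is what [tP] and [sP]
   record. *)
pose t e := if pselect (exists v, 0 < (g v)@_e) is left ex
  then Some (sval (cid ex), `|(g (sval (cid ex)))@_e|%N) else None.
pose s e := if pselect (exists v, (g v)@_e < 0) is left ex
  then Some (sval (cid ex), `|(g (sval (cid ex)))@_e|%N) else None.
have tP e v n : t e = Some (v, n) <-> 0 < (g v)@_e /\ n = `|(g v)@_e|%N.
  rewrite /t; case: pselect => [ex|nex]; last first.
    by split=> // -[gt0 _]; case: nex; exists v.
  case: cid => w /= gw; split=> [[<- <-]//|[gv ->]].
  suff -> : w = v by [].
  apply/eqP/negPn/negP => wv; have := g_opp _ _ e wv.
  by rewrite leNgt mulr_gt0.
have sP e v n : s e = Some (v, n) <-> (g v)@_e < 0 /\ n = `|(g v)@_e|%N.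
  rewrite /s; case: pselect => [ex|nex]; last first.
    by split=> // -[gt0 _]; case: nex; exists v.
  case: cid => w /= gw; split=> [[<- <-]//|[gv ->]].
  suff -> : w = v by [].
  apply/eqP/negPn/negP => wv; have := g_opp _ _ e wv.
  by rewrite leNgt nmulr_rgt0 // gv.
have s_gt0 e v n : s e = Some (v, n) -> (0 < n)%N.
  by move=> /sP[gv ->]; rewrite absz_gt0 lt_eqF.
have t_gt0 e v n : t e = Some (v, n) -> (0 < n)%N.
  by move=> /tP[gv ->]; rewrite absz_gt0 gt_eqF.
have loopless e u m v n : s e = Some (u, m) -> t e = Some (v, n) -> u <> v.
  by move=> /sP[gu _] /tP[gv _] uv; move: gv; rewrite -uv ltNge ltW.
have locfin v : finite_set
    (fun e => (exists n, s e = Some (v, n)) \/ exists n, t e = Some (v, n)).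
  apply: (@sub_finite_set _ _ [set` msupp (g v)]%classic); last exact: finite_fset.
  move=> e /=; rewrite -mcoeff_neq0.
  by case=> -[n]; [move=> /sP[/lt_eqF-> _]|move=> /tP[/gt_eqF-> _]].
exists (@Multiquiver V E s t s_gt0 t_gt0 loopless locfin) => v.
apply/malgP => e; rewrite mq_incidenceE /mq_gamma /=.
case te: (t e) => [[w n]|]; first case: eqP => [wv|wv].
- by move: te => /tP[]; rewrite wv => gw ->; rewrite gtz0_abs.
- have gv : (g v)@_e <= 0.
    by rewrite leNgt; apply/negP => gv; have := (tP e v _).2 (conj gv erefl); rewrite te => -[].
  case se: (s e) => [[u m]|].
    case: eqP => [uv|uv].
      by move: se => /sP[]; rewrite uv => gu ->; rewrite ltz0_abs // opprK.
    apply/esym/eqP; rewrite eq_le gv /= leNgt; apply/negP => gv'.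
    by have := (sP e v _).2 (conj gv' erefl); rewrite se => -[].
  apply/esym/eqP; rewrite eq_le gv /= leNgt; apply/negP => gv'.
  by have := (sP e v _).2 (conj gv' erefl); rewrite se.
- have gv : (g v)@_e <= 0.
    by rewrite leNgt; apply/negP => gv; have := (tP e v _).2 (conj gv erefl); rewrite te.
  case se: (s e) => [[u m]|].
    case: eqP => [uv|uv].
      by move: se => /sP[]; rewrite uv => gu ->; rewrite ltz0_abs // opprK.
    apply/esym/eqP; rewrite eq_le gv /= leNgt; apply/negP => gv'.
    by have := (sP e v _).2 (conj gv' erefl); rewrite se => -[].
  apply/esym/eqP; rewrite eq_le gv /= leNgt; apply/negP => gv'.
  by have := (sP e v _).2 (conj gv' erefl); rewrite se.
Qed.
End QuiverCombinatorics.

(** * The involution before and after passing to the quotient *)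

Section TgwcStar.
Variables (k : fieldType) (R : comAlgType k) (V : choiceType).
Variables (D : tgw_datum R V) (mu : V -> V -> k).
Hypothesis mu_sym : forall i j, i != j -> mu i j = mu j i.

Lemma tgwc_star_rho r : tgwc_star (tgwc_rho D mu r) = tgwc_rho D mu r.
Proof. by rewrite (tgwc_starE D mu_sym) free_star_cst. Qed.
Lemma tgwc_star_X i : tgwc_star (tgwc_X D mu i) = tgwc_Y D mu i.
Proof. by rewrite (tgwc_starE D mu_sym) free_star_X. Qed.
Lemma tgwc_star_Y i : tgwc_star (tgwc_Y D mu i) = tgwc_X D mu i.
Proof. by rewrite (tgwc_starE D mu_sym) free_star_Y. Qed.
Lemma tgw_star_pi a : tgw_star (tgw_pi a) = tgw_pi (tgwc_star a) :> tgw D mu.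
Proof.
apply: qstarE; [exact: tgwc_star_inv|exact: tgwc_rad_star].
Qed.
End TgwcStar.

(** * Construction of the canonical representation *)

Section Canonical.
Variables (k : fieldType) (V E : choiceType) (G : multiquiver V E).
Hypothesis k_pchar0 : [pchar k] =i pred0.

Local Notation R := (polyring k E).
Local Notation W := (weyl k E).
Local Notation Z := {malg int[E]}.
Local Notation rho := (@weyl_rho k E).
Local Notation zp := (@weyl_zpow k E).
Local Notation inc := (mq_incidence G).

Lemma mq_sigma_tau v (p : R) : mq_sigma k G v p = tau (inc v) p.
Proof. by congr (pshift _ p); apply/funext => e; rewrite mq_incidenceE. Qed.
Lemma mq_sigmaV_tau v (p : R) : mq_sigmaV G v p = tau (- inc v) p.
Proof. by congr (pshift _ p); apply/funext => e; rewrite mcoeffN opprK mq_incidenceE. Qed.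

Definition inc_lin (g : {malg int[V]}) : Z := \sum_(v <- msupp g) inc v *~ g@_v.

Lemma inc_linEw (d : {fset V}) g : (msupp g `<=` d)%fset ->
  inc_lin g = \sum_(v <- d) inc v *~ g@_v.
Proof.
move=> le; rewrite [LHS](big_fset_incl _ le) // => v vd /mcoeff_outdom ->.
exact: mulr0z.
Qed.

Lemma inc_linB g h : inc_lin (g - h) = inc_lin g - inc_lin h.
Proof.
pose d := (msupp g `|` msupp h)%fset.
rewrite (@inc_linEw d) ?msuppB_le // (@inc_linEw d g) ?fsubsetUl //.
rewrite (@inc_linEw d h) ?fsubsetUr // -sumrB; apply: eq_bigr => v _.
by rewrite mcoeffB mulrzBr.
Qed.

Lemma inc_lin0 : inc_lin 0 = 0.
Proof. by rewrite /inc_lin msupp0 big_nil. Qed.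
Lemma inc_linN g : inc_lin (- g) = - inc_lin g.
Proof. by rewrite -sub0r inc_linB inc_lin0 sub0r. Qed.
Lemma inc_linD g h : inc_lin (g + h) = inc_lin g + inc_lin h.
Proof. by rewrite -{1}[h]opprK inc_linB inc_linN opprK. Qed.
Lemma inc_linU v : inc_lin << v >> = inc v.
Proof.
by rewrite (@inc_linEw [fset v]%fset) ?msuppU_le // big_seq_fset1 mcoeffUU mulr1z.
Qed.

(** Degree expressed by commutation with R, which passes to sums and products. In characteristic
    zero it describes exactly the multiples [rho r * zp d]. *)
Definition weyl_homog (d : Z) (a : W) := forall p, a * rho p = rho (tau d p) * a.

Lemma weyl_homog_term d a : weyl_homog d a -> exists r, a = rho r * zp d.
Proof.
move=> ha; have [->|/eqP a0] := eqVneq a 0; first by exists 0; rewrite rmorph0 mul0r.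
have [d' [r [_ Ea dd']]] := weyl_eigen k_pchar0 a0 ha.
by exists r; rewrite (tau_inj k_pchar0 dd').
Qed.

Section Homog.
Variables (F : {rmorphism tgwc (mq_datum G k_pchar0) (@mq_mu k V) -> W}).
Hypothesis Frho : forall r, F (tgwc_rho _ _ r) = rho r.
Hypothesis FX : forall v, F (tgwc_X _ _ v) = zp (inc v).
Hypothesis FY : forall v, F (tgwc_Y _ _ v) = zp (- inc v).

Lemma canonical_homog g a : tgwc_homog g a -> weyl_homog (inc_lin g) (F a).
Proof.
elim=> {g a} [r|v|v|g|g a b _ IHa _ IHb|g h a b _ IHa _ IHb] p.
- by rewrite inc_lin0 tau0 Frho -!rmorphM mulrC.
- by rewrite inc_linU FX weyl_zpow_rho.
- by rewrite inc_linN inc_linU FY weyl_zpow_rho.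
- by rewrite rmorph0 mul0r mulr0.
- by rewrite rmorphB mulrBl IHa IHb -mulrBr.
- by rewrite rmorphM -mulrA IHb mulrA IHa tauD inc_linD -mulrA.
Qed.
End Homog.

(** Variable by variable, this is y^n x^n = u (u + 1) ... (u + n - 1) for a positive entry n, and
    x^n y^n = (u - 1) ... (u - n) for an entry -n. *)
Lemma zpow_coef_mq_tt v : zpow_coef k (- inc v) * tau (- inc v) (zpow_coef k (inc v)) = mq_tt k G v.
Proof.
have -> : mq_tt k G v = \prod_(e <- msupp (inc v)) mq_u k G e v.
  apply: fsbigTE => e; rewrite -mcoeff_eq0 mq_incidenceE /mq_u => /eqP ->.
  exact: big_ord0.
rewrite /zpow_coef msuppN rmorph_prod -big_split; apply: eq_bigr => e _ /=.
rewrite mcoeffN /mq_u -mq_incidenceE.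
have tE := @tauU k E (- inc v) e; rewrite mcoeffN in tE.
case: ((inc v)@_e) tE => n tE.
  by rewrite rmorph1 mulr1; case: n {tE} => [|n]; rewrite ?big_ord0.
(* The shifted factors run from u - (n + 1) up to u - 1, hence the reversal of the index. *)
rewrite /zpow_cf NegzE opprK mul1r rmorph_prod (reindex_inj rev_ord_inj) /=.
apply: eq_bigr => i _; rewrite rmorphD rmorph_nat /= tE NegzE !opprK -addrA; congr (_ + _).
by rewrite natrB ?ltn_ord //; exact: addKr.
Qed.

Lemma weyl_zpow_inv g h p : g + h = 0 -> zpow_coef k g * tau g (zpow_coef k h) = p ->
  zp g * zp h = rho p.
Proof.
have mb (A : pzRingType) (f : {additive A -> A}) (b : bool) (s t : A) :
    s * f (t *+ b) = s * f t * b%:R.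
  by case: b; rewrite ?mulr1n ?mulr1 // !mulr0n raddf0 !mulr0.
move=> gh0 <-; apply: weyl_coef_inj => l; rewrite weyl_coef_zpow.
have -> : weyl_coef (zp h) (l - g) = zpow_coef k h *+ (l == 0).
  have -> : zp h = rho 1 * zp h by rewrite [rho 1](rmorph1 rho) mul1r.
  by rewrite weyl_coef_term mul1r -subr_eq0 -addrA -opprD gh0 subr0.
rewrite -[rho _]mulr1 weyl_coef_rho weyl_coef1; exact: mb.
Qed.

Lemma weyl_zpowNK v : zp (- inc v) * zp (inc v) = rho (mq_tt k G v).
Proof. by apply: weyl_zpow_inv; [rewrite addNr|exact: zpow_coef_mq_tt]. Qed.

Lemma weyl_zpowKN v : zp (inc v) * zp (- inc v) = rho (tau (inc v) (mq_tt k G v)).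
Proof.
apply: weyl_zpow_inv; first by rewrite subrr.
have E1 p : tau (inc v) (tau (- inc v) p) = p :> R by rewrite tauD subrr tau0.
rewrite -zpow_coef_mq_tt; apply/esym; apply: etrans (rmorphM (tau (inc v)) _ _) _.
exact: etrans (congr1 (fun t => _ * t) (E1 _)) (mulrC _ _).
Qed.

Lemma canonical_rep_exists :
  exists phiG : inv_map (mq_algebra G k_pchar0) (weyl_inv k E), is_canonical_rep phiG.
Proof.
have [| | | | |F [Frho FX FY]] := @tgwc_lift k R V (mq_datum G k_pchar0) (@mq_mu k V) W
    rho (fun v => zp (inc v)) (fun v => zp (- inc v)).
- by move=> v p; rewrite weyl_zpow_rho [tgw_sigma _ _ _]mq_sigma_tau.
- by move=> v p; rewrite weyl_zpow_rho [tgw_sigmaV _ _ _]mq_sigmaV_tau.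
- exact: weyl_zpowNK.
- by move=> v; rewrite weyl_zpowKN [tgw_sigma _ _ _]mq_sigma_tau.
- move=> i j ij; rewrite /mq_mu scale1r (rmorph1 rho) mul1r.
  apply: weyl_zpow_comm => e; rewrite mcoeffN mulrN oppr_ge0 !mq_incidenceE.
  exact: mq_gamma_le0.
have hsW := involution_antihom (@weyl_star_inv k E).
have hsC := involution_antihom
  (@tgwc_star_inv k R V (mq_datum G k_pchar0) (@mq_mu k V) (fun _ _ _ => erefl)).
have Fstar a : F (tgwc_star a) = weyl_star (F a).
  elim/tgwc_ind: a => [r|v|v|a b IHa IHb|a IHa|a b IHa IHb].
  - by rewrite tgwc_star_rho // Frho weyl_star_rho.
  - by rewrite tgwc_star_X // FY FX weyl_star_zpow.
  - by rewrite tgwc_star_Y // FX FY weyl_star_zpow opprK.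
  - by rewrite (antihomD hsC) rmorphD IHa IHb rmorphD (antihomD hsW).
  - by rewrite (antihomN hsC) rmorphN IHa rmorphN (antihomN hsW).
  - by rewrite (antihomM hsC) rmorphM IHa IHb rmorphM (antihomM hsW).
have [|Phi PhiE] := @tgw_lift _ _ _ _ _ _ F.
  (* [F b] is a single term. Since the product of [tgwc_star b] and [b] lies in [I] and has degree
     0, it vanishes, and [weyl_star_term_eq0] gives [F b = 0]. *)
  move=> I g b hI Ib hb.
  have [p Ep] := weyl_homog_term (canonical_homog Frho FX FY hb).
  rewrite Ep; apply: weyl_star_term_eq0; rewrite -Ep -Fstar -rmorphM.
  case: hI => -[[_ _ IM] _] I0; rewrite (I0 (tgwc_star b * b)) ?rmorph0 //.
    by case: (IM (tgwc_star b) b Ib).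
  by rewrite -(addNr g); apply: homog_M => //; apply: tgwc_star_homog.
have Prho (r : R) : Phi (tgw_rho (mq_datum G k_pchar0) (@mq_mu k V) r) = rho r.
  by rewrite [LHS]PhiE [LHS]Frho.
have Pstar (a : mq_algebra G k_pchar0) : Phi (inv_star a) = weyl_star (Phi a).
  by elim/q_ind: a => a; rewrite [inv_star _]tgw_star_pi // !PhiE.
exists (@InvMap R (mq_algebra G k_pchar0) (weyl_inv k E) Phi Prho Pstar); split.
- by move=> v; rewrite [LHS]PhiE FX.
- by move=> v; rewrite [LHS]PhiE FY.
- by move=> e; rewrite [LHS]Prho weyl_rhoU.
Qed.
End Canonical.

(** * Factorization through a canonical representation *)

Section Factorization.
Variables (k : fieldType) (k0 : [pchar k] =i pred0) (V E : choiceType).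
Variables (D : tgw_datum (polyring k E) V) (mu : V -> V -> k).
Hypothesis mu_neq0 : forall i j, i != j -> mu i j != 0.
Hypothesis mu_sym : forall i j, i != j -> mu i j = mu j i.
Variable phi : inv_map (tgw_inv D mu_sym) (weyl_inv k E).

Local Notation R := (polyring k E).
Local Notation W := (weyl k E).
Local Notation Z := {malg int[E]}.
Local Notation rho := (@weyl_rho k E).
Local Notation zp := (@weyl_zpow k E).
Local Notation X := (tgw_X D mu).
Local Notation Y := (tgw_Y D mu).
Local Notation trho := (tgw_rho D mu).

Lemma phi_rho r : phi (trho r) = rho r.
Proof. exact: (inv_map_rho phi r). Qed.

Lemma phi_Y i : phi (Y i) = weyl_star (phi (X i)).
Proof. rewrite -(tgw_star_X D mu_sym i); exact: (inv_map_star phi (X i)). Qed.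

Lemma tgw_consistent : injective trho.
Proof.
move=> r s rs; apply: (@weyl_rho_inj k E); rewrite -!phi_rho.
exact: congr1 rs.
Qed.

Lemma phi_XR i p : phi (X i) * rho p = rho (tgw_sigma D i p) * phi (X i).
Proof.
have := congr1 phi (tgw_XR D mu i p).
by rewrite (rmorphM phi) (rmorphM phi) !phi_rho.
Qed.

Lemma phi_YR i p : phi (Y i) * rho p = rho (tgw_sigmaV D i p) * phi (Y i).
Proof.
have := congr1 phi (tgw_YR D mu i p).
by rewrite (rmorphM phi) (rmorphM phi) !phi_rho.
Qed.

Lemma phi_XY i : phi (X i) * phi (Y i) = rho (tgw_sigma D i (tgw_t D i)).
Proof.
have := congr1 phi (tgw_XY D mu i).
by rewrite (rmorphM phi) phi_rho.
Qed.

Lemma phi_YX i : phi (Y i) * phi (X i) = rho (tgw_t D i).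
Proof.
have := congr1 phi (tgw_YX D mu i).
by rewrite (rmorphM phi) phi_rho.
Qed.

Lemma phi_XYmu i j : i != j ->
  phi (X i) * phi (Y j) = rho (mu i j)%:A * (phi (Y j) * phi (X i)).
Proof.
move=> ij; have := congr1 phi (tgw_XYmu D mu ij).
by rewrite (rmorphM phi) (rmorphM phi) (rmorphM phi) phi_rho.
Qed.

(** The product [phi (Y i) * phi (X i)] is the image of the nonzero [t_i] under the injective map
    [rho]. *)
Lemma phi_X_neq0 i : phi (X i) <> 0.
Proof.
move=> Xi0; have := phi_YX i; rewrite Xi0 mulr0.
have -> : 0 = rho 0 by exact: esym (rmorph0 rho).
by move=> /(@weyl_rho_inj k E) t0; have := tgw_t_neq0 D i; rewrite -t0 eqxx.
Qed.

Lemma phi_X_term : exists (g : V -> Z) (r : V -> R),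
  forall i, [/\ r i != 0, phi (X i) = rho (r i) * zp (g i) &
    forall p, tgw_sigma D i p = tau (g i) p].
Proof.
have /choice[gr grP] : forall i, exists gr : Z * R,
    [/\ gr.2 != 0, phi (X i) = rho gr.2 * zp gr.1 & forall p, tgw_sigma D i p = tau gr.1 p].
  move=> i; have [g [r h]] := weyl_eigen k0 (@phi_X_neq0 i) (phi_XR i).
  by exists (g, r).
by exists (fun i => (gr i).1), (fun i => (gr i).2).
Qed.

Lemma zpow_cf_Negz (e : E) n : zpow_cf k e (Negz n) =
  pvar e * \prod_(i < n) (pvar e + (lift ord0 i)%:R).
Proof.
have h (A : pzRingType) (u P : A) : (u + 0%:R) * P = u * P by rewrite addr0.
rewrite /zpow_cf big_ord_recl; exact: h.
Qed.

(** A negative exponent contributes a rising factorial, whose first factor is u_e. *)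
Lemma zpow_coef_pvar (g : Z) e : g@_e < 0 -> exists c, zpow_coef k g = pvar e * c.
Proof.
move=> ge; have eg : e \in msupp g by rewrite -mcoeff_neq0 lt_eqF.
rewrite /zpow_coef (bigD1_seq e) //=; case: (g@_e) ge => // n _.
rewrite zpow_cf_Negz.
by eexists; exact: esym (mulrA _ _ _).
Qed.

Section Degrees.
Variables (g : V -> Z) (r : V -> R).
Hypothesis r_neq0 : forall i, r i != 0.
Hypothesis phiX : forall i, phi (X i) = rho (r i) * zp (g i).

(** [A i] and [B j] are the coefficients of [phi (X i)] in degree [g i] and of [phi (Y j)] in degree
    [- g j]. *)
Let A i := r i * zpow_coef k (g i).
Let B j := zpow_coef k (- g j) * tau (- g j) (r j).

(** Coefficient of the relation between [X i] and [Y j] in degree [g i - g j]. *)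
Lemma phi_exchange i j : i != j ->
  A i * tau (g i) (B j) = (mu i j)%:MP * (B j * tau (- g j) (A i)).
Proof.
move=> ij; have hs := involution_antihom (@weyl_star_inv k E).
have YE : phi (Y j) = zp (- g j) * rho (r j).
  by rewrite phi_Y phiX (antihomM hs) weyl_star_zpow weyl_star_rho.
have := congr1 (fun b : W => weyl_coef b (g i - g j)) (phi_XYmu ij).
rewrite YE phiX.
have -> : rho (r i) * zp (g i) * (zp (- g j) * rho (r j)) =
    rho (r i) * (zp (g i) * (zp (- g j) * (rho (r j) * 1))) by rewrite mulr1 -!mulrA.
have -> : zp (- g j) * rho (r j) * (rho (r i) * zp (g i)) =
    zp (- g j) * (rho (r j) * (rho (r i) * (zp (g i) * 1))) by rewrite mulr1 -!mulrA.
rewrite !(weyl_coef_rho, weyl_coef_zpow, weyl_coef1).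
have -> : g i - g j - g i - - g j = 0 by rewrite opprK addrAC subrK subrr.
have -> : g i - g j - - g j - g i = 0 by rewrite opprK subrK subrr.
have -> : (mu i j)%:A = (mu i j)%:MP :> R by rewrite -mul_malgC mulr1.
(* The rearrangement is done for abstract morphisms [f] and [h], which become [tau (g i)] and
   [tau (- g j)]. *)
have alg (S : comPzRingType) (f h : {rmorphism S -> S}) (a c b d m : S) :
    a * (c * f (b * h (d * 1))) = m * (b * h (d * (a * (c * f 1)))) ->
    (a * c) * f (b * h d) = m * ((b * h d) * h (a * c)).
  by rewrite !mulr1 rmorph1 mulr1 => E1; rewrite -mulrA E1 !rmorphM !mulrA.
rewrite eqxx; exact: alg.
Qed.

Lemma tauN_pshift h p : tau (- h) p = pshift (fun e => h@_e) p :> R.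
Proof. by congr (pshift _ p); apply/funext => e; rewrite mcoeffN opprK. Qed.

Lemma exchange_left_neq0 i : A i != 0.
Proof. by apply: polyring_mulf_neq0; [exact: r_neq0|exact: zpow_coef_neq0]. Qed.
Lemma exchange_right_neq0 i : B i != 0.
Proof.
by apply: polyring_mulf_neq0; [exact: zpow_coef_neq0|apply: tau_neq0; exact: r_neq0].
Qed.

Lemma phi_exchange_pshift i j : i != j -> A i * pshift (fun e => - (g i)@_e) (B j) =
  (mu i j)%:MP * (B j * pshift (fun e => (g j)@_e) (A i)).
Proof. by move=> /phi_exchange; rewrite tauN_pshift. Qed.

Lemma mu_eq1 i j : i != j -> mu i j = 1.
Proof.
move=> ij.
exact: (exchange_scalar (exchange_left_neq0 i) (exchange_right_neq0 j) (mu_neq0 ij) (phi_exchange_pshift ij)).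
Qed.

(** If both entries were negative, u_e would divide [A i]; if both were positive, it would divide
    [B j]. The exchange equation excludes either case. *)
Lemma degrees_le0 i j e : i != j -> (g i)@_e * (g j)@_e <= 0.
Proof.
move=> ij; rewrite leNgt; apply/negP => gt0.
have [i0|i0|i0] := ltgtP (g i)@_e 0; last by rewrite i0 mul0r in gt0.
  have j0 : (g j)@_e < 0 by rewrite -(nmulr_rgt0 _ i0).
  have [c Ec] := zpow_coef_pvar i0.
  have EA : A i = pvar e * (r i * c) by rewrite /A Ec; exact: mulrCA.
  exact: (exchange_neg k0 (exchange_left_neq0 i) (exchange_right_neq0 j) (mu_neq0 ij) (phi_exchange_pshift ij) i0 j0 EA).
have j0 : 0 < (g j)@_e by rewrite -(pmulr_rgt0 _ i0).
have [|c Ec] := @zpow_coef_pvar (- g j) e; first by rewrite mcoeffN oppr_lt0.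
have EB : B j = pvar e * (c * tau (- g j) (r j)) by rewrite /B Ec; exact: esym (mulrA _ _ _).
exact: (exchange_pos k0 (exchange_left_neq0 i) (exchange_right_neq0 j) (mu_neq0 ij) (phi_exchange_pshift ij) i0 j0 EB).
Qed.
End Degrees.

Lemma factors_through_exists : exists G : multiquiver V E, factors_through k0 phi G.
Proof.
have [g [r grP]] := phi_X_term.
have r_neq0 i : r i != 0 by case: (grP i).
have phiX i : phi (X i) = rho (r i) * zp (g i) by case: (grP i).
have [G GE] := multiquiver_exists (fun i j e => @degrees_le0 g r r_neq0 phiX i j e).
have [phiG cG] := canonical_rep_exists G k0.
exists G; case: (cG) => GX GY _.
pose D' := mq_datum G k0; pose mu' := @mq_mu k V.
pose T := tgw D' mu'.
have Grho p : phiG (tgw_rho D' mu' p) = rho p by exact: (inv_map_rho phiG p).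
(* Identities between elements of the same degree can be tested in the Weyl algebra, since [phiG] is
   injective on R. *)
have key d (a b : T) : tgw_homog d a -> tgw_homog d b -> phiG a = phiG b -> a = b.
  move=> ha hb ab; apply/eqP; rewrite -subr_eq0; apply/eqP.
  have mu'0 i j : i != j -> mu' i j != 0 by move=> _; exact: oner_neq0.
  have psi_inj : injective (phiG \o tgw_rho D' mu').
    move=> p q /= pq; apply: (@weyl_rho_inj k E).
    exact: etrans (esym (Grho p)) (etrans pq (Grho q)).
  apply: (tgw_homog_inj mu'0 psi_inj (tgw_homogB ha hb)).
  apply: etrans (rmorphB phiG a b) _; apply/eqP; rewrite subr_eq0; exact/eqP.
(* The images of [X v] and [Y v] under xi, chosen so that [phiG] maps them to [phi (X v)] and
   [phi (Y v)]. *)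
pose hx v : T := tgw_rho D' mu' (r v) * tgw_X D' mu' v.
pose hy v : T := tgw_Y D' mu' v * tgw_rho D' mu' (r v).
have hsT := involution_antihom (tgw_star_inv D' (fun (i j : V) (_ : i != j) => erefl (mu' i j))).
have star_hx v : tgw_star (hx v) = hy v.
  rewrite (antihomM hsT) tgw_star_X // tgw_star_rho //.
have Ghx v : phiG (hx v) = phi (X v).
  by rewrite phiX (rmorphM phiG) Grho GX GE.
have Ghy v : phiG (hy v) = phi (Y v).
  rewrite phi_Y -Ghx -star_hx; exact: (inv_map_star phiG (hx v)).
have hom_x v : tgw_homog << v >> (hx v).
  by rewrite -[<< v >>]add0r; apply: tgw_homogM; [exact: tgw_homog_rho|exact: tgw_homog_X].
have hom_y v : tgw_homog (- << v >>) (hy v).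
  by rewrite -[- << v >>]addr0; apply: tgw_homogM; [exact: tgw_homog_Y|exact: tgw_homog_rho].
have hom_r p : tgw_homog 0 (tgw_rho D' mu' p) by exact: tgw_homog_rho.
have GM (a b : T) : phiG (a * b) = phiG a * phiG b by exact: (rmorphM phiG).
clearbody hx hy.
(* For each defining relation both sides have the same degree and, by the corresponding relation for
   [phi], the same image. *)
have [| | | | |F [Frho FX FY]] := @tgwc_lift k R V D mu T (tgw_rho D' mu') hx hy.
- move=> v p; apply: (key << v >>).
  + by rewrite -[<< v >>]addr0; exact: tgw_homogM (hom_x v) (hom_r p).
  + by rewrite -[<< v >>]add0r; exact: tgw_homogM (hom_r _) (hom_x v).
  + by rewrite !GM !Grho Ghx phi_XR.
- move=> v p; apply: (key (- << v >>)).
  + by rewrite -[- << v >>]addr0; exact: tgw_homogM (hom_y v) (hom_r p).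
  + by rewrite -[- << v >>]add0r; exact: tgw_homogM (hom_r _) (hom_y v).
  + by rewrite !GM !Grho Ghy phi_YR.
- move=> v; apply: (key 0).
  + by rewrite -(addNr << v >>); exact: tgw_homogM (hom_y v) (hom_x v).
  + exact: hom_r.
  + by rewrite !GM !Grho Ghx Ghy phi_YX.
- move=> v; apply: (key 0).
  + by rewrite -(subrr << v >>); exact: tgw_homogM (hom_x v) (hom_y v).
  + exact: hom_r.
  + by rewrite !GM !Grho Ghx Ghy phi_XY.
- move=> i j ij; apply: (key (<< i >> - << j >>)).
  + exact: tgw_homogM (hom_x i) (hom_y j).
  + rewrite -[_ - _]add0r [_ - _]addrC.
    exact: tgw_homogM (hom_r _) (tgw_homogM (hom_y j) (hom_x i)).
  + by rewrite !GM !Grho Ghx Ghy phi_XYmu.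
have Fhom d a : tgwc_homog d a -> tgw_homog d (F a).
  elim=> {d a} [p|v|v|d|d a b _ IHa _ IHb|d e a b _ IHa _ IHb].
  - by rewrite Frho; exact: hom_r.
  - by rewrite FX; exact: hom_x.
  - by rewrite FY; exact: hom_y.
  - by rewrite rmorph0; exists 0; [exact: homog_0|exact: rmorph0].
  - by rewrite rmorphB; exact: tgw_homogB.
  - by rewrite rmorphM; exact: tgw_homogM.
have GF a : phiG (F a) = phi (tgw_pi a).
  elim/tgwc_ind: a => [p|v|v|a b IHa IHb|a IHa|a b IHa IHb].
  - by rewrite Frho Grho; exact: esym (phi_rho p).
  - by rewrite FX Ghx.
  - by rewrite FY Ghy.
  - by rewrite !rmorphD IHa IHb.
  - by rewrite !rmorphN IHa.
  - by rewrite !rmorphM IHa IHb.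
(* A homogeneous [b] in a null ideal has [phiG (F b) = phi (tgw_pi b) = 0], so [key] gives
   [F b = 0]. *)
have [|Xi XiE] := @tgw_lift _ _ _ _ _ _ F.
  move=> I d b hI Ib hb; apply: (key d); first exact: Fhom.
    by exists 0; [exact: homog_0|exact: rmorph0].
  rewrite GF (null_ideal_tgw_pi hI Ib); exact: etrans (rmorph0 phi) (esym (rmorph0 phiG)).
have Xirho (p : R) : Xi (tgw_rho D mu p) = tgw_rho D' mu' p.
  by rewrite [LHS]XiE Frho.
have hsC := involution_antihom (tgwc_star_inv D mu_sym).
have Fstar a : F (tgwc_star a) = tgw_star (F a).
  elim/tgwc_ind: a => [p|v|v|a b IHa IHb|a IHa|a b IHa IHb].
  - by rewrite tgwc_star_rho // Frho tgw_star_rho.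
  - by rewrite tgwc_star_X // FY FX star_hx.
  - rewrite tgwc_star_Y // FX FY -star_hx.
    by case: (tgw_star_inv D' (fun (i j : V) (_ : i != j) => erefl (mu' i j))) => _ _ ->.
  - by rewrite (antihomD hsC) rmorphD IHa IHb rmorphD (antihomD hsT).
  - by rewrite (antihomN hsC) rmorphN IHa rmorphN (antihomN hsT).
  - by rewrite (antihomM hsC) rmorphM IHa IHb rmorphM (antihomM hsT).
have Xistar (a : tgw_inv D mu_sym) : Xi (inv_star a) = tgw_star (Xi a).
  by elim/q_ind: a => a; rewrite [inv_star _]tgw_star_pi // !XiE.
exists (@InvMap R (tgw_inv D mu_sym) (mq_algebra G k0) Xi Xirho Xistar), phiG; split=> //.
- by move=> d _ [c hc <-]; rewrite [X in tgw_homog d X]XiE; exact: Fhom.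
- by elim/q_ind=> a; rewrite [Xi _]XiE GF.
Qed.

(** As xi is graded, [phi (X i)] commutes with R like the column [mq_incidence G i]; being nonzero,
    it is a single term of that degree. *)
Lemma factors_through_degree G : factors_through k0 phi G -> forall i,
  exists2 r, r != 0 & phi (X i) = rho r * zp (mq_incidence G i).
Proof.
move=> [xi [phiG [xi_gr [GX GY _] phiE]]] i.
have [c hc Ec] := xi_gr _ _ (tgw_homog_X D mu i).
pose F : {rmorphism tgwc (mq_datum G k0) (@mq_mu k V) -> W} :=
  phiG \o @tgw_pi _ _ _ (mq_datum G k0) (@mq_mu k V).
have Frho p : F (tgwc_rho _ _ p) = rho p by exact: (inv_map_rho phiG p).
have hom : weyl_homog (mq_incidence G i) (phi (X i)).
  rewrite phiE -Ec -inc_linU.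
  exact: (@canonical_homog k V E G k0 F Frho GX GY _ _ hc).
have [d [r [r0 Ea dE]]] := weyl_eigen k0 (@phi_X_neq0 i) hom.
by exists r; rewrite // (tau_inj k0 dE).
Qed.

(** A nonzero single term has only one degree, so the two incidence matrices agree column by
    column. *)
Lemma factors_through_unique G G' :
  factors_through k0 phi G -> factors_through k0 phi G' -> G = G'.
Proof.
move=> fG fG'; apply: multiquiver_eq => e v; rewrite -!mq_incidenceE.
have [p p0 Ep] := factors_through_degree fG v.
have [q q0 Eq] := factors_through_degree fG' v.
suff -> : mq_incidence G v = mq_incidence G' v by [].
have c1 : weyl_coef (phi (X v)) (mq_incidence G v) = p * zpow_coef k (mq_incidence G v).
  by rewrite Ep weyl_coef_term eqxx.
apply/eqP/negPn/negP => ne.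
have c2 : weyl_coef (phi (X v)) (mq_incidence G v) = 0.
  by rewrite Eq weyl_coef_term (negPf ne).
have := polyring_mulf_neq0 p0 (@zpow_coef_neq0 k E (mq_incidence G v)).
by rewrite -c1 c2 eqxx.
Qed.

End Factorization.

Theorem theorem4p21 (k : fieldType) (k0 : [pchar k] =i pred0)
    (V E : choiceType) (D : tgw_datum (polyring k E) V) (mu : V -> V -> k)
    (mu_neq0 : forall i j, i != j -> mu i j != 0)
    (mu_sym : forall i j, i != j -> mu i j = mu j i)
    (phi : inv_map (tgw_inv D mu_sym) (weyl_inv k E)) :
  [/\ injective (inv_rho (tgw_inv D mu_sym)),
      exists G : multiquiver V E, factors_through k0 phi G
    & (forall i, phi (tgw_X D mu i) <> 0) ->
      (forall G G' : multiquiver V E,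
         factors_through k0 phi G -> factors_through k0 phi G' -> G = G') /\
      (forall i j, i != j -> mu i j = 1)].
Proof.
split.
- exact: tgw_consistent phi.
- exact: factors_through_exists.
- move=> _; split; first exact: factors_through_unique.
  have [g [r grP]] := phi_X_term k0 phi.
  have r_neq0 i : r i != 0 by case: (grP i).
  have phiX i : phi (tgw_X D mu i) = weyl_rho (r i) * weyl_zpow (g i) by case: (grP i).
  by move=> i j; exact: mu_eq1 r_neq0 phiX i j.
Qed.
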